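(* Let $(M^m,g)$ be a smooth Riemannian manifold of dimension $m$, let $\iota\colon L^n\to M$ be a smooth immersion of a closed manifold $L$ of dimension $n\geq 1$, equipped with the induced metric, and let $\Omega\subset M$ be a subset with $\iota(L)\subset\Omega$. Let $H$ be the mean curvature vector of $\iota$. Then $$\operatorname{ave}(|H|)\geq\Theta_n(\Omega).$$
   Context: ''Closed'' means compact without boundary. $H=\sum_{i=1}^n \mathrm{II}(e_i,e_i)$ for any orthonormal basis $(e_1,\dots,e_n)$ of $T_pL$, where $\mathrm{II}$ is the (normal-bundle-valued) second fundamental form of $\iota$ (no division by $n$). For a continuous function $\varphi$ on $L$, $\operatorname{ave}(\varphi)=\frac{1}{\operatorname{vol}(L)}\int_L\varphi\,dV$, with $dV$ the Riemannian volume measure of the induced metric. For a nonempty subset $\Omega\subset M$ and a smooth function $f$ on an open neighborhood of $\Omega$ in $M$, set $$A_n(f,\Omega)=\inf_{q\in\Omega,\;P\in \mathrm{Gr}_n(T_qM)}\operatorname{tr}_P(\nabla^2 f),\qquad \operatorname{tr}_P(\nabla^2 f)=\sum_{i=1}^n\nabla^2 f(e_i,e_i),$$ where $\mathrm{Gr}_n(T_qM)$ is the set of $n$-dimensional linear subspaces of $T_qM$, $(e_1,\dots,e_n)$ is any orthonormal basis of $P$, and $\nabla^2 f$ is the Riemannian Hessian. Define $$\Theta_n(\Omega)=\sup\bigl\{A_n(f,\Omega): f \text{ smooth on an open neighborhood of }\Omega\text{ in }M,\ \sup_\Omega|\nabla f|\leq 1\bigr\}.$$ *)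

(* Defs.v *)
From HB Require Import structures.
From mathcomp Require Import all_boot all_order all_algebra.
From mathcomp Require Import all_classical all_reals all_analysis.
From mathcomp Require Import measurable_realfun.
Set Implicit Arguments.
Unset Strict Implicit.
Unset Printing Implicit Defensive.
Import Order.TTheory GRing.Theory Num.Theory.
Import numFieldNormedType.Exports.
Local Open Scope classical_set_scope.
Local Open Scope ring_scope.

(* C^k and C^oo on an open set U; only the values of f on U matter. *)
Fixpoint Ck (R : realType) (V W : normedModType R) (k : nat) (U : set V)
    (f : V -> W) : Prop :=
  match k with
  | 0 => forall x, U x -> {for x, continuous f}
  | k'.+1 => (forall x, U x -> differentiable f x) /\
             (forall v, Ck k' U (fun x => 'D_v f x))
  end.

Definition smooth_on (R : realType) (V W : normedModType R) (U : set V)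
    (f : V -> W) : Prop := forall k, Ck k U f.

Definition partial (R : realType) (m : nat) (W : normedModType R) (i : 'I_m)
    (f : 'rV[R]_m -> W) (x : 'rV[R]_m) : W := 'D_(delta_mx 0 i) f x.

(* coord and cinv are total functions, meaningful on cdom and on
   coord @` cdom respectively. *)
Record chart (R : realType) (T : topologicalType) (m : nat) := Chart {
  cdom : set T;
  coord : T -> 'rV[R]_m;
  cinv : 'rV[R]_m -> T;
  cdom_open : open cdom;
  cimg_open : open (coord @` cdom);
  coordK : forall p, cdom p -> cinv (coord p) = p;
  coord_continuous : forall p, cdom p -> {for p, continuous coord};
  cinv_continuous : forall x, (coord @` cdom) x -> {for x, continuous cinv}
}.

Definition cimg (R : realType) (T : topologicalType) (m : nat)
    (c : chart R T m) : set 'rV[R]_m := coord c @` cdom c.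

(* Nonempty (pointed) m-manifolds without boundary.  The atlas need not be
   maximal.  As part of the data, each point p comes with a preferred chart
   chart_at p around it: the tangent space at p is represented by 'rV[R]_m,
   a row vector being the components of a tangent vector in the coordinate
   basis of chart_at p. *)
Record manifold (R : realType) (m : nat) := Manifold {
  msort :> ptopologicalType;
  manifold_hausdorff : hausdorff_space msort;
  manifold_second_countable : @second_countable msort;
  atlas : set (chart R msort m);
  chart_at : msort -> chart R msort m;
  chart_at_atlas : forall p, atlas (chart_at p);
  chart_at_dom : forall p, cdom (chart_at p) p;
  atlas_smooth : forall c c', atlas c -> atlas c' ->
    smooth_on (coord c @` (cdom c `&` cdom c')) (coord c' \o cinv c)
}.

Definition smooth_fun (R : realType) (m : nat) (M : manifold R m) (U : set M)
    (f : M -> R) : Prop :=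
  forall c, atlas c -> smooth_on (coord c @` (cdom c `&` U)) (f \o cinv c).

Definition smooth_map (R : realType) (n m : nat) (L : manifold R n)
    (M : manifold R m) (F : L -> M) : Prop :=
  continuous F /\
  forall c c', atlas c -> atlas c' ->
    smooth_on (coord c @` (cdom c `&` F @^-1` cdom c'))
              (coord c' \o F \o cinv c).

(* F read in the preferred charts at p and at F p. *)
Definition local_rep (R : realType) (n m : nat) (L : manifold R n)
    (M : manifold R m) (F : L -> M) (p : L) : 'rV[R]_n -> 'rV[R]_m :=
  coord (chart_at (F p)) \o F \o cinv (chart_at p).

Definition dmap (R : realType) (n m : nat) (L : manifold R n)
    (M : manifold R m) (F : L -> M) (p : L) (u : 'rV[R]_n) : 'rV[R]_m :=
  'D_u (local_rep F p) (coord (chart_at p) p).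

Definition immersion (R : realType) (n m : nat) (L : manifold R n)
    (M : manifold R m) (F : L -> M) : Prop :=
  smooth_map F /\ forall p, injective (dmap F p).

Definition dfun (R : realType) (m : nat) (M : manifold R m) (f : M -> R)
    (p : M) (v : 'rV[R]_m) : R :=
  'D_v (f \o cinv (chart_at p)) (coord (chart_at p) p).

(* The i-th coordinate vector of the chart c at the point p = cinv c x, as an
   element of the tangent space at p, i.e. in components of chart_at p. *)
Definition coord_vec (R : realType) (m : nat) (M : manifold R m)
    (c : chart R M m) (x : 'rV[R]_m) (i : 'I_m) : 'rV[R]_m :=
  partial i (coord (chart_at (cinv c x)) \o cinv c) x.

Definition dot (R : realType) (m : nat) (B : 'M[R]_m) (u v : 'rV[R]_m) : R :=
  (u *m B *m v^T) 0 0.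

(* A metric g is given at p by the Gram matrix of the inner product on the
   tangent space at p; local_metric g c is its matrix (g_ij) in the chart c. *)
Definition local_metric (R : realType) (m : nat) (M : manifold R m)
    (g : M -> 'M[R]_m) (c : chart R M m) (x : 'rV[R]_m) : 'M[R]_m :=
  \matrix_(i, j) dot (g (cinv c x)) (coord_vec c x i) (coord_vec c x j).

Definition riemannian_metric (R : realType) (m : nat) (M : manifold R m)
    (g : M -> 'M[R]_m) : Prop :=
  [/\ forall p, (g p)^T = g p,
      forall p u, u != 0 -> 0 < dot (g p) u u
    & forall c, atlas c -> smooth_on (cimg c) (local_metric g c)].

Definition metric_norm (R : realType) (m : nat) (M : manifold R m)
    (g : M -> 'M[R]_m) (p : M) (u : 'rV[R]_m) : R := Num.sqrt (dot (g p) u u).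

Definition induced_metric (R : realType) (n m : nat) (L : manifold R n)
    (M : manifold R m) (g : M -> 'M[R]_m) (F : L -> M) (p : L) : 'M[R]_n :=
  \matrix_(a, b) dot (g (F p)) (dmap F p (delta_mx 0 a))
                               (dmap F p (delta_mx 0 b)).

(* e is an orthonormal basis of P for the inner product with matrix B. *)
Definition onbasis (R : realType) (m k : nat) (B : 'M[R]_m)
    (P : {vspace 'rV[R]_m}) (e : k.-tuple 'rV[R]_m) : Prop :=
  basis_of P e /\
  forall a b, dot B (tnth e a) (tnth e b) = (a == b)%:R.

(* Christoffel symbol Gamma^k_ij of the Levi-Civita connection. *)
Definition christoffel (R : realType) (m : nat) (M : manifold R m)
    (g : M -> 'M[R]_m) (c : chart R M m) (x : 'rV[R]_m) (i j k : 'I_m) : R :=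
  2^-1 * \sum_l invmx (local_metric g c x) k l *
    (partial i (fun y => local_metric g c y j l) x +
     partial j (fun y => local_metric g c y i l) x -
     partial l (fun y => local_metric g c y i j) x).

(* xget picks the unique vector representing the differential. *)
Definition grad (R : realType) (m : nat) (M : manifold R m)
    (g : M -> 'M[R]_m) (f : M -> R) (p : M) : 'rV[R]_m :=
  xget 0 [set w | forall v, dot (g p) w v = dfun f p v].

Definition hessian (R : realType) (m : nat) (M : manifold R m)
    (g : M -> 'M[R]_m) (f : M -> R) (p : M) (u v : 'rV[R]_m) : R :=
  let c := chart_at p in
  let x := coord c p in
  let f' := f \o cinv c in
  \sum_i \sum_j u 0 i * v 0 j *
    (partial i (partial j f') x -
     \sum_k christoffel g c x i j k * partial k f' x).

(* Component of w normal to the image of dmap F p: xget picks the unique w'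
   orthogonal to that image and such that w - w' is tangent. *)
Definition normal_part (R : realType) (n m : nat) (L : manifold R n)
    (M : manifold R m) (g : M -> 'M[R]_m) (F : L -> M) (p : L)
    (w : 'rV[R]_m) : 'rV[R]_m :=
  xget 0 [set w' | (forall u, dot (g (F p)) w' (dmap F p u) = 0) /\
                   exists u, w = w' + dmap F p u].

(* Ambient covariant derivative at p, along u, of the push-forward by F of the
   field with constant components v in the chart chart_at p. *)
Definition ambient_deriv (R : realType) (n m : nat) (L : manifold R n)
    (M : manifold R m) (g : M -> 'M[R]_m) (F : L -> M) (p : L)
    (u v : 'rV[R]_n) : 'rV[R]_m :=
  let x := coord (chart_at p) p in
  let y := coord (chart_at (F p)) (F p) in
  \row_k ('D_u (fun z => 'D_v (local_rep F p) z) x 0 k +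
          \sum_i \sum_j christoffel g (chart_at (F p)) y i j k *
            dmap F p u 0 i * dmap F p v 0 j).

Definition second_fundamental_form (R : realType) (n m : nat)
    (L : manifold R n) (M : manifold R m) (g : M -> 'M[R]_m) (F : L -> M)
    (p : L) (u v : 'rV[R]_n) : 'rV[R]_m :=
  normal_part g F p (ambient_deriv g F p u v).

(* Trace of the second fundamental form over an orthonormal basis of the
   tangent space; the result does not depend on the basis picked by xget. *)
Definition mean_curvature (R : realType) (n m : nat) (L : manifold R n)
    (M : manifold R m) (g : M -> 'M[R]_m) (F : L -> M) (p : L) : 'rV[R]_m :=
  let e : n.-tuple 'rV[R]_n :=
    xget [tuple 0 | _ < n]
      [set e : n.-tuple 'rV[R]_n | onbasis (induced_metric g F p) fullv e] in
  \sum_(a < n) second_fundamental_form g F p (tnth e a) (tnth e a).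

Notation borel T := (g_sigma_algebraType (@open T)).

(* Lebesgue integral over R^n as an iterated integral; by Tonelli this is the
   integral against n-dimensional Lebesgue measure for nonnegative Borel f,
   the only functions it is used for. *)
Fixpoint lebesgue_int (R : realType) (n : nat) :
    ('rV[R]_n -> \bar R) -> \bar R :=
  match n with
  | 0 => fun f => f 0
  | n'.+1 => fun f =>
      (\int[lebesgue_measure]_(t in [set: R])
         lebesgue_int (fun y : 'rV[R]_n' =>
           f (row_mx (t%:M : 'rV[R]_1) y : 'rV[R]_(1 + n'))))%E
  end.

(* mu is the Riemannian volume measure of h: in every chart of the atlas,
   dV = sqrt (det h_ij) dx.  This determines the Borel measure mu. *)
Definition riemannian_volume (R : realType) (n : nat) (L : manifold R n)
    (h : L -> 'M[R]_n) (mu : {measure set (borel L) -> \bar R}) : Prop :=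
  forall c : chart R L n, atlas c ->
  forall phi : borel L -> \bar R,
    measurable_fun setT phi -> (forall p, 0 <= phi p)%E ->
    (\int[mu]_(p in cdom c) phi p =
     lebesgue_int
       ((fun x => phi (cinv c x) *
                  (Num.sqrt (\det (local_metric h c x)))%:E) \_ (cimg c)))%E.

Definition ave (R : realType) (n : nat) (L : manifold R n)
    (mu : {measure set (borel L) -> \bar R}) (phi : borel L -> R) : R :=
  (fine (mu setT))^-1 * \int[mu]_(p in setT) phi p.

(* A_n(f, Omega); P ranges over the n-dimensional subspaces of the tangent
   space at q, e over the orthonormal bases of P. *)
Definition hess_trace_inf (R : realType) (m : nat) (M : manifold R m)
    (g : M -> 'M[R]_m) (n : nat) (f : M -> R) (Omega : set M) : \bar R :=
  ereal_inf [set s | exists (q : M) (P : {vspace 'rV[R]_m})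
                            (e : n.-tuple 'rV[R]_m),
    [/\ Omega q, \dim P = n, onbasis (g q) P e
      & s = (\sum_(a < n) hessian g f q (tnth e a) (tnth e a))%:E]].

Definition Theta (R : realType) (m : nat) (M : manifold R m)
    (g : M -> 'M[R]_m) (n : nat) (Omega : set M) : \bar R :=
  ereal_sup [set hess_trace_inf g n f Omega | f in
    [set f : M -> R | (exists U : set M,
       [/\ open U, Omega `<=` U & smooth_fun U f]) /\
     (ereal_sup [set (metric_norm g q (grad g f q))%:E | q in Omega] <= 1)%E]].

(* Main.v *)
Require Import Defs.
From mathcomp Require Import all_boot all_order all_algebra.
From mathcomp Require Import all_classical all_reals all_analysis.
From mathcomp Require Import measurable_realfun.
From mathcomp Require Import ring lra perm.
Set Implicit Arguments.
Unset Strict Implicit.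
Unset Printing Implicit Defensive.
Import Order.TTheory GRing.Theory Num.Theory.
Import numFieldNormedType.Exports.
Local Open Scope classical_set_scope.
Local Open Scope ring_scope.

(** Let f be a smooth function near Omega whose gradient has norm at most 1
    on Omega, and let u be its pull-back to L. By the Gauss formula the
    Hessian of u is the ambient Hessian of f on tangent vectors plus the
    derivative of f along the second fundamental form ([hess_restriction]).
    Its trace is the identity
      Laplacian of u = trace over T_p L of the Hessian of f + df (H)
    ([laplacian_restriction]), in which the first term is at least
    A_n (f, Omega) and the second at least -|H|; hence
      A_n (f, Omega) <= Laplacian of u + |H|
    at every point ([laplacian_lower_bound]). Since L is closed the Laplacian
    of u integrates to zero ([integral_laplacian]); averaging over L gives
    A_n (f, Omega) <= ave (|H|), and it remains to take the supremum over f.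

    All tensors are handled in coordinates. The central object is [sff],
    which for a map phi between open sets with metrics G' and G is the
    ambient second derivative of phi corrected by both Christoffel terms. It
    is what separates the Hessian of f o phi from the Hessian of f
    ([hess_comp]), and for an isometric phi the Koszul formula shows that it
    is orthogonal to the image of the differential of phi ([sff_normal]). For
    a coordinate change this means that it vanishes, so that Hessians and
    Laplacians do not depend on the chart ([hess_trans], [laplacian_chart]);
    for the immersion it means that [sff] is the second fundamental form
    ([second_fundamental_formE]).

    For the integral of the Laplacian, a partition of unity made of C^2
    functions reduces to functions supported in one chart. There the
    Laplacian times the volume density is a divergence ([lapl_div], from the
    Jacobi formula for the derivative of a determinant), and the integral of
    a partial derivative of a compactly supported function vanishes by
    translation invariance of the integral ([eint_derive]). The Euclidean
    integral being an iterated one, its finiteness, linearity and translation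
    invariance are established by induction on the dimension for continuous
    functions with bounded support ([eint_goodP], [eint_shift]).

    Averaging needs that the volume of L is finite and positive
    ([volume_finite]) and that |H| is integrable, which follows from its
    continuity. The latter is not apparent in the definition, where bases and
    charts are chosen point by point; it follows from an expression of H in
    fixed charts through the inverse metric ([mean_curvature_chart]). *)

(** * Differential calculus *)

Section Calculus.
Context {R : realType}.
Implicit Types V W : normedModType R.

Lemma derive_comp V W (X : normedModType R) (f : V -> W) (g : W -> X) x v :
  differentiable f x -> differentiable g (f x) ->
  'D_v (fun y => g (f y)) x = 'D_('D_v f x) g (f x).
Proof.
move=> df dg.
rewrite deriveE; last exact: differentiable_comp.
by rewrite (diff_comp df dg) /= !deriveE.
Qed.

Lemma derive_dirP V W (f : V -> W) x a u v :
  differentiable f x ->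
  'D_(a *: u + v) f x = a *: 'D_u f x + 'D_v f x.
Proof. by move=> df; rewrite !deriveE// linearP. Qed.

Lemma derive_dirD V W (f : V -> W) x u v :
  differentiable f x -> 'D_(u + v) f x = 'D_u f x + 'D_v f x.
Proof. by move=> df; rewrite !deriveE// linearD. Qed.

Lemma derive_dirZ V W (f : V -> W) x a u :
  differentiable f x -> 'D_(a *: u) f x = a *: 'D_u f x.
Proof. by move=> df; rewrite !deriveE// linearZ. Qed.

Lemma derive_dirB V W (f : V -> W) x u v :
  differentiable f x -> 'D_(u - v) f x = 'D_u f x - 'D_v f x.
Proof. by move=> df; rewrite !deriveE// linearB. Qed.

Lemma derive_dir_sum V W (f : V -> W) x (I : Type) (r : seq I) (P : pred I) (F : I -> V) :
  differentiable f x -> 'D_(\sum_(i <- r | P i) F i) f x = \sum_(i <- r | P i) 'D_(F i) f x.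
Proof.
move=> df; elim/big_rec2 : _ => [|i y1 y2 _ <-]; first exact: derive0.
exact: derive_dirD.
Qed.

Lemma derive_partial m W (f : 'rV[R]_m -> W) x v :
  differentiable f x -> 'D_v f x = \sum_i v 0 i *: partial i f x.
Proof.
move=> df; rewrite {1}(row_sum_delta v) derive_dir_sum//.
by apply: eq_bigr => i _; rewrite derive_dirZ.
Qed.

Lemma near_open V (U : set V) (P : V -> Prop) x :
  open U -> U x -> (forall y, U y -> P y) -> \forall y \near x, P y.
Proof. by move=> oU Ux h; near do apply: h; exact: open_nbhs_nbhs. Unshelve. all: by end_near. Qed.

(** Differentiability is a statement on germs: the two expansions at x have
    the same remainder near x. *)
Lemma near_eq_differentiable V W (f g : V -> W) x :
  (\near x, f x = g x) -> differentiable f x -> differentiable g x.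
Proof.
move=> fg df.
have fgx : f x = g x by exact: nbhs_singleton fg.
have [dc dfE] := (diff_locallyP x f).1 df.
have H : g \o shift x = cst (g x) + 'd f x +o_ 0 id.
  apply: eqaddoE; move/eqaddoP: dfE => dfE; apply/eqaddoP => e e0.
  have {}dfE := dfE e e0.
  have fg0 : \forall h \near 0, f (h + x) = g (h + x).
    by move: fg; rewrite (near_shift 0 x) /= subr0.
  near=> h.
  have : (f \o shift x - (cst (f x) + 'd f x)) h =
         (g \o shift x - (cst (g x) + 'd f x)) h.
    have fgh : f (h + x) = g (h + x) by near: h.
    by rewrite !fctE /= fgh fgx.
  by move=> <-; near: h.
have dE : 'd g x = 'd f x :> (V -> W) by apply: diff_unique.
by apply/diff_locallyP; rewrite dE.
Unshelve. all: by end_near. Qed.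

Lemma differentiable_mx V m n (F : V -> 'M[R]_(m, n)) x :
  (forall i j, differentiable (fun y => F y i j) x) -> differentiable F x.
Proof.
move=> h.
have -> : F = \sum_(i < m) \sum_(j < n) (fun y => F y i j *: delta_mx i j).
  apply/funext => y; rewrite {1}(matrix_sum_delta (F y)) fct_sumE.
  by apply: eq_bigr => i _; rewrite fct_sumE.
by apply: differentiable_sum => i; apply: differentiable_sum => j; apply: differentiableZl.
Qed.

Lemma differentiable_entry V m n (F : V -> 'M[R]_(m, n)) x i j :
  differentiable F x -> differentiable (fun y => F y i j) x.
Proof.
move=> dF.
exact: (@differentiable_comp _ V _ _ F (fun N : 'M[R]_(m, n) => N i j) x dF
  (differentiable_coord _ _ _)).
Qed.

Lemma derive_entry V m n (F : V -> 'M[R]_(m, n)) x v i j :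
  differentiable F x -> ('D_v F x) i j = 'D_v (fun y => F y i j) x.
Proof. by move=> dF; rewrite derive_mx ?mxE//; exact: diff_derivable. Qed.

Lemma derive_mulr V (f g : V -> R) x v : differentiable f x -> differentiable g x ->
  'D_v (fun y => f y * g y) x = 'D_v f x * g x + f x * 'D_v g x.
Proof.
move=> df dg; rewrite [LHS](@deriveM _ _ f g)//; [|exact: diff_derivable..].
by rewrite /GRing.scale/= addrC mulrC.
Qed.

Lemma derive_add V W (f g : V -> W) x v : differentiable f x -> differentiable g x ->
  'D_v (fun y => f y + g y) x = 'D_v f x + 'D_v g x.
Proof. by move=> df dg; rewrite [LHS](@deriveD _ _ _ f g)//; exact: diff_derivable. Qed.

Lemma derive_sub V W (f g : V -> W) x v : differentiable f x -> differentiable g x ->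
  'D_v (fun y => f y - g y) x = 'D_v f x - 'D_v g x.
Proof. by move=> df dg; rewrite [LHS](@deriveB _ _ _ f g)//; exact: diff_derivable. Qed.

Lemma differentiable_fsum V W (I : Type) (r : seq I) (P : pred I) (f : I -> V -> W) x :
  (forall i, P i -> differentiable (f i) x) ->
  differentiable (fun y => \sum_(i <- r | P i) f i y) x.
Proof.
move=> h; rewrite (_ : (fun _ => _) = \sum_(i <- r | P i) f i); last first.
  by apply/funext => y; rewrite fct_sumE.
elim/big_rec : _ => [|i g Pi dg]; first exact: differentiable_cst.
by apply: differentiableD => //; exact: h.
Qed.

Lemma derive_fsum V W (I : Type) (r : seq I) (P : pred I) (f : I -> V -> W) x v :
  (forall i, P i -> differentiable (f i) x) ->
  'D_v (fun y => \sum_(i <- r | P i) f i y) x = \sum_(i <- r | P i) 'D_v (f i) x.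
Proof.
move=> h; elim: r => [|a r IH].
  rewrite big_nil (_ : (fun _ => _) = cst 0) ?derive_cst//.
  by apply/funext => y; rewrite big_nil.
rewrite big_cons; case: ifPn => Pa; last first.
  by rewrite -IH; congr ('D_v _ x); apply/funext => y; rewrite big_cons (negbTE Pa).
rewrite -IH -derive_add; [|exact: h|exact: differentiable_fsum].
by congr ('D_v _ x); apply/funext => y; rewrite big_cons Pa.
Qed.

Lemma derive_scaler V W (f : V -> W) (a : R) x v : differentiable f x ->
  'D_v (fun y => a *: f y) x = a *: 'D_v f x.
Proof. by move=> df; rewrite [LHS](@deriveZ _ _ _ f)//; exact: diff_derivable. Qed.

(** * C^k functions *)

Lemma Ck_derive V W k (U : set V) (f : V -> W) v : Ck k.+1 U f -> Ck k U ('D_v f).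
Proof. by case=> _; apply. Qed.

Lemma Ck_differentiable V W k (U : set V) (f : V -> W) x :
  Ck k.+1 U f -> U x -> differentiable f x.
Proof. by case=> + _; apply. Qed.

Lemma Ck_ext V W k (U : set V) (f g : V -> W) :
  open U -> (forall x, U x -> f x = g x) -> Ck k U f -> Ck k U g.
Proof.
move=> oU; elim: k f g => [|k IH] f g fg /=.
  move=> h x Ux; rewrite /prop_for /continuous_at -fg//.
  apply: cvg_trans (h x Ux); apply: near_eq_cvg.
  by apply: (near_open oU Ux) => y Uy; rewrite fg.
move=> [df h]; split=> [x Ux|v].
  by apply: near_eq_differentiable (df x Ux); exact: near_open fg.
apply: IH (h v) => x Ux; apply: near_eq_derive.
exact: near_open fg.
Qed.

Lemma Ck_subset V W k (U U' : set V) (f : V -> W) :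
  U' `<=` U -> Ck k U f -> Ck k U' f.
Proof.
move=> UU'; elim: k f => [|k IH] f /=.
  by move=> h x /UU' Ux; exact: h.
by move=> [df h]; split=> [x /UU'|v]; [exact: df|exact: IH].
Qed.

Lemma Ck_continuous V W k (U : set V) (f : V -> W) x :
  Ck k U f -> U x -> {for x, continuous f}.
Proof.
case: k => [h Ux|k [df _] Ux]; first exact: h.
exact: differentiable_continuous (df x Ux).
Qed.

Lemma Ck_S V W k (U : set V) (f : V -> W) : Ck k.+1 U f -> Ck k U f.
Proof.
elim: k f => [|k IH] f [df h].
  by move=> x Ux; exact: differentiable_continuous (df x Ux).
by split=> // v; exact: IH.
Qed.

Lemma Ck_cst V W k (U : set V) (a : W) : Ck k U (fun=> a).
Proof.
elim: k a => [|k IH] a /=; first by move=> x _; exact: cvg_cst.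
split=> [x _|v]; first exact: differentiable_cst.
rewrite (_ : 'D_v _ = fun=> 0); first exact: IH.
by apply/funext => x; rewrite derive_cst.
Qed.

Lemma Ck_add V W k (U : set V) (f g : V -> W) : open U ->
  Ck k U f -> Ck k U g -> Ck k U (fun x => f x + g x).
Proof.
move=> oU; elim: k f g => [|k IH] f g /=.
  by move=> hf hg x Ux; apply: cvgD; [exact: hf|exact: hg].
move=> [df hf] [dg hg]; split=> [x Ux|v].
  by apply: differentiableD; [exact: df|exact: dg].
apply: (Ck_ext oU _ (IH _ _ (hf v) (hg v))) => x Ux.
by rewrite derive_add//; [exact: df|exact: dg].
Qed.

Lemma Ck_mul V k (U : set V) (f g : V -> R) : open U ->
  Ck k U f -> Ck k U g -> Ck k U (fun x => f x * g x).
Proof.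
move=> oU; elim: k f g => [|k IH] f g.
  by move=> hf hg x Ux; apply: cvgM; [exact: hf|exact: hg].
move=> /[dup] hf0 [df hf] /[dup] hg0 [dg hg]; split=> [x Ux|v].
  by apply: differentiableM; [exact: df|exact: dg].
apply: (@Ck_ext _ _ _ _ (fun x => 'D_v f x * g x + f x * 'D_v g x)) => //.
  by move=> x Ux; rewrite derive_mulr//; [exact: df|exact: dg].
apply: Ck_add => //; apply: IH => //.
- exact: Ck_derive hf0.
- exact: Ck_S hg0.
- exact: Ck_S hf0.
- exact: Ck_derive hg0.
Qed.

Lemma Ck_opp V W k (U : set V) (f : V -> W) : open U ->
  Ck k U f -> Ck k U (fun x => - f x).
Proof.
move=> oU; elim: k f => [|k IH] f /=.
  by move=> hf x Ux; apply: cvgN; exact: hf.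
move=> [df hf]; split=> [x Ux|v].
  by apply: differentiableN; exact: df.
apply: (Ck_ext oU _ (IH _ (hf v))) => x Ux.
by rewrite [RHS](@deriveN _ _ _ f)//; apply: diff_derivable; exact: df.
Qed.

Lemma Ck_sub V W k (U : set V) (f g : V -> W) : open U ->
  Ck k U f -> Ck k U g -> Ck k U (fun x => f x - g x).
Proof. by move=> oU hf hg; apply: Ck_add => //; exact: Ck_opp. Qed.

Lemma Ck_sum V W k (U : set V) (I : Type) (r : seq I) (P : pred I) (f : I -> V -> W) :
  open U -> (forall i, P i -> Ck k U (f i)) ->
  Ck k U (fun x => \sum_(i <- r | P i) f i x).
Proof.
move=> oU h; elim: r => [|a r IH].
  rewrite (_ : (fun _ => _) = fun=> 0); first exact: Ck_cst.
  by apply/funext => x; rewrite big_nil.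
case: (boolP (P a)) => Pa.
  rewrite (_ : (fun _ => _) = fun x => f a x + \sum_(i <- r | P i) f i x).
    by apply: Ck_add => //; exact: h.
  by apply/funext => x; rewrite big_cons Pa.
rewrite (_ : (fun _ => _) = fun x => \sum_(i <- r | P i) f i x)//.
by apply/funext => x; rewrite big_cons (negbTE Pa).
Qed.

Lemma Ck_prod V k (U : set V) (I : Type) (r : seq I) (P : pred I) (f : I -> V -> R) :
  open U -> (forall i, P i -> Ck k U (f i)) ->
  Ck k U (fun x => \prod_(i <- r | P i) f i x).
Proof.
move=> oU h; elim: r => [|a r IH].
  rewrite (_ : (fun _ => _) = fun=> 1); first exact: Ck_cst.
  by apply/funext => x; rewrite big_nil.
case: (boolP (P a)) => Pa.
  rewrite (_ : (fun _ => _) = fun x => f a x * \prod_(i <- r | P i) f i x).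
    by apply: Ck_mul => //; exact: h.
  by apply/funext => x; rewrite big_cons Pa.
rewrite (_ : (fun _ => _) = fun x => \prod_(i <- r | P i) f i x)//.
by apply/funext => x; rewrite big_cons (negbTE Pa).
Qed.

Lemma continuous_mx (T : topologicalType) m n (F : T -> 'M[R]_(m, n)) x :
  (forall i j, {for x, continuous (fun y => F y i j)}) -> {for x, continuous F}.
Proof.
move=> h; rewrite /prop_for /continuous_at.
rewrite (_ : F = \sum_(i < m) \sum_(j < n) (fun y => F y i j *: delta_mx i j)); last first.
  apply/funext => y; rewrite {1}(matrix_sum_delta (F y)) fct_sumE.
  by apply: eq_bigr => i _; rewrite fct_sumE.
apply: (big_ind (fun f : T -> 'M[R]_(m, n) => f @ x --> f x)) => [|f g hf hg|i _].
- exact: cvg_cst.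
- exact: cvgD.
apply: (big_ind (fun f : T -> 'M[R]_(m, n) => f @ x --> f x)) => [|f g hf hg|j _].
- exact: cvg_cst.
- exact: cvgD.
by apply: cvgZr_tmp; exact: h.
Qed.

Lemma continuous_entry (T : topologicalType) m n (F : T -> 'M[R]_(m, n)) x i j :
  {for x, continuous F} -> {for x, continuous (fun y => F y i j)}.
Proof.
by move=> h; apply: (@continuous_comp _ _ _ F (fun M : 'M[R]_(m, n) => M i j)) => //;
  exact: coord_continuous.
Qed.

(** Reduces regularity of matrix-valued maps to that of their entries, where
    products and quotients are available. *)
Lemma Ck_mxP V m n k (U : set V) (F : V -> 'M[R]_(m, n)) : open U ->
  Ck k U F <-> forall i j, Ck k U (fun x => F x i j).
Proof.
move=> oU; elim: k F => [|k IH] F; split.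
- by move=> h i j x Ux; apply: continuous_entry; exact: h.
- by move=> h x Ux; apply: continuous_mx => i j; exact: h.
- move=> [dF hF] i j; split=> [x Ux|v].
    by apply: differentiable_entry; exact: dF.
  apply: (@Ck_ext _ _ _ _ (fun x => 'D_v F x i j)) => //.
    by move=> x Ux; rewrite derive_entry//; exact: dF.
  by apply: (IH _).1; exact: hF.
- move=> h.
  have dF x : U x -> differentiable F x.
    by move=> Ux; apply: differentiable_mx => i j; have [d _] := h i j; exact: d.
  split=> // v; apply: (IH _).2 => i j.
  apply: (@Ck_ext _ _ _ _ (fun x => 'D_v (fun y => F y i j) x)) => //.
    by move=> x Ux; rewrite derive_entry//; exact: dF.
  by have [_] := h i j; apply.
Qed.

(** By induction on k, the chain rule writing a derivative of the composite
    as a sum of products of C^k functions. *)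
Lemma Ck_comp V m k (U : set V) (U' : set 'rV[R]_m) (F : V -> 'rV[R]_m) (f : 'rV[R]_m -> R) :
  open U -> (forall x, U x -> U' (F x)) -> Ck k U F -> Ck k U' f ->
  Ck k U (fun x => f (F x)).
Proof.
move=> oU UU'; elim: k F f UU' => [|k IH] F f UU'.
  move=> hF hf x Ux; apply: (@continuous_comp _ _ _ F f); first exact: hF.
  by apply: hf; exact: UU'.
move=> /[dup] hF0 [dF hF] /[dup] hf0 [df hf]; split=> [x Ux|v].
  by apply: differentiable_comp; [exact: dF|apply: df; exact: UU'].
apply: (@Ck_ext _ _ _ _ (fun x => \sum_i 'D_v F x 0 i * partial i f (F x))) => //.
  move=> x Ux; rewrite (derive_comp (f := F) (g := f)); [|exact: dF|by apply: df; exact: UU'].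
  by rewrite derive_partial//; apply: df; exact: UU'.
apply: Ck_sum => // i _; apply: Ck_mul => //.
  exact: (Ck_mxP k _ oU).1 (Ck_derive v hF0) 0 i.
apply: IH => //; first exact: Ck_S.
exact: hf.
Qed.

Lemma derive_invr V (f : V -> R) x v : differentiable f x -> f x != 0 ->
  'D_v (fun y => (f y)^-1) x = - ((f x)^-1 * (f x)^-1) * 'D_v f x.
Proof.
move=> df f0; rewrite [LHS](@deriveV _ _ f x v)//; last exact: diff_derivable.
by rewrite /GRing.scale/= expr2 invfM.
Qed.

Lemma Ck_inv V k (U : set V) (f : V -> R) : open U ->
  (forall x, U x -> f x != 0) -> Ck k U f -> Ck k U (fun x => (f x)^-1).
Proof.
move=> oU f0; elim: k => [|k IH].
  by move=> hf x Ux; apply: cvgV; [exact: f0|exact: hf].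
move=> /[dup] hf0 [df hf]; split=> [x Ux|v].
  by apply: differentiableV; [exact: df|exact: f0].
apply: (@Ck_ext _ _ _ _ (fun x => - ((f x)^-1 * (f x)^-1) * 'D_v f x)) => //.
  by move=> x Ux; rewrite derive_invr//; [exact: df|exact: f0].
have := IH (Ck_S hf0) => h.
apply: Ck_mul => //; last exact: Ck_derive hf0.
by apply: (Ck_opp (f := fun x => (f x)^-1 * (f x)^-1)) => //; exact: Ck_mul.
Qed.

Lemma Ck_scale V k (U : set V) (a : R) (f : V -> R) : open U ->
  Ck k U f -> Ck k U (fun x => a * f x).
Proof. by move=> oU h; apply: Ck_mul => //; exact: Ck_cst. Qed.

End Calculus.

(** * Second derivatives *)

Section SecondDerivatives.
Context {R : realType}.
Implicit Types V W : normedModType R.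

Lemma derive_shift_arg V W (f : V -> W) (x a u : V) :
  'D_u (fun y => f (y + a)) x = 'D_u f (x + a).
Proof.
rewrite /derive (_ : (fun h : R => _) = (fun h : R => h^-1 *: (f (h *: u + (x + a)) - f (x + a))))//.
by apply/funext => h; rewrite /= addrA.
Qed.

Lemma differentiable_shift_arg V W (f : V -> W) (x a : V) :
  differentiable f (x + a) -> differentiable (fun y => f (y + a)) x.
Proof.
move=> df; apply: (@differentiable_comp _ _ _ _ (fun y => y + a) f) => //.
Qed.

Lemma derive_line V (f : V -> R) (x v : V) (t : R) :
  differentiable f (x + t *: v) ->
  is_derive t 1 (fun s : R => f (x + s *: v)) ('D_v f (x + t *: v)).
Proof.
move=> df.
have dl : differentiable (fun s : R => x + s *: v) t.
  by apply: differentiableD => //; exact: differentiableZl.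
apply: DeriveDef.
  apply: diff_derivable.
  exact: (@differentiable_comp _ _ _ _ (fun s : R => x + s *: v) f).
rewrite (derive_comp (f := fun s : R => x + s *: v) (g := f))//.
congr ('D_ _ f _).
rewrite /derive (_ : (fun h : R => h^-1 *: _) = (fun h : R => h^-1 *: (h *: v))); last first.
  apply/funext => h /=; congr (_ *: _).
  by rewrite [h%:A]mulr1 scalerDl opprD addrACA subrr add0r addrK.
apply/cvg_lim => //.
apply: (@cvg_trans _ ((fun=> v) @ (0 : R)^')); last exact: cvg_cst.
apply: near_eq_cvg.
by near do rewrite scalerA mulVf ?scale1r//; exact: nbhs_dnbhs_neq.
Unshelve. all: by end_near. Qed.

Lemma MVT_dir V (f : V -> R) (x v : V) :
  (forall t : R, 0 <= t <= 1 -> differentiable f (x + t *: v)) ->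
  exists2 c : R, 0 < c < 1 & f (x + v) - f x = 'D_v f (x + c *: v).
Proof.
move=> df.
have d (t : R) : 0 <= t <= 1 -> is_derive t 1 (fun s : R => f (x + s *: v)) ('D_v f (x + t *: v)).
  by move=> t01; apply: derive_line; exact: df.
have [|t t01||c] := @MVT R (fun s => f (x + s *: v)) (fun t => 'D_v f (x + t *: v)) 0 1.
- exact: ltr01.
- by apply: d; move: t01; rewrite in_itv/= => /andP[/ltW-> /ltW].
- apply: derivable_within_continuous => t; rewrite in_itv/= => t01.
  by have [] := d t t01.
- rewrite in_itv/= => c01; rewrite scale1r scale0r addr0 subr0 mulr1 => ->.
  by exists c.
Qed.

(** Two mean value theorems: first in the direction u, for the increment of
    f along v, then in the direction v. *)
Lemma second_difference V (f : V -> R) (U : set V) (x u v : V) :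
  open U -> Ck 2 U f ->
  (forall a b : R, 0 <= a <= 1 -> 0 <= b <= 1 -> U (x + a *: u + b *: v)) ->
  exists a b : R, [/\ 0 < a < 1, 0 < b < 1 &
    f (x + u + v) - f (x + u) - (f (x + v) - f x) =
    'D_v ('D_u f) (x + a *: u + b *: v)].
Proof.
move=> oU hf hU.
have df y : U y -> differentiable f y by apply: Ck_differentiable hf.
have U0 (a : R) : 0 <= a <= 1 -> U (x + a *: u).
  by move=> a01; have := hU a 0 a01; rewrite scale0r addr0; apply; rewrite lexx ler01.
have U1 (a : R) : 0 <= a <= 1 -> U (x + a *: u + v).
  by move=> a01; have := hU a 1 a01; rewrite scale1r; apply; rewrite lexx ler01.
have [|a a01] := @MVT_dir V (fun y => f (y + v) - f y) x u.
  move=> t t01; apply: differentiableB; last by apply: df; exact: U0.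
  by apply: differentiable_shift_arg; apply: df; exact: U1.
have a01' : 0 <= a <= 1 by case/andP: a01 => /ltW-> /ltW.
rewrite derive_sub; last 2 first.
- by apply: differentiable_shift_arg; apply: df; exact: U1.
- by apply: df; exact: U0.
rewrite derive_shift_arg => E.
have [|b b01 E'] := @MVT_dir V ('D_u f) (x + a *: u) v.
  by move=> t t01; apply: (Ck_differentiable (Ck_derive u hf)); exact: hU.
exists a, b; split=> //.
by rewrite -E' -E.
Qed.

Lemma derive2_dirZ V (f : V -> R) (U : set V) (x u v : V) (s : R) :
  open U -> Ck 2 U f -> U x ->
  'D_(s *: v) ('D_(s *: u) f) x = s ^+ 2 * 'D_v ('D_u f) x.
Proof.
move=> oU hf Ux.
have d1 : differentiable ('D_u f) x by apply: (Ck_differentiable (Ck_derive u hf)).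
have -> : 'D_(s *: v) ('D_(s *: u) f) x = 'D_(s *: v) (fun y => s *: 'D_u f y) x.
  apply: near_eq_derive; apply: (near_open oU Ux) => y Uy.
  by rewrite derive_dirZ//; apply: (Ck_differentiable hf).
rewrite (derive_scaler (f := 'D_u f) s _ d1) (derive_dirZ s _ d1).
by rewrite expr2 -mulrA.
Qed.

Lemma near_pair V (A B : V -> R) (U : set V) x e : open U -> U x -> 0 < e ->
  {for x, continuous A} -> {for x, continuous B} ->
  exists2 d : R, 0 < d & forall y, ball x d y ->
    [/\ U y, `|A x - A y| < e & `|B x - B y| < e].
Proof.
move=> oU Ux e0 /cvgrPdist_lt cA /cvgrPdist_lt cB.
have h1 := cA _ e0; have h2 := cB _ e0.
have h0 : \forall y \near x, U y by exact: open_nbhs_nbhs.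
have : \forall y \near x, [/\ U y, `|A x - A y| < e & `|B x - B y| < e].
  by apply: filterS3 h0 h1 h2 => y.
by move=> /nbhs_ballP[d /= d0 hd]; exists d.
Qed.

(** Schwarz. Both iterated derivatives are limits of the same second
    difference, taken along small multiples of u and v. *)
Lemma derive_swap V (f : V -> R) (U : set V) (x u v : V) :
  open U -> Ck 2 U f -> U x -> 'D_u ('D_v f) x = 'D_v ('D_u f) x.
Proof.
move=> oU hf Ux.
pose A := 'D_u ('D_v f); pose B := 'D_v ('D_u f).
have cA : {for x, continuous A} := Ck_continuous (Ck_derive u (Ck_derive v hf)) Ux.
have cB : {for x, continuous B} := Ck_continuous (Ck_derive v (Ck_derive u hf)) Ux.
have HA (s : R) y : U y -> 'D_(s *: u) ('D_(s *: v) f) y = s ^+ 2 * A y.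
  exact: derive2_dirZ oU hf.
have HB (s : R) y : U y -> 'D_(s *: v) ('D_(s *: u) f) y = s ^+ 2 * B y.
  exact: derive2_dirZ oU hf.
suff : A x = B x by [].
have sA s := @second_difference V f U x (s *: v) (s *: u) oU hf.
have sB s := @second_difference V f U x (s *: u) (s *: v) oU hf.
have {}sA (s : R) : (forall a b : R, 0 <= a <= 1 -> 0 <= b <= 1 ->
     U (x + a *: (s *: v) + b *: (s *: u))) ->
  exists a b, [/\ 0 < a < 1, 0 < b < 1 &
   f (x + s *: v + s *: u) - f (x + s *: v) - (f (x + s *: u) - f x) =
   s ^+ 2 * A (x + a *: (s *: v) + b *: (s *: u))].
  move=> h; have [a [b [a01 b01 E]]] := sA s h; exists a, b; split => //.
  rewrite E; apply: HA; apply: h.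
    by case/andP: a01 => /ltW-> /ltW.
  by case/andP: b01 => /ltW-> /ltW.
have {}sB (s : R) : (forall a b : R, 0 <= a <= 1 -> 0 <= b <= 1 ->
     U (x + a *: (s *: u) + b *: (s *: v))) ->
  exists a b, [/\ 0 < a < 1, 0 < b < 1 &
   f (x + s *: u + s *: v) - f (x + s *: u) - (f (x + s *: v) - f x) =
   s ^+ 2 * B (x + a *: (s *: u) + b *: (s *: v))].
  move=> h; have [a [b [a01 b01 E]]] := sB s h; exists a, b; split => //.
  rewrite E; apply: HB; apply: h.
    by case/andP: a01 => /ltW-> /ltW.
  by case/andP: b01 => /ltW-> /ltW.
(* From here on only the continuity of the two second derivatives matters. *)
clear HA HB; move: A B cA cB sA sB => A B cA cB sA sB.
apply/eqP; rewrite -subr_eq0 -normr_le0.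
apply/ler_addgt0Pr => e e0; rewrite add0r.
have e20 : 0 < e / 2 by rewrite divr_gt0.
have [d d0 hd] := near_pair oU Ux e20 cA cB.
have N0 : 0 < `|u| + `|v| + 1 by rewrite ltr_wpDl// addr_ge0.
(* A step so small that the whole parallelogram lies in the ball of radius
   d. *)
have [s s0 sd] : exists2 s : R, 0 < s & s * (`|u| + `|v| + 1) < d.
  exists (d / 2 / (`|u| + `|v| + 1)); first by rewrite !divr_gt0.
  by rewrite divfK ?gt_eqF// ltr_pdivrMr// ltr_pMr// ltr1n.
have hn (c : R) (w : V) : 0 <= c <= 1 -> `|c *: (s *: w)| <= s * `|w|.
  move=> /andP[c0 c1]; rewrite !normrZ (ger0_norm c0) (ger0_norm (ltW s0)).
  by rewrite ler_piMl// mulr_ge0// ltW.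
have hU (a b : R) : 0 <= a <= 1 -> 0 <= b <= 1 -> ball x d (x + a *: (s *: u) + b *: (s *: v)).
  move=> /andP[a0 a1] /andP[b0 b1]; rewrite -ball_normE/= -addrA opprD addNKr normrN.
  apply: (@le_lt_trans _ _ (s * (`|u| + `|v|))).
    by rewrite (le_trans (ler_normD _ _))// mulrDr lerD// hn// ?a0 ?b0.
  apply: (@lt_trans _ _ (s * (`|u| + `|v| + 1))).
    by rewrite ltr_pM2l// ltrDl.
  exact: sd.
have [|a [b [a01 b01]]] := sB s.
  by move=> a b a01 b01; have [] := hd _ (hU a b a01 b01).
have [|b' [a' [b01' a01']]] := sA s.
  by move=> b' a' b01' a01'; have := hU a' b' a01' b01'; rewrite addrAC => /hd[].
have {}a01 : 0 <= a <= 1 by case/andP: a01 => /ltW-> /ltW.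
have {}b01 : 0 <= b <= 1 by case/andP: b01 => /ltW-> /ltW.
have {}a01' : 0 <= a' <= 1 by case/andP: a01' => /ltW-> /ltW.
have {}b01' : 0 <= b' <= 1 by case/andP: b01' => /ltW-> /ltW.
(* The two mean values are equal, and both are close to the values at x. *)
have [_ _ y2] := hd _ (hU a b a01 b01).
have := hU a' b' a01' b01'; rewrite addrAC => /hd[_ z1 _].
rewrite (addrAC x (s *: v)).
set q := f (x + s *: u + s *: v).
rewrite (_ : q - f (x + s *: v) - _ = q - f (x + s *: u) - (f (x + s *: v) - f x)); last by ring.
move=> -> /(mulfI (lt0r_neq0 (exprn_gt0 2 s0))) E; move: y2; rewrite -E => y2.
rewrite -(subrKA (A (x + b' *: (s *: v) + a' *: (s *: u)))) (le_trans (ler_normD _ _))//.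
by rewrite [leRHS]splitr lerD ?ltW// distrC.
Qed.

Lemma derive_swap_mx V p q (f : V -> 'M[R]_(p, q)) (U : set V) (x u v : V) :
  open U -> Ck 2 U f -> U x -> 'D_u ('D_v f) x = 'D_v ('D_u f) x.
Proof.
move=> oU hf Ux; apply/matrixP => i j.
have E a b : ('D_a ('D_b f) x) i j = 'D_a ('D_b (fun y => f y i j)) x.
  rewrite derive_entry; last exact: (Ck_differentiable (Ck_derive b hf)).
  apply: near_eq_derive; apply: (near_open oU Ux) => y Uy.
  by rewrite derive_entry//; exact: (Ck_differentiable hf).
have hfij : Ck 2 U (fun y => f y i j) by exact: (Ck_mxP 2 _ oU).1.
exact: etrans (E u v) (etrans (derive_swap u v oU hfij Ux) (esym (E v u))).
Qed.

(** * Positive parts and square roots *)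

Definition pospart (t : R) : R := Num.max 0 t.

Lemma pospart0 : pospart 0 = 0. Proof. exact: maxxx. Qed.

Lemma continuous_pospart : continuous pospart.
Proof. by move=> t; apply: continuous_max; [exact: cvg_cst|exact: cvg_id]. Qed.

(** The derivative of the power k.+2 of the positive part is a multiple of
    its power k.+1, so each power gains one order of differentiability. *)
Lemma is_derive_pos_pow (k : nat) (t : R) :
  is_derive t 1 (fun t : R => pospart t ^+ k.+2) (k.+2%:R * pospart t ^+ k.+1).
Proof.
have [t0|t0|->] := ltgtP t 0.
- rewrite (_ : pospart t = 0) ?expr0n ?mulr0; last by apply/max_idPl; rewrite ltW.
  apply: (near_eq_is_derive (f := cst 0)).
  near=> s; rewrite (_ : pospart s = 0) ?expr0n//.
  by apply/max_idPl; rewrite ltW//; near: s; exact: lt_nbhsl.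
- rewrite (_ : pospart t = t); last by apply/max_idPr; rewrite ltW.
  have D : is_derive t 1 (fun s : R => s ^+ k.+2) (k.+2%:R * t ^+ k.+1).
    split; first exact: exprn_derivable.
    by rewrite -derive1E exp_derive1.
  apply: near_eq_is_derive D.
  near=> s; congr (_ ^+ _); apply/esym/max_idPr.
  by rewrite ltW//; near: s; exact: lt_nbhsr.
- rewrite pospart0 expr0n mulr0.
  have E : (fun h : R => h^-1 *: (((fun t : R => pospart t ^+ k.+2) \o shift 0) (h *: 1) - pospart 0 ^+ k.+2)) @ 0^' --> (0 : R).
    apply: (@cvg_trans _ ((fun h : R => pospart h ^+ k.+1) @ (0 : R)^')).
      apply: near_eq_cvg; near=> h.
      have h0 : h != 0 by near: h; exact: nbhs_dnbhs_neq.
      rewrite /= pospart0 expr0n subr0 addr0 [h%:A]mulr1.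
      have [hn|hp|/eqP] := ltgtP h 0; last by rewrite (negbTE h0).
        by rewrite (_ : pospart h = 0) ?expr0n ?scaler0//; apply/max_idPl; rewrite ltW.
      rewrite (_ : pospart h = h); last by apply/max_idPr; rewrite ltW.
      by rewrite [in RHS]exprS [RHS]mulKf.
    have : {for (0 : R), continuous (fun h : R => pospart h ^+ k.+1)}.
      apply: (@continuous_comp _ _ _ pospart (fun h => h ^+ k.+1)).
        by exact: continuous_pospart.
      exact: exprn_continuous.
    rewrite /prop_for/continuous_at pospart0 expr0n /=.
    exact: cvg_trans (cvg_app _ (cvg_within _)).
  by apply: DeriveDef; [apply/cvg_ex; exists 0|apply/cvg_lim].
Unshelve. all: by end_near. Qed.

Lemma derive_comp1 V (g : R -> R) (f : V -> R) x v (dg : R) :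
  is_derive (f x) 1 g dg -> differentiable f x ->
  'D_v (fun y => g (f y)) x = dg * 'D_v f x.
Proof.
move=> [/derivable1_diffP d <-] df.
rewrite (derive_comp (f := f) (g := g))//.
by rewrite -[in LHS](mulr1 ('D_v f x)) [LHS]derive_dirZ// mulrC.
Qed.

Lemma Ck_pos_pow V (k : nat) (U : set V) (f : V -> R) : open U ->
  Ck k U f -> Ck k U (fun x => pospart (f x) ^+ k.+1).
Proof.
move=> oU; elim: k => [|k IH].
  move=> h x Ux; apply: (@continuous_comp _ _ _ f pospart); first exact: h.
  exact: continuous_pospart.
move=> /[dup] hf0 [df hf]; split=> [x Ux|v].
  have [d _] := is_derive_pos_pow k (f x).
  apply: (@differentiable_comp _ _ _ _ f (fun t => pospart t ^+ k.+2)); first exact: df.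
  exact/derivable1_diffP.
apply: (@Ck_ext _ _ _ _ _ (fun x => k.+2%:R * pospart (f x) ^+ k.+1 * 'D_v f x)) => //.
  move=> x Ux; rewrite (derive_comp1 _ (is_derive_pos_pow k (f x)))//.
  exact: df.
apply: Ck_mul => //; last exact: Ck_derive hf0.
by apply: (Ck_scale _ oU); apply: IH; exact: Ck_S.
Qed.

Lemma Ck_sqrt V (k : nat) (U : set V) (f : V -> R) : open U ->
  (forall x, U x -> 0 < f x) ->
  Ck k U f -> Ck k U (fun x => Num.sqrt (f x)).
Proof.
move=> oU f0; elim: k => [|k IH].
  move=> h x Ux; apply: (@continuous_comp _ _ _ f Num.sqrt); first exact: h.
  exact: sqrt_continuous.
move=> /[dup] hf0 [df hf]; split=> [x Ux|v].
  have [d _] := is_derive1_sqrt (f0 x Ux).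
  apply: (@differentiable_comp _ _ _ _ f Num.sqrt); first exact: df.
  exact/derivable1_diffP.
apply: (@Ck_ext _ _ _ _ _ (fun x => (2 * Num.sqrt (f x))^-1 * 'D_v f x)) => //.
  move=> x Ux; rewrite (derive_comp1 _ (is_derive1_sqrt (f0 x Ux)))//.
  exact: df.
apply: Ck_mul => //; last exact: Ck_derive hf0.
apply: Ck_inv => // [x Ux|]; first by rewrite mulf_neq0// gt_eqF// sqrtr_gt0 f0.
by apply: (Ck_scale _ oU); apply: IH; exact: Ck_S.
Qed.

End SecondDerivatives.

(** * Christoffel symbols, Hessians and second fundamental forms in coordinates *)

Section Koszul.
Context {R : realType}.

Lemma dotE m (B : 'M[R]_m) (u v : 'rV[R]_m) :
  dot B u v = \sum_i \sum_j u 0 i * B i j * v 0 j.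
Proof.
rewrite /dot mxE exchange_big/=; apply: eq_bigr => j _.
by rewrite !mxE mulr_suml.
Qed.

Lemma dotDl m (B : 'M[R]_m) u u' v : dot B (u + u') v = dot B u v + dot B u' v.
Proof. by rewrite /dot !mulmxDl mxE. Qed.

Lemma dotDr m (B : 'M[R]_m) u v v' : dot B u (v + v') = dot B u v + dot B u v'.
Proof. by rewrite /dot linearD /= mulmxDr mxE. Qed.

Lemma dotZl m (B : 'M[R]_m) a u v : dot B (a *: u) v = a * dot B u v.
Proof. by rewrite /dot -!scalemxAl mxE. Qed.

Lemma dotZr m (B : 'M[R]_m) a u v : dot B u (a *: v) = a * dot B u v.
Proof. by rewrite /dot linearZ /= -scalemxAr mxE. Qed.

Lemma dotNl m (B : 'M[R]_m) u v : dot B (- u) v = - dot B u v.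
Proof. by rewrite -scaleN1r dotZl mulN1r. Qed.

Lemma dotBl m (B : 'M[R]_m) u u' v : dot B (u - u') v = dot B u v - dot B u' v.
Proof. by rewrite dotDl dotNl. Qed.

Lemma dot0l m (B : 'M[R]_m) v : dot B 0 v = 0.
Proof. by rewrite -(scale0r 0) dotZl mul0r. Qed.

Lemma dot0r m (B : 'M[R]_m) v : dot B v 0 = 0.
Proof. by rewrite -(scale0r 0) dotZr mul0r. Qed.

Lemma dot_sym m (B : 'M[R]_m) u v : B^T = B -> dot B u v = dot B v u.
Proof.
move=> sB; rewrite !dotE exchange_big; apply: eq_bigr => i _; apply: eq_bigr => j _ /=.
by rewrite -[in LHS]sB mxE; ring.
Qed.

Definition dcoef m (G : 'rV[R]_m -> 'M[R]_m) (x : 'rV[R]_m) (i j l : 'I_m) : R :=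
  partial i (fun y => G y j l) x.

(** Christoffel symbols of the metric G at x, contracted with u and v. *)
Definition chr m (G : 'rV[R]_m -> 'M[R]_m) (x u v : 'rV[R]_m) : 'rV[R]_m :=
  \row_k \sum_i \sum_j
    (2^-1 * \sum_l invmx (G x) k l *
      (dcoef G x i j l + dcoef G x j i l -
       dcoef G x l i j)) * u 0 i * v 0 j.

Lemma chrDl m (G : 'rV[R]_m -> 'M[R]_m) x a u u' v :
  chr G x (a *: u + u') v = a *: chr G x u v + chr G x u' v.
Proof.
apply/rowP => k; rewrite !mxE mulr_sumr -big_split; apply: eq_bigr => i _ /=.
rewrite mulr_sumr -big_split; apply: eq_bigr => j _ /=.
by rewrite !mxE; ring.
Qed.

Lemma chrDr m (G : 'rV[R]_m -> 'M[R]_m) x a u v v' :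
  chr G x u (a *: v + v') = a *: chr G x u v + chr G x u v'.
Proof.
apply/rowP => k; rewrite !mxE mulr_sumr -big_split; apply: eq_bigr => i _ /=.
rewrite mulr_sumr -big_split; apply: eq_bigr => j _ /=.
by rewrite !mxE; ring.
Qed.

Lemma derive_dot n m (A : 'rV[R]_n -> 'M[R]_m) (a b : 'rV[R]_n -> 'rV[R]_m) x w :
  differentiable A x -> differentiable a x -> differentiable b x ->
  'D_w (fun y => dot (A y) (a y) (b y)) x =
    dot ('D_w A x) (a x) (b x) + dot (A x) ('D_w a x) (b x) + dot (A x) (a x) ('D_w b x).
Proof.
move=> dA da db.
have dAe i j : differentiable (fun y => A y i j) x by exact: differentiable_entry.
have dae i : differentiable (fun y => a y 0 i) x by exact: differentiable_entry.
have dbe i : differentiable (fun y => b y 0 i) x by exact: differentiable_entry.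
have dm1 i j : differentiable (fun y => a y 0 i * A y i j) x by exact: differentiableM.
have dm2 i j : differentiable (fun y => a y 0 i * A y i j * b y 0 j) x by exact: differentiableM.
under eq_fun do rewrite dotE.
rewrite !dotE derive_fsum; last by move=> i _; exact: differentiable_fsum.
rewrite -!big_split; apply: eq_bigr => i _ /=.
rewrite derive_fsum// -!big_split; apply: eq_bigr => j _ /=.
rewrite (derive_mulr _ (dm1 i j) (dbe j)) (derive_mulr _ (dae i) (dAe i j)).
by rewrite !derive_entry//; ring.
Qed.

Lemma derive_dot_cst m (G : 'rV[R]_m -> 'M[R]_m) x w u v :
  differentiable G x -> 'D_w (fun y => dot (G y) u v) x = dot ('D_w G x) u v.
Proof.
move=> dG; rewrite (derive_dot (a := cst u) (b := cst v))//.
by rewrite !derive_cst dot0l dot0r !addr0.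
Qed.

(** Lowering the index cancels the inverse matrix in the Christoffel
    symbols; the three remaining terms are trilinear and are compared after
    expansion on the coordinate vectors. *)
Lemma koszul m (G : 'rV[R]_m -> 'M[R]_m) x u v w :
  differentiable G x -> (G x)^T = G x -> G x \in unitmx ->
  dot (G x) (chr G x u v) w =
  2^-1 * (dot ('D_u G x) v w + dot ('D_v G x) u w - dot ('D_w G x) u v).
Proof.
move=> dG sG uG.
pose c : 'rV[R]_m := \row_l \sum_i \sum_j 2^-1 *
      (dcoef G x i j l + dcoef G x j i l -
       dcoef G x l i j) * u 0 i * v 0 j.
have -> : chr G x u v = c *m (invmx (G x)).
  apply/rowP => k; rewrite !mxE.
  under [RHS]eq_bigr => l _.
    rewrite mxE mulr_suml.
    under eq_bigr do rewrite mulr_suml.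
    over.
  rewrite /= [RHS]exchange_big; apply: eq_bigr => i _ /=.
  rewrite [RHS]exchange_big; apply: eq_bigr => j _ /=.
  rewrite mulr_sumr !mulr_suml; apply: eq_bigr => l _.
  have <- : invmx (G x) k l = invmx (G x) l k.
    by rewrite -[in RHS]sG -trmx_inv mxE.
  by ring.
rewrite /dot mulmxKV// mxE.
(* Both sides are signed sums of three permuted copies of S. *)
pose S (a b d : 'rV[R]_m) :=
    \sum_i \sum_j \sum_l a 0 i * b 0 j * d 0 l * dcoef G x i j l.
have E (a b d : 'rV[R]_m) : (b *m 'D_a G x *m d^T) 0 0 = S a b d.
  rewrite -[LHS]/(dot ('D_a G x) b d) dotE derive_partial//.
  under eq_bigr => j _.
    under eq_bigr => l _.
      rewrite summxE mulr_sumr mulr_suml.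
      under eq_bigr => i _ do rewrite mxE.
      over.
    over.
  rewrite /=.
  under eq_bigr do rewrite exchange_big /=.
  rewrite exchange_big; apply: eq_bigr => i _ /=.
  apply: eq_bigr => j _; apply: eq_bigr => l _.
  by rewrite derive_entry// /dcoef /partial; ring.
transitivity (2^-1 * (S u v w + S v u w - S w u v)); last first.
  by congr (_ * (_ + _ - _)); exact: esym (E _ _ _).
rewrite /S.
have -> : \sum_j c 0 j * w^T j 0 = \sum_i \sum_j \sum_l 2^-1 *
      (dcoef G x i j l + dcoef G x j i l -
       dcoef G x l i j) * u 0 i * v 0 j * w 0 l.
  under eq_bigr => l _.
    rewrite !mxE mulr_suml.
    under eq_bigr do rewrite mulr_suml.
    over.
  rewrite /= exchange_big; apply: eq_bigr => i _ /=.
  by rewrite exchange_big.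
rewrite [X in _ + X - _]exchange_big/=.
rewrite [X in _ - X](_ : _ = \sum_i \sum_j \sum_l w 0 l * u 0 i * v 0 j * dcoef G x l i j); last first.
  rewrite exchange_big; apply: eq_bigr => i _ /=.
  by rewrite exchange_big.
rewrite -big_split -sumrB /= mulr_sumr; apply: eq_bigr => i _.
rewrite -big_split -sumrB /= mulr_sumr; apply: eq_bigr => j _.
rewrite -big_split -sumrB /= mulr_sumr; apply: eq_bigr => l _.
by ring.
Qed.

(** * Second fundamental form of a map between open sets *)

(** For an isometric immersion phi between open sets with metrics G' and G,
    the ambient second derivative of phi minus its intrinsic counterpart,
    that is the second fundamental form. *)
Definition sff n m (G' : 'rV[R]_n -> 'M[R]_n) (G : 'rV[R]_m -> 'M[R]_m)
    (phi : 'rV[R]_n -> 'rV[R]_m) (x u v : 'rV[R]_n) : 'rV[R]_m :=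
  'D_u ('D_v phi) x + chr G (phi x) ('D_u phi x) ('D_v phi x) -
  'D_(chr G' x u v) phi x.

Definition hess n (G : 'rV[R]_n -> 'M[R]_n) (f : 'rV[R]_n -> R) (x u v : 'rV[R]_n) : R :=
  'D_u ('D_v f) x - 'D_(chr G x u v) f x.

(** Gauss formula. The derivatives of the relation between the metrics give,
    through the Koszul formula on both sides, the same tangential component
    for the ambient and for the intrinsic second derivative. *)
Lemma sff_normal n m (G' : 'rV[R]_n -> 'M[R]_n) (G : 'rV[R]_m -> 'M[R]_m)
    (phi : 'rV[R]_n -> 'rV[R]_m) (U : set 'rV[R]_n) x u v w :
  open U -> U x -> Ck 2 U phi ->
  (forall y, U y -> forall a b, dot (G' y) a b = dot (G (phi y)) ('D_a phi y) ('D_b phi y)) ->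
  differentiable G' x -> (G' x)^T = G' x -> G' x \in unitmx ->
  differentiable G (phi x) -> (G (phi x))^T = G (phi x) -> G (phi x) \in unitmx ->
  dot (G (phi x)) (sff G' G phi x u v) ('D_w phi x) = 0.
Proof.
move=> oU Ux hphi iso dG' sG' uG' dG sG uG.
have dphi : differentiable phi x by exact: Ck_differentiable hphi Ux.
have d2phi a : differentiable ('D_a phi) x := Ck_differentiable (Ck_derive a hphi) Ux.
have dGphi : differentiable (fun y => G (phi y)) x by exact: differentiable_comp.
(* Second derivatives of phi: symmetric, so they cancel from the Koszul
   formula except in the term already present in sff. *)
pose D2 a b := 'D_a ('D_b phi) x.
have swap a b : D2 a b = D2 b a by exact: derive_swap_mx oU hphi Ux.
have DG a b c : dot ('D_a G' x) b c = dot ('D_('D_a phi x) G (phi x)) ('D_b phi x) ('D_c phi x)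
     + dot (G (phi x)) (D2 a b) ('D_c phi x)
     + dot (G (phi x)) ('D_b phi x) (D2 a c).
  rewrite -(derive_dot_cst a b c dG').
  transitivity ('D_a (fun y => dot (G (phi y)) ('D_b phi y) ('D_c phi y)) x).
    by apply: near_eq_derive; apply: (near_open oU Ux) => y Uy; exact: iso.
  by rewrite (derive_dot _ dGphi (d2phi b) (d2phi c)) (derive_comp _ dphi dG).
rewrite -[sff _ _ _ _ _ _]/(D2 u v + _ - _) dotBl dotDl -(iso x Ux) !koszul//.
rewrite !DG; clearbody D2.
rewrite (swap w u) (swap w v) (swap v u).
set gu := 'D_u phi x; set gv := 'D_v phi x; set gw := 'D_w phi x.
clearbody gu gv gw.
set Gu := 'D_gu G (phi x); set Gv := 'D_gv G (phi x); set Gw := 'D_gw G (phi x).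
clearbody Gu Gv Gw.
rewrite (dot_sym gv (D2 u w) sG).
by field.
Qed.

Lemma derive2_comp n m (phi : 'rV[R]_n -> 'rV[R]_m) (f : 'rV[R]_m -> R)
    (U : set 'rV[R]_n) (U' : set 'rV[R]_m) x u v :
  open U -> open U' -> U x -> Ck 2 U phi -> Ck 2 U' f -> (forall y, U y -> U' (phi y)) ->
  'D_u ('D_v (fun y => f (phi y))) x =
  'D_('D_u ('D_v phi) x) f (phi x) + 'D_('D_u phi x) ('D_('D_v phi x) f) (phi x).
Proof.
move=> oU oU' Ux hphi hf UU'.
have dphi y : U y -> differentiable phi y by exact: Ck_differentiable hphi.
have df y : U' y -> differentiable f y by exact: Ck_differentiable hf.
have d2phi a : differentiable ('D_a phi) x := Ck_differentiable (Ck_derive a hphi) Ux.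
have d2f i : differentiable (partial i f) (phi x) :=
  Ck_differentiable (Ck_derive (delta_mx 0 i) hf) (UU' _ Ux).
have dpf i : differentiable (fun y => partial i f (phi y)) x.
  by apply: (@differentiable_comp _ _ _ _ phi (partial i f)) => //; exact: dphi.
have de i : differentiable (fun y => 'D_v phi y 0 i) x by exact: differentiable_entry.
transitivity ('D_u (fun y => \sum_i 'D_v phi y 0 i * partial i f (phi y)) x).
  apply: near_eq_derive; apply: (near_open oU Ux) => y Uy.
  rewrite (derive_comp (f := phi) (g := f))//; [|exact: dphi|by apply: df; exact: UU'].
  by rewrite derive_partial//; apply: df; exact: UU'.
rewrite derive_fsum; last by move=> i _; exact: differentiableM.
have E1 i : 'D_u (fun y => 'D_v phi y 0 i * partial i f (phi y)) x =
    'D_u ('D_v phi) x 0 i * partial i f (phi x) +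
    'D_v phi x 0 i * 'D_('D_u phi x) (partial i f) (phi x).
  have A := derive_entry u 0 i (d2phi v).
  have B := derive_comp u (dphi _ Ux) (d2f i).
  apply: (etrans (derive_mulr u (de i) (dpf i))).
  exact: (f_equal2 +%R (f_equal2 *%R (esym A) erefl) (f_equal2 *%R erefl B)).
under eq_bigr => i _ do rewrite E1.
rewrite big_split /=; congr (_ + _).
  by rewrite (derive_partial _ (df _ (UU' _ Ux))).
transitivity ('D_('D_u phi x) (fun y => \sum_i 'D_v phi x 0 i * partial i f y) (phi x)).
  rewrite derive_fsum; last by move=> i _; exact: differentiableM.
  apply: eq_bigr => i _.
  by rewrite (derive_mulr _ (differentiable_cst _ _) (d2f i)) derive_cst mul0r add0r.
apply: near_eq_derive; apply: (near_open oU' (UU' _ Ux)) => y Uy.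
by rewrite (derive_partial _ (df _ Uy)).
Qed.

(** Adding and subtracting the Christoffel term of the target regroups the
    chain rule for second derivatives into the derivative of f along sff and
    the Hessian of f. *)
Lemma hess_comp n m (G' : 'rV[R]_n -> 'M[R]_n) (G : 'rV[R]_m -> 'M[R]_m)
    (phi : 'rV[R]_n -> 'rV[R]_m) (f : 'rV[R]_m -> R)
    (U : set 'rV[R]_n) (U' : set 'rV[R]_m) x u v :
  open U -> open U' -> U x -> Ck 2 U phi -> Ck 2 U' f -> (forall y, U y -> U' (phi y)) ->
  hess G' (fun y => f (phi y)) x u v =
  'D_(sff G' G phi x u v) f (phi x) + hess G f (phi x) ('D_u phi x) ('D_v phi x).
Proof.
move=> oU oU' Ux hphi hf UU'.
have df : differentiable f (phi x) by apply: Ck_differentiable hf (UU' _ Ux).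
have dphi : differentiable phi x by apply: Ck_differentiable hphi Ux.
rewrite /hess (derive2_comp u v oU oU' Ux hphi hf UU').
rewrite (derive_comp (f := phi) (g := f))//.
rewrite /sff derive_dirB// derive_dirD//.
set a := 'D_('D_u ('D_v phi) x) f _; set b := 'D_('D_u phi x) _ _; set c := 'D_(chr _ _ _ _) _ _.
set d := 'D_('D_(chr _ _ _ _) _ _) _ _.
by ring.
Qed.

Lemma hess_linear_l n (G : 'rV[R]_n -> 'M[R]_n) (f : 'rV[R]_n -> R) U x a u u' v :
  Ck 2 U f -> U x -> hess G f x (a *: u + u') v = a * hess G f x u v + hess G f x u' v.
Proof.
move=> hf Ux.
have d2f : differentiable ('D_v f) x := Ck_differentiable (Ck_derive v hf) Ux.
have df : differentiable f x by apply: Ck_differentiable hf Ux.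
rewrite /hess derive_dirP// chrDl derive_dirP//.
set p := 'D_u _ _; set q := 'D_u' _ _; set r := 'D_(chr _ _ u v) _ _; set s := 'D_(chr _ _ u' v) _ _.
by rewrite /GRing.scale/=; ring.
Qed.

Lemma hess_linear_r n (G : 'rV[R]_n -> 'M[R]_n) (f : 'rV[R]_n -> R) U x a u v v' :
  open U -> Ck 2 U f -> U x ->
  hess G f x u (a *: v + v') = a * hess G f x u v + hess G f x u v'.
Proof.
move=> oU hf Ux.
have d2f w : differentiable ('D_w f) x := Ck_differentiable (Ck_derive w hf) Ux.
have df y : U y -> differentiable f y by apply: Ck_differentiable hf.
have -> : hess G f x u (a *: v + v') =
   'D_u (fun y => a *: 'D_v f y + 'D_v' f y) x - 'D_(chr G x u (a *: v + v')) f x.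
  congr (_ - _); apply: near_eq_derive; apply: (near_open oU Ux) => y Uy.
  by rewrite derive_dirP//; exact: df.
rewrite derive_add//; last exact: differentiableZ.
rewrite derive_scaler// /hess chrDr derive_dirP; last exact: df.
set p := 'D_u _ _; set q := 'D_u _ _; set r := 'D_(chr _ _ u v) _ _; set s := 'D_(chr _ _ u v') _ _.
by rewrite /GRing.scale/=; ring.
Qed.

End Koszul.

(** * Laplacians *)

Section Laplacian.
Context {R : realType}.

(** If the rows of E are orthonormal then the product of the transpose of E
    with E is the inverse of h, so the trace over any orthonormal basis is
    the contraction with the inverse metric. *)
Lemma orthonormal_trace n (h : 'M[R]_n) (e : n.-tuple 'rV[R]_n) (B : 'rV[R]_n -> 'rV[R]_n -> R) :
  (forall a u u' v, B (a *: u + u') v = a * B u v + B u' v) ->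
  (forall a u v v', B u (a *: v + v') = a * B u v + B u v') ->
  (forall a b, dot h (tnth e a) (tnth e b) = (a == b)%:R) ->
  \sum_a B (tnth e a) (tnth e a) =
  \sum_i \sum_j invmx h i j * B (delta_mx 0 i) (delta_mx 0 j).
Proof.
move=> Bl Br he.
have B0l v : B 0 v = 0.
  by apply: (@addIr _ (B 0 v)); rewrite add0r -{1}(mul1r (B 0 v)) -Bl scale1r addr0.
have B0r u : B u 0 = 0.
  by apply: (@addIr _ (B u 0)); rewrite add0r -{1}(mul1r (B u 0)) -Br scale1r addr0.
pose E := \matrix_(a < n) tnth e a.
have EhE : E *m h *m E^T = 1%:M.
  apply/matrixP => a b; rewrite !mxE -he dotE exchange_big; apply: eq_bigr => j _ /=.
  by rewrite !mxE mulr_suml; apply: eq_bigr => i _; rewrite !mxE.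
have uh : h \in unitmx.
  by have /mulmx1_unit[] : (E^T *m E) *m h = 1%:M by rewrite -mulmxA; exact: mulmx1C.
have EE : E^T *m E = invmx h.
  have : (E^T *m E) *m h = 1%:M by rewrite -mulmxA; exact: mulmx1C.
  by move=> /(congr1 (fun X => X *m invmx h)); rewrite mulmxK// mul1mx.
have expand u v : B u v = \sum_i \sum_j u 0 i * v 0 j * B (delta_mx 0 i) (delta_mx 0 j).
  transitivity (\sum_i u 0 i * B (delta_mx 0 i) v).
    rewrite {1}(row_sum_delta u); elim: (index_enum _) => [|i r IH].
      by rewrite !big_nil B0l.
    by rewrite !big_cons Bl IH.
  apply: eq_bigr => i _.
  transitivity (u 0 i * \sum_j v 0 j * B (delta_mx 0 i) (delta_mx 0 j)); last first.
    by rewrite mulr_sumr; apply: eq_bigr => j _; rewrite mulrA.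
  congr (_ * _); rewrite {1}(row_sum_delta v); elim: (index_enum _) => [|j r IH].
    by rewrite !big_nil B0r.
  by rewrite !big_cons Br IH.
under eq_bigr do rewrite expand.
rewrite exchange_big; apply: eq_bigr => i _ /=.
rewrite exchange_big; apply: eq_bigr => j _ /=.
rewrite -EE mxE mulr_suml; apply: eq_bigr => a _.
by rewrite !mxE.
Qed.

Lemma differentiable_fprod n (I : Type) (r : seq I) (f : I -> 'rV[R]_n -> R) x :
  (forall i, differentiable (f i) x) ->
  differentiable (fun y => \prod_(i <- r) f i y) x.
Proof.
move=> df; elim: r => [|b s IH].
  rewrite (_ : (fun _ => _) = cst 1); first exact: differentiable_cst.
  by apply/funext => y; rewrite big_nil.
rewrite (_ : (fun _ => _) = fun y => f b y * \prod_(i <- s) f i y).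
  exact: differentiableM.
by apply/funext => y; rewrite big_cons.
Qed.

Lemma derive_fprod n (I : eqType) (r : seq I) (f : I -> 'rV[R]_n -> R) x v :
  uniq r -> (forall i, differentiable (f i) x) ->
  'D_v (fun y => \prod_(i <- r) f i y) x =
  \sum_(i <- r) \prod_(k <- r) (if k == i then 'D_v (f k) x else f k x).
Proof.
move=> + df; elim: r => [_|a r IH /= /andP[ar ur]].
  rewrite big_nil (_ : (fun _ => _) = cst 1) ?derive_cst//.
  by apply/funext => y; rewrite big_nil.
rewrite (_ : (fun _ => _) = fun y => f a y * \prod_(i <- r) f i y); last first.
  by apply/funext => y; rewrite big_cons.
have dp : differentiable (fun y => \prod_(i <- r) f i y) x.
  exact: differentiable_fprod.
rewrite derive_mulr// IH// big_cons big_cons eqxx; congr (_ * _ + _).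
  rewrite [LHS]big_seq_cond [RHS]big_seq_cond; apply: eq_bigr => i /andP[ir _].
  by case: eqP => // ia; move: ar; rewrite -ia ir.
rewrite mulr_sumr [LHS]big_seq_cond [RHS]big_seq_cond; apply: eq_bigr => i /andP[ir _].
rewrite big_cons; case: eqP => // ai; by move: ar; rewrite ai ir.
Qed.

(** Jacobi formula. The determinant is differentiated row by row, and each
    term is expanded along the differentiated row. *)
Lemma derive_det n m (A : 'rV[R]_n -> 'M[R]_m) x v :
  differentiable A x ->
  'D_v (fun y => \det (A y)) x = \tr (\adj (A x) *m 'D_v A x).
Proof.
move=> dA.
have dAe i j : differentiable (fun y => A y i j) x by exact: differentiable_entry.
pose D i := \matrix_(k, l) (if k == i then 'D_v A x k l else A x k l).
have dpr (s : {perm 'I_m}) : differentiable (fun y => \prod_i A y i (s i)) x.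
  by apply: (differentiable_fprod _ (f := fun i y => A y i (s i))).
transitivity (\sum_i \det (D i)).
  rewrite /determinant exchange_big derive_fsum /=; last first.
    by move=> s _; exact: differentiableM.
  apply: eq_bigr => s _; rewrite -mulr_sumr.
  rewrite [LHS](@derive_scaler _ _ _ (fun y => \prod_i A y i (s i)))//.
  congr (_ * _).
  rewrite (derive_fprod (f := fun i y => A y i (s i)))//; last exact: index_enum_uniq.
  apply: eq_bigr => i _; apply: eq_bigr => k _.
  by rewrite !mxE derive_entry.
rewrite mxtrace_mulC /mxtrace; apply: eq_bigr => i _.
rewrite (expand_det_row _ i) mxE; apply: eq_bigr => j _.
rewrite !mxE eqxx; congr (_ * _).
rewrite /cofactor; congr (_ * \det _); apply/matrixP => k l; rewrite !mxE.
by rewrite eq_sym (negbTE (neq_lift _ _)).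
Qed.

Lemma Ck_det (V : normedModType R) m k (U : set V) (A : V -> 'M[R]_m) :
  open U -> (forall i j, Ck k U (fun y => A y i j)) -> Ck k U (fun y => \det (A y)).
Proof.
move=> oU hA; rewrite /determinant; apply: Ck_sum => // s _.
apply: (@Ck_scale _ _ _ _ _ (fun y => \prod_i A y i (s i))) => //.
by apply: Ck_prod => // i _.
Qed.

Lemma Ck_invmx n m k (U : set 'rV[R]_n) (A : 'rV[R]_n -> 'M[R]_m) :
  open U -> (forall y, U y -> A y \in unitmx) ->
  (forall i j, Ck k U (fun y => A y i j)) -> forall i j, Ck k U (fun y => invmx (A y) i j).
Proof.
move=> oU uA hA i j.
apply: (@Ck_ext _ _ _ _ _ (fun y => (\det (A y))^-1 * ((-1) ^+ (j + i) * \det (row' j (col' i (A y)))))) => //.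
  by move=> y Uy; rewrite /invmx uA// !mxE.
apply: Ck_mul => //.
  apply: Ck_inv => //; last exact: Ck_det.
  by move=> y /uA; rewrite unitmxE unitfE.
apply: Ck_scale => //; apply: Ck_det => // k' l'.
under eq_fun do rewrite !mxE.
exact: hA.
Qed.

(** Differentiate the product of A with its inverse, which is constant. *)
Lemma derive_invmx n m (U : set 'rV[R]_n) (A : 'rV[R]_n -> 'M[R]_m) x v :
  open U -> U x -> (forall y, U y -> A y \in unitmx) ->
  (forall i j, Ck 1 U (fun y => A y i j)) ->
  'D_v (fun y => invmx (A y)) x = - (invmx (A x) *m 'D_v A x *m invmx (A x)).
Proof.
move=> oU Ux uA hA.
have dA : differentiable A x.
  by apply: differentiable_mx => i j; exact: Ck_differentiable (hA i j) Ux.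
have dI : differentiable (fun y => invmx (A y)) x.
  by apply: differentiable_mx => i j; exact: Ck_differentiable (Ck_invmx oU uA hA i j) Ux.
have : 'D_v A x *m invmx (A x) + A x *m 'D_v (fun y => invmx (A y)) x = 0.
  apply/matrixP => i k; rewrite mxE [RHS]mxE [X in X + _]mxE [X in _ + X]mxE.
  rewrite -big_split /=.
  transitivity ('D_v (fun y => \sum_j A y i j * invmx (A y) j k) x).
    have dAij j : differentiable (fun y => A y i j) x by exact: differentiable_entry.
    have dIjk j : differentiable (fun y => invmx (A y) j k) x by exact: (differentiable_entry j k dI).
    rewrite derive_fsum; last by move=> j _; exact: differentiableM.
    apply: eq_bigr => j _.
    rewrite (derive_mulr v (dAij j) (dIjk j)).
    exact: (f_equal2 +%R (f_equal2 *%R (derive_entry v i j dA) erefl)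
                         (f_equal2 *%R erefl (derive_entry v j k dI))).
  rewrite (near_eq_derive (g := cst ((1%:M : 'M[R]_m) i k))) ?derive_cst//.
  apply: (near_open oU Ux) => y Uy; rewrite -(mulmxV (uA y Uy)) mxE//.
move/eqP; rewrite addrC addr_eq0 => /eqP E.
by rewrite -[LHS](mulKmx (uA x Ux)) E mulmxN mulmxA.
Qed.

(** The contraction of the Hessian with the inverse metric. *)
Definition lapl n (h : 'rV[R]_n -> 'M[R]_n) (u : 'rV[R]_n -> R) (x : 'rV[R]_n) : R :=
  \sum_i \sum_j invmx (h x) i j * hess h u x (delta_mx 0 i) (delta_mx 0 j).

(** The i-th component of the gradient of u, times the volume density. *)
Definition flux n (h : 'rV[R]_n -> 'M[R]_n) (u : 'rV[R]_n -> R) (i : 'I_n) (y : 'rV[R]_n) : R :=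
  Num.sqrt (\det (h y)) * \sum_j invmx (h y) i j * partial j u y.

Lemma Ck_flux n (h : 'rV[R]_n -> 'M[R]_n) (u : 'rV[R]_n -> R) (U : set 'rV[R]_n) i :
  open U -> (forall y, U y -> 0 < \det (h y)) ->
  (forall i j, Ck 1 U (fun y => h y i j)) -> Ck 2 U u -> Ck 1 U (flux h u i).
Proof.
move=> oU dh hh hu; apply: Ck_mul => //.
  by apply: Ck_sqrt => //; exact: Ck_det.
apply: Ck_sum => // j _; apply: Ck_mul => //; last exact: Ck_derive hu.
by apply: Ck_invmx => // y Uy; rewrite unitmxE unitfE gt_eqF// dh.
Qed.

(** Divergence form of the Laplacian. The Christoffel terms of the Hessian,
    contracted with the inverse metric, are accounted for by the derivatives
    of the volume density (Jacobi formula) and of the inverse metric. *)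
Lemma lapl_div n (h : 'rV[R]_n -> 'M[R]_n) (u : 'rV[R]_n -> R) (U : set 'rV[R]_n) x :
  open U -> U x -> (forall y, U y -> 0 < \det (h y)) -> (h x)^T = h x ->
  (forall i j, Ck 1 U (fun y => h y i j)) -> Ck 2 U u ->
  lapl h u x * Num.sqrt (\det (h x)) = \sum_i partial i (flux h u i) x.
Proof.
move=> oU Ux dh sh hh hu.
have uh y : U y -> h y \in unitmx by move=> Uy; rewrite unitmxE unitfE gt_eqF// dh.
have dhx : differentiable h x.
  by apply: differentiable_mx => i j; exact: Ck_differentiable (hh i j) Ux.
have dI : differentiable (fun y => invmx (h y)) x.
  by apply: differentiable_mx => i j; exact: Ck_differentiable (Ck_invmx oU uh hh i j) Ux.
have du : differentiable u x := Ck_differentiable hu Ux.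
have d2u j : differentiable (partial j u) x := Ck_differentiable (Ck_derive (delta_mx 0 j) hu) Ux.
pose s := Num.sqrt (\det (h x)); pose I := invmx (h x).
pose H (i : 'I_n) := 'D_(delta_mx 0 i) h x.
pose p : 'rV[R]_n := \row_j partial j u x.
pose q := p *m I.
have sI : I^T = I by rewrite trmx_inv sh.
have qT : I *m p^T = q^T by rewrite trmx_mul sI.
have Ds (i : 'I_n) : 'D_(delta_mx 0 i) (fun y => Num.sqrt (\det (h y))) x = 2^-1 * s * \tr (I *m H i).
  have D0 : 0 < \det (h x) by exact: dh.
  rewrite (derive_comp1 (f := fun y => \det (h y)) _ (is_derive1_sqrt D0)); last first.
    exact: Ck_differentiable (Ck_det oU hh) Ux.
  rewrite derive_det// /I /invmx uh// -scalemxAl mxtraceZ.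
  rewrite -/(H i) -/s; set t := \tr _.
  have s0 : s != 0 by rewrite gt_eqF// sqrtr_gt0.
  have -> : \det (h x) = s * s by rewrite -expr2 sqr_sqrtr// ltW.
  by field.
have DI (i j : 'I_n) : 'D_(delta_mx 0 i) (fun y => invmx (h y) i j) x = - (I *m H i *m I) i j.
  by rewrite -(derive_entry _ _ _ dI) (derive_invmx _ oU Ux uh hh) mxE.
have flxE (i : 'I_n) : partial i (flux h u i) x =
   2^-1 * s * \tr (I *m H i) * q 0 i +
   s * (- (I *m H i *m q^T) i 0 + \sum_j I i j * partial i (partial j u) x).
  rewrite /partial /flux.
  have ds : differentiable (fun y => Num.sqrt (\det (h y))) x.
    by apply: (Ck_differentiable (k := 0) (U := U)) => //; apply: Ck_sqrt => //; exact: Ck_det.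
  have dIe j : differentiable (fun y => invmx (h y) i j) x by exact: (differentiable_entry i j dI).
  have dsum : differentiable (fun y => \sum_j invmx (h y) i j * partial j u y) x.
    by apply: differentiable_fsum => j _; exact: differentiableM.
  rewrite (derive_mulr _ ds dsum) Ds; congr (_ + _).
    apply: (f_equal2 *%R erefl); have -> : q 0 i = q^T i 0 by rewrite [RHS]mxE.
    by rewrite -qT mxE; apply: eq_bigr => j _; rewrite !mxE.
  apply: (f_equal2 *%R erefl); rewrite derive_fsum; last by move=> j _; exact: differentiableM.
  have -> : - (I *m H i *m q^T) i 0 = \sum_j - (I *m H i *m I) i j * partial j u x.
    rewrite -qT mulmxA mxE -sumrN; apply: eq_bigr => j _.
    by rewrite [p^T _ _]mxE [p _ _]mxE mulNr.
  rewrite -big_split; apply: eq_bigr => j _ /=.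
  apply: etrans (derive_mulr _ (dIe j) (d2u j)) _.
  by rewrite DI.
under [RHS]eq_bigr do rewrite flxE.
have hessE (i j : 'I_n) : hess h u x (delta_mx 0 i) (delta_mx 0 j) =
    partial i (partial j u) x -
    2^-1 * ((H i *m q^T) j 0 + (H j *m q^T) i 0 - \sum_k q 0 k * H k i j).
  rewrite /hess; congr (_ - _).
  set w := chr _ _ _ _.
  have -> : 'D_w u x = dot (h x) w q.
    rewrite derive_partial// /dot /q trmx_mul sI mulmxA mulmxK ?uh// mxE.
    by apply: eq_bigr => k _; rewrite !mxE.
  rewrite koszul ?uh//; congr (_ * (_ + _ - _)).
  - by rewrite /dot -mulmxA -rowE mxE.
  - by rewrite /dot -mulmxA -rowE mxE.
  - rewrite derive_partial//.
    rewrite /dot -mulmxA -rowE mxE.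
    rewrite trmx_delta -colE mxE summxE; apply: eq_bigr => k _.
    by rewrite mxE.
rewrite /lapl -/s -/I.
(* The second derivatives of u, and the two contractions of the derivative
   of the metric with the gradient of u. *)
pose T1 := \sum_i \sum_j I i j * partial i (partial j u) x.
pose T2 := \sum_i \sum_j I i j * (H i *m q^T) j 0.
pose T3 := \sum_i \sum_j \sum_k I i j * (q 0 k * H k i j).
transitivity ((T1 - 2^-1 * (T2 + T2 - T3)) * s).
  congr (_ * _).
  have T2' : T2 = \sum_i \sum_j I i j * (H j *m q^T) i 0.
    rewrite /T2 exchange_big; apply: eq_bigr => i _; apply: eq_bigr => j _ /=.
    by rewrite -[in LHS]sI mxE.
  rewrite {2}T2' /T1 /T2 /T3 -big_split -sumrB mulr_sumr -sumrB; apply: eq_bigr => i _ /=.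
  rewrite -big_split -sumrB mulr_sumr -sumrB; apply: eq_bigr => j _ /=.
  apply: etrans (f_equal2 *%R erefl (hessE i j)) _.
  by rewrite -mulr_sumr; ring.
have E2 : \sum_i (I *m H i *m q^T) i 0 = T2.
  by apply: eq_bigr => i _; rewrite -mulmxA mxE.
have E3 : \sum_i \tr (I *m H i) * q 0 i = T3.
  rewrite /T3.
  under [RHS]eq_bigr do rewrite exchange_big /=.
  rewrite [RHS]exchange_big; apply: eq_bigr => k _ /=.
  rewrite /mxtrace mulr_suml; under [LHS]eq_bigr => i _ do rewrite mxE mulr_suml.
  rewrite [LHS]exchange_big; apply: eq_bigr => i _; apply: eq_bigr => j _ /=.
  by rewrite -[in LHS]sI mxE; ring.
rewrite big_split /= -mulr_sumr big_split /= sumrN E2 -/T1.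
have -> : \sum_i 2^-1 * s * \tr (I *m H i) * q 0 i = 2^-1 * s * T3.
  by rewrite -E3 mulr_sumr; apply: eq_bigr => i _; rewrite mulrA.
by field.
Qed.

End Laplacian.

(** * Iterated integrals of compactly supported continuous functions *)

Section Slices.
Context {R : realType}.
Notation mu := (@lebesgue_measure R).

Lemma norm_entry_le m n (M : 'M[R]_(m, n)) i j : `|M i j| <= `|M|.
Proof.
rewrite [leRHS]/Num.Def.normr /= mx_normrE.
exact: (le_bigmax _ (fun ij : 'I_m * 'I_n => `|M ij.1 ij.2|) (i, j)).
Qed.

Lemma mx_norm_le m n (M : 'M[R]_(m, n)) (a : R) :
  0 <= a -> (forall i j, `|M i j| <= a) -> `|M| <= a.
Proof.
move=> a0 h; rewrite [leLHS]/Num.Def.normr /= mx_normrE.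
by apply: bigmax_le => // -[i j] _; exact: h.
Qed.

(** The vector whose slices lebesgue_int integrates: first coordinate t,
    remaining coordinates y. *)
Definition glue n (t : R) (y : 'rV[R]_n) : 'rV[R]_(1 + n) := row_mx (t%:M : 'rV_1) y.

Lemma glue_l n t (y : 'rV[R]_n) : glue t y 0 (lshift n 0) = t.
Proof. by rewrite /glue row_mxEl mxE eqxx. Qed.

Lemma glue_r n t (y : 'rV[R]_n) i : glue t y 0 (rshift 1 i) = y 0 i.
Proof. by rewrite /glue row_mxEr. Qed.

Lemma glueK n (x : 'rV[R]_(1 + n)) : glue (x 0 (lshift n 0)) (rsubmx x) = x.
Proof.
apply/rowP => i; case: (split_ordP i) => j ->.
  by rewrite (ord1 j) glue_l.
by rewrite glue_r mxE.
Qed.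

Lemma glueD n t s (y z : 'rV[R]_n) : glue (t + s) (y + z) = glue t y + glue s z.
Proof. by rewrite /glue add_row_mx raddfD. Qed.

Lemma norm_glue_l n t (y : 'rV[R]_n) : `|t| <= `|glue t y|.
Proof. by rewrite -{1}(glue_l t y); exact: norm_entry_le. Qed.

Lemma norm_glue_r n t (y : 'rV[R]_n) : `|y| <= `|glue t y|.
Proof.
apply: mx_norm_le => // i j; rewrite (ord1 i) -(glue_r t y); exact: norm_entry_le.
Qed.

Lemma continuous_pair_at (S T U : topologicalType) (f : S -> T) (g : S -> U) x :
  {for x, continuous f} -> {for x, continuous g} ->
  {for x, continuous (fun y => (f y, g y))}.
Proof. by move=> cf cg; exact: cvg_pair. Qed.

Lemma continuous_glue n : continuous (fun z : R * 'rV[R]_n => glue z.1 z.2).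
Proof.
move=> z; apply: continuous_mx => i j; rewrite (ord1 i).
case: (split_ordP j) => k ->.
  rewrite (ord1 k) (_ : (fun y => _) = fst); last by apply/funext => y; rewrite glue_l.
  exact: cvg_fst.
rewrite (_ : (fun y => _) = fun y : R * 'rV[R]_n => y.2 0 k); last first.
  by apply/funext => y; rewrite glue_r.
apply: (@continuous_comp _ _ _ snd (fun y : 'rV[R]_n => y 0 k)); first exact: cvg_snd.
exact: coord_continuous.
Qed.

Definition supp_in n (r : R) (w : 'rV[R]_n -> R) :=
  continuous w /\ forall x, r < `|x| -> w x = 0.

Definition slice n (w : 'rV[R]_n.+1 -> R) (t : R) : 'rV[R]_n -> R := fun y => w (glue t y).

Definition eint n (w : 'rV[R]_n -> R) : R := fine (lebesgue_int (EFin \o w)).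

Lemma supp_in_slice n (r : R) (w : 'rV[R]_n.+1 -> R) t : supp_in r w -> supp_in r (slice w t).
Proof.
move=> [cw sw]; split.
  move=> y; apply: (@continuous_comp _ _ _ (glue t) w); last exact: cw.
  apply: (@continuous_comp _ _ _ (fun y => (t, y)) (fun z => glue z.1 z.2)).
    by apply: (@continuous_pair_at _ _ _ (fun=> t) id); [exact: cst_continuous|exact: cvg_id].
  exact: continuous_glue.
by move=> y ry; apply: sw; apply: lt_le_trans ry _; exact: norm_glue_r.
Qed.

Lemma supp_inD n (r : R) (w w' : 'rV[R]_n -> R) a :
  supp_in r w -> supp_in r w' -> supp_in r (fun x => a * w x + w' x).
Proof.
move=> [cw sw] [cw' sw']; split; last by move=> x rx; rewrite sw// sw'// mulr0 addr0.
move=> x.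
apply: (@continuousD _ _ _ (fun x => a * w x) w'); last exact: cw'.
by apply: (@continuousM _ _ (cst a) w); [exact: cst_continuous|exact: cw].
Qed.

Lemma compact_cball n (r : R) : compact [set x : 'rV[R]_n | `|x| <= r].
Proof.
apply: bounded_closed_compact.
  exists r; split; first exact: num_real.
  by move=> s rs x /= xr; rewrite (le_trans xr)// ltW.
rewrite (_ : [set x | _] = (fun x : 'rV[R]_n => `|x|) @^-1` [set s | s <= r]) //.
apply: closed_comp; last exact: closed_le.
by move=> x _; exact: norm_continuous.
Qed.

(** Continuity at t holds uniformly in y because y ranges over a compact
    ball, outside of which both slices vanish. *)
Lemma slice_unif n (r : R) (w : 'rV[R]_n.+1 -> R) (t e : R) : supp_in r w -> 0 < e ->
  \forall s \near t, forall y, `|slice w t y - slice w s y| <= e.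
Proof.
move=> [cw sw] e0.
have cov := (@compact_near_coveringP _ _).1 (@compact_cball n r).
have := cov R (nbhs t) (fun s y => `|slice w t y - slice w s y| < e) _.
move=> h; have {}h : \forall s \near t, forall y, `|y| <= r -> `|slice w t y - slice w s y| < e.
  apply: h => y _.
  have c1 : {for (y, t), continuous (fun z : 'rV[R]_n * R => slice w t z.1 - slice w z.2 z.1)}.
    apply: cvgB.
      apply: (@continuous_comp _ _ _ (fun z : 'rV[R]_n * R => glue t z.1) w); last exact: cw.
      apply: (@continuous_comp _ _ _ (fun z : 'rV[R]_n * R => (t, z.1)) (fun z => glue z.1 z.2)).
        by apply: (@continuous_pair_at _ _ _ (fun=> t) fst); [exact: cst_continuous|exact: cvg_fst].
      exact: continuous_glue.
    apply: (@continuous_comp _ _ _ (fun z : 'rV[R]_n * R => glue z.2 z.1) w); last exact: cw.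
    apply: (@continuous_comp _ _ _ (fun z : 'rV[R]_n * R => (z.2, z.1)) (fun z => glue z.1 z.2)).
      by apply: continuous_pair_at; [exact: cvg_snd|exact: cvg_fst].
    exact: continuous_glue.
  have /cvgrPdist_lt/(_ e e0) := c1; rewrite /= subrr.
  by under eq_near do rewrite sub0r normrN.
apply: filterS h => s h y; have [yr|ry] := leP `|y| r; first by rewrite ltW// h.
rewrite /slice !sw ?subrr ?normr0 ?ltW//; apply: lt_le_trans ry _; exact: norm_glue_r.
Qed.

Lemma cont1_integrable (W : R -> R) (r : R) : continuous W -> (forall t, r < `|t| -> W t = 0) ->
  mu.-integrable setT (EFin \o W) /\
  (\int[mu]_t W t = \int[mu]_(t in `[- r, r]) W t)%R.
Proof.
move=> cW sW.
have E : W = W \_ `[- r, r].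
  apply/funext => t; rewrite patchE; case: ifPn => // /negP tr.
  apply: sW; rewrite ltNge; apply/negP => tr'; apply: tr.
  by rewrite inE /= in_itv /= -ler_norml.
split; last by rewrite [RHS]Rintegral_mkcond -E.
have I : mu.-integrable `[- r, r] (EFin \o W).
  apply: continuous_compact_integrable; first exact: segment_compact.
  exact: continuous_subspaceT.
by rewrite E -restrict_EFin; apply: (integrable_mkcond _ _).1.
Qed.

Lemma cont1_bound (W : R -> R) (r M : R) : 0 <= r -> continuous W ->
  (forall t, r < `|t| -> W t = 0) -> (forall t, `|W t| <= M) ->
  `|\int[mu]_t W t| <= 2 * r * M.
Proof.
move=> r0 cW sW WM; have [iW ->] := cont1_integrable cW sW.
have iW' : mu.-integrable `[- r, r] (EFin \o W) by apply: integrableS iW.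
apply: le_trans (le_normr_Rintegral _ iW') _ => //.
apply: (@le_trans _ _ (\int[mu]_(t in `[- r, r]) M)).
  apply: le_Rintegral => //.
  - exact: integrable_abse iW'.
  - apply: continuous_compact_integrable; first exact: segment_compact.
    by move=> x; exact: cvg_cst.
rewrite Rintegral_cst//= lebesgue_measure_itv/= lte_fin.
case: ifPn => _; first by rewrite -EFinD /= opprK -mulr2n mulr_natl mulrC.
by rewrite mulr0 mulr_ge0// ?mulr_ge0// (le_trans _ (WM 0)).
Qed.

End Slices.

(** * Linearity, translation invariance and integrals of derivatives *)

Section EuclideanIntegral.
Context {R : realType}.
Notation mu := (@lebesgue_measure R).

(** What the induction on the dimension has to carry: the outer integrand of
    the iterated integral is continuous because the inner integral is linear
    and bounded by the supremum, and its continuity and bounded support give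
    the same three properties one dimension higher. *)
Definition eint_good n (r : R) :=
  [/\ forall w : 'rV[R]_n -> R, supp_in r w -> lebesgue_int (EFin \o w) = (eint w)%:E,
      forall (w : 'rV[R]_n -> R) (M : R), supp_in r w -> (forall x, `|w x| <= M) ->
        `|eint w| <= (2 * r) ^+ n * M
    & forall a (w w' : 'rV[R]_n -> R), supp_in r w -> supp_in r w' ->
        eint (fun x => a * w x + w' x) = a * eint w + eint w'].

Section step.
Variables (n : nat) (r : R) (r0 : 0 <= r) (H : eint_good n r).

Let eint0 : eint (fun _ : 'rV[R]_n => 0 : R) = 0.
Proof.
have [_ Hb _] := H.
have := Hb (fun=> 0) 0; rewrite mulr0 => h.
apply/eqP; rewrite -normr_le0; apply: h; last by move=> x; rewrite normr0.
by split=> // x; exact: cst_continuous.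
Qed.

Lemma eint_slice_supp (w : 'rV[R]_n.+1 -> R) (t : R) :
  supp_in r w -> r < `|t| -> eint (slice w t) = 0.
Proof.
move=> [_ sw] rt; rewrite -eint0; congr eint; apply/funext => y.
by apply: sw; apply: lt_le_trans rt _; exact: norm_glue_l.
Qed.

(** The slices at s and at t differ uniformly little, and the inner integral
    is bounded by the supremum. *)
Lemma eint_slice_continuous (w : 'rV[R]_n.+1 -> R) : supp_in r w ->
  continuous (fun t => eint (slice w t)).
Proof.
have [_ Hb Hl] := H.
move=> sw t; apply/cvgrPdist_le => e e0.
pose C : R := (2 * r) ^+ n + 1.
have C0 : 0 < C by rewrite ltr_wpDl// exprn_ge0// mulr_ge0.
have eC : 0 < e / C by rewrite divr_gt0.
apply: filterS (slice_unif t sw eC) => s hs.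
have -> : eint (slice w t) - eint (slice w s) = eint (fun y => - 1 * slice w s y + slice w t y).
  rewrite Hl; [by rewrite mulN1r addrC|exact: supp_in_slice|exact: supp_in_slice].
apply: le_trans (Hb _ (e / C) _ _) _.
- by apply: supp_inD; exact: supp_in_slice.
- by move=> y; rewrite mulN1r addrC.
- rewrite mulrA ler_pdivrMr// mulrC ler_pM2l// /C.
  by rewrite lerDl.
Qed.

Lemma eint_slice_EFin (w : 'rV[R]_n.+1 -> R) : supp_in r w ->
  lebesgue_int (EFin \o w) = (\int[mu]_t (eint (slice w t))%:E)%E.
Proof.
move=> sw; apply: eq_integral => t _.
have [Ha _ _] := H.
by rewrite -Ha//; exact: supp_in_slice.
Qed.

Lemma eintS (w : 'rV[R]_n.+1 -> R) : supp_in r w ->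
  eint w = (\int[mu]_t (eint (slice w t)))%R.
Proof. by move=> sw; rewrite /eint eint_slice_EFin. Qed.

Lemma eint_slice_integrable (w : 'rV[R]_n.+1 -> R) : supp_in r w ->
  mu.-integrable setT (EFin \o (fun t => eint (slice w t))).
Proof.
move=> sw.
by have [] := cont1_integrable (eint_slice_continuous sw) (fun t => eint_slice_supp sw (t := t)).
Qed.

Lemma eint_good_step : eint_good n.+1 r.
Proof.
have [_ Hb Hl] := H.
split=> [w sw|w M sw wM|a w w' sw sw'].
- rewrite eint_slice_EFin// /eint eint_slice_EFin// fineK//.
  by apply: integrable_fin_num => //; exact: eint_slice_integrable.
- rewrite eintS// exprS -mulrA.
  apply: cont1_bound => //; first exact: eint_slice_continuous.
    by move=> t rt; exact: eint_slice_supp.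
  by move=> t; apply: Hb => [|y]; [exact: supp_in_slice|exact: wM].
- rewrite !eintS//; last exact: supp_inD.
  rewrite -RintegralZl//; last exact: eint_slice_integrable.
  rewrite -RintegralD//; last 2 first.
  + rewrite (_ : EFin \o _ = (fun t => a%:E * (EFin \o (fun t => eint (slice w t))) t)%E)//.
    by apply: integrableZl => //; exact: eint_slice_integrable.
  + exact: eint_slice_integrable.
  apply: eq_Rintegral => t _.
  by rewrite -Hl//; exact: supp_in_slice.
Qed.

End step.

Lemma eint_goodP n (r : R) : 0 <= r -> eint_good n r.
Proof.
move=> r0; elim: n => [|n IH]; last exact: eint_good_step.
split=> [w sw|w M sw wM|a w w' sw sw'].
- by [].
- by rewrite expr0 mul1r; exact: wM.
- by [].
Qed.

(** Continuous functions with bounded support. *)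
Definition csupp n (w : 'rV[R]_n -> R) := exists2 r, 0 <= r & supp_in r w.

Lemma csupp_common n (w w' : 'rV[R]_n -> R) : csupp w -> csupp w' ->
  exists r, [/\ 0 <= r, supp_in r w & supp_in r w'].
Proof.
move=> [r r0 [cw sw]] [r' r0' [cw' sw']]; exists (Num.max r r'); split.
- by rewrite le_max r0.
- by split=> // x; rewrite gt_max => /andP[/sw].
- by split=> // x; rewrite gt_max => /andP[_ /sw'].
Qed.

Lemma csuppD n a (w w' : 'rV[R]_n -> R) : csupp w -> csupp w' ->
  csupp (fun x => a * w x + w' x).
Proof.
move=> cw cw'; have [r [r0 sw sw']] := csupp_common cw cw'.
by exists r => //; exact: supp_inD.
Qed.

Lemma csupp0 n : csupp (fun _ : 'rV[R]_n => 0 : R).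
Proof. by exists 0 => //; split=> // x; exact: cst_continuous. Qed.

Lemma eintE n (w : 'rV[R]_n -> R) : csupp w -> lebesgue_int (EFin \o w) = (eint w)%:E.
Proof. by move=> [r r0 sw]; have [] := eint_goodP n r0; auto. Qed.

Lemma eint_lin n a (w w' : 'rV[R]_n -> R) : csupp w -> csupp w' ->
  eint (fun x => a * w x + w' x) = a * eint w + eint w'.
Proof.
move=> cw cw'; have [r [r0 sw sw']] := csupp_common cw cw'.
by have [_ _] := eint_goodP n r0; apply.
Qed.

Lemma eint0 n : eint (fun _ : 'rV[R]_n => 0 : R) = 0.
Proof.
have := eint_lin 1 (csupp0 n) (csupp0 n).
under [X in eint X]eq_fun do rewrite mul1r addr0.
by rewrite mul1r -{1}[eint _]addr0 => /addrI.
Qed.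

Lemma csupp_sum n (I : Type) (s : seq I) (w : I -> 'rV[R]_n -> R) :
  (forall i, csupp (w i)) -> csupp (fun x => \sum_(i <- s) w i x).
Proof.
move=> h; elim: s => [|i s IH].
  by under eq_fun do rewrite big_nil; exact: csupp0.
have := csuppD 1 (h i) IH.
by under eq_fun do rewrite mul1r -(big_cons _ _ i s xpredT (fun i => w i _)).
Qed.

Lemma eint_sum n (I : Type) (s : seq I) (w : I -> 'rV[R]_n -> R) :
  (forall i, csupp (w i)) -> eint (fun x => \sum_(i <- s) w i x) = \sum_(i <- s) eint (w i).
Proof.
move=> h; elim: s => [|i s IH].
  by under eq_fun do rewrite big_nil; rewrite big_nil eint0.
rewrite big_cons -IH -[eint (w i)]mul1r -eint_lin//; last exact: csupp_sum.
by congr eint; apply/funext => x; rewrite big_cons mul1r.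
Qed.

Lemma cont1_itv (W : R -> R) (p q : R) :
  (forall t, t \notin `[p, q] -> W t = 0) ->
  (\int[mu]_t W t = \int[mu]_(t in `[p, q]) W t)%R.
Proof.
move=> sW; have E : W = W \_ `[p, q].
  apply/funext => t; rewrite patchE; case: ifPn => // /negP tr.
  by apply: sW; apply/negP => tr'; apply: tr; rewrite inE.
by rewrite [RHS]Rintegral_mkcond -E.
Qed.

(** On the interval of half-length K = r + |a| both integrands have their
    whole support, and the change of variable is a translation. *)
Lemma cont1_shift (W : R -> R) (r a : R) : 0 <= r -> continuous W ->
  (forall t, r < `|t| -> W t = 0) ->
  (\int[mu]_t W (t + a) = \int[mu]_t W t)%R.
Proof.
move=> r0 cW sW.
pose K := r + `|a|.
have K0 : 0 <= K by rewrite addr_ge0.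
have sW' t : t \notin `[- K + a, K + a] -> W t = 0.
  move=> tK; apply: sW; rewrite ltNge; apply/negP => tr; move/negP: tK; apply.
  move: tr; rewrite in_itv /= ler_norml => /andP[t1 t2].
  have := ler_norm a; have := ler_norm (- a); rewrite normrN /K => h1 h2.
  by apply/andP; split; lra.
rewrite (cont1_itv (W := fun t => W (t + a)) (p := - K) (q := K)); last first.
  move=> t tK; apply: sW'; apply: contra tK.
  by rewrite !in_itv/= !lerD2r.
rewrite (cont1_itv sW').
pose F := fun t : R => t + a.
have dF (t : R) : is_derive t 1 F 1.
  rewrite -[X in is_derive _ _ _ X]addr0.
  by apply: is_deriveD.
have F1 : F^`()%classic = cst 1.
  by apply/funext => t; rewrite derive1E; have [_ ->] := dF t.
have cF : continuous F.
  by move=> t; apply: differentiable_continuous; apply/derivable1_diffP; have [] := dF t.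
have KK : - K <= K by rewrite (le_trans _ K0)// oppr_le0.
have S := @integration_by_substitution_increasing R F W (- K) K KK.
congr fine; apply: esym.
rewrite S.
- by apply: eq_integral => t _; rewrite F1 /= mulr1.
- by move=> x y _ _; rewrite ltrD2r.
- by rewrite F1 => x _; exact: cst_continuous.
- by rewrite F1; exact: is_cvg_cst.
- by rewrite F1; exact: is_cvg_cst.
- split.
  + by move=> x _; have [] := dF x.
  + by apply: cvg_at_right_filter; exact: cF.
  + by apply: cvg_at_left_filter; exact: cF.
- exact: continuous_subspaceT.
Qed.

Lemma csupp_shift n (w : 'rV[R]_n -> R) (v : 'rV[R]_n) : csupp w -> csupp (fun x => w (x + v)).
Proof.
move=> [r r0 [cw sw]]; exists (r + `|v|); first by rewrite addr_ge0.
split=> [x|x rx].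
  apply: (@continuous_comp _ _ _ (fun x : 'rV[R]_n => x + v) w); last exact: cw.
  by apply: (@continuousD _ _ _ id (cst v)); [exact: cvg_id|exact: cst_continuous].
apply: sw; rewrite -(ltrD2r `|v|) (lt_le_trans rx)//.
by rewrite -{1}(addrK v x) -(normrN v) ler_normD.
Qed.

(** Translate the first coordinate in the outer integral, then the others in
    the inner one. *)
Lemma eint_shift n (w : 'rV[R]_n -> R) (v : 'rV[R]_n) : csupp w -> eint (fun x => w (x + v)) = eint w.
Proof.
elim: n w v => [|n IH] w v cw.
  by rewrite /eint /=; congr w; apply/rowP; case.
have [r [r0 sw sw']] := csupp_common cw (csupp_shift v cw).
have H := eint_goodP n r0.
rewrite (eintS H sw') (eintS H sw).
rewrite -(cont1_shift ((v : 'rV_(1 + n)) 0 (lshift n 0)) r0 (eint_slice_continuous r0 H sw) (fun t => eint_slice_supp H sw (t:=t))).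
apply: eq_Rintegral => t _.
rewrite -(IH (slice w (t + (v : 'rV_(1 + n)) 0 (lshift n 0))) (rsubmx (v : 'rV_(1 + n)))); last first.
  by exists r => //; exact: supp_in_slice.
by congr eint; apply/funext => y; rewrite /slice glueD glueK.
Qed.

(** Uniform continuity along v: on a large ball by compactness, and for |s|
    at most 1 both terms vanish outside it. *)
Lemma csupp_unif n (g : 'rV[R]_n -> R) (v : 'rV[R]_n) (e : R) : csupp g -> 0 < e ->
  exists2 d : R, 0 < d & forall s x, `|s| < d -> `|g (x + s *: v) - g x| <= e.
Proof.
move=> [r r0 [cg sg]] e0.
have cov := (@compact_near_coveringP _ _).1 (@compact_cball R n (r + `|v|)).
have h : \forall s \near (0 : R), forall y, `|y| <= r + `|v| -> `|g (y + s *: v) - g y| < e.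
  apply: (cov R (nbhs (0 : R)) (fun s y => `|g (y + s *: v) - g y| < e)) => y _.
  have c1 : {for (y, 0 : R), continuous (fun z : 'rV[R]_n * R => g (z.1 + z.2 *: v) - g z.1)}.
    apply: (@continuousB _ _ _ (fun z : 'rV[R]_n * R => g (z.1 + z.2 *: v)) (fun z : 'rV[R]_n * R => g z.1)).
      apply: (@continuous_comp _ _ _ (fun z : 'rV[R]_n * R => z.1 + z.2 *: v) g); last exact: cg.
      apply: (@continuousD _ _ _ fst (fun z : 'rV[R]_n * R => z.2 *: v)); first exact: cvg_fst.
      by apply: cvgZr_tmp; exact: cvg_snd.
    apply: (@continuous_comp _ _ _ (fun z : 'rV[R]_n * R => z.1) g); last exact: cg.
    exact: cvg_fst.
  have /cvgrPdist_lt/(_ e e0) := c1; rewrite /= scale0r addr0 subrr.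
  by under eq_near do rewrite sub0r normrN.
have /nbhs_ballP[d /= d0 hd] := h.
exists (Num.min d 1); first by rewrite lt_min d0 ltr01.
move=> s x; rewrite lt_min => /andP[sd s1].
have [xr|rx] := leP `|x| (r + `|v|).
  by apply/ltW; apply: hd => //; rewrite /ball/= sub0r normrN.
rewrite !sg ?subrr ?normr0 ?ltW//.
  by apply: le_lt_trans rx; rewrite lerDl.
rewrite -(ltrD2r `|v|) (lt_le_trans rx)//.
rewrite -{1}(addrK (s *: v) x) (le_trans (ler_normB _ _))// lerD2l normrZ.
by rewrite ler_piMl// ltW.
Qed.

(** The difference quotients of w in the direction v integrate to zero by
    translation invariance, and they converge uniformly to the derivative,
    with supports in a common ball. *)
Lemma eint_derive n (w : 'rV[R]_n -> R) (v : 'rV[R]_n) : csupp w -> (forall x, differentiable w x) ->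
  csupp ('D_v w) -> eint ('D_v w) = 0.
Proof.
move=> cw dw cg.
have [r [r0 sw sg]] := csupp_common cw cg.
(* Radius of a ball containing the support of w and its translates. *)
pose q := r + `|v|.
have q0 : 0 <= q by rewrite addr_ge0.
pose C : R := (2 * q) ^+ n + 1.
have C0 : 0 < C by rewrite ltr_wpDl// exprn_ge0// mulr_ge0.
apply/eqP; rewrite -normr_le0; apply/ler_addgt0Pr => e e0; rewrite add0r.
have eC : 0 < e / C by rewrite divr_gt0.
have [d d0 hd] := csupp_unif v cg eC.
pose s := Num.min (d / 2) 1.
have s0 : 0 < s by rewrite lt_min divr_gt0//= ltr01.
have sd : s < d by rewrite gt_min ltr_pdivrMr// ltr_pMr// ltr1n.
have s1 : s <= 1 by rewrite ge_min lexx orbT.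
have cws : csupp (fun x => w (x + s *: v)) by exact: csupp_shift.
have E : eint (fun x => - s^-1 * (w (x + s *: v)) + (s^-1 * w x + 'D_v w x)) = eint ('D_v w).
  rewrite eint_lin//; last exact: csuppD.
  by rewrite eint_lin// eint_shift// addrA mulNr addNr add0r.
rewrite -E.
have [_ Hb _] := eint_goodP n q0.
apply: le_trans (Hb _ (e / C) _ _) _; last first.
  by rewrite mulrA ler_pdivrMr// mulrC ler_pM2l// /C lerDl.
- move=> x.
  have [c c01 hc] : exists2 c : R, 0 < c < 1 & w (x + s *: v) - w x = 'D_(s *: v) w (x + c *: (s *: v)).
    by apply: MVT_dir.
  have -> : - s^-1 * w (x + s *: v) + (s^-1 * w x + 'D_v w x) =
     - ('D_v w (x + (c * s) *: v) - 'D_v w x).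
    have -> : w (x + s *: v) = w x + s * 'D_v w (x + (c * s) *: v).
      by rewrite -[s * _]/(s *: 'D_v w _) -derive_dirZ// -scalerA -hc [RHS]addrC subrK.
    set A := 'D_v w (x + _); set B := 'D_v w x.
    by field; exact: lt0r_neq0.
  rewrite normrN; apply: hd; rewrite normrM !gtr0_norm//; last by case/andP: c01.
  by rewrite (lt_trans _ sd)// gtr_pMl//; case/andP: c01.
- have sq : supp_in q w.
    by have [c1 c2] := sw; split=> // x qx; apply: c2; apply: le_lt_trans qx; rewrite lerDl.
  have gq : supp_in q ('D_v w).
    by have [c1 c2] := sg; split=> // x qx; apply: c2; apply: le_lt_trans qx; rewrite lerDl.
  apply: supp_inD; last exact: supp_inD.
  have [cw1 cw2] := sw; split=> [x|x rx].
    apply: (@continuous_comp _ _ _ (fun x : 'rV[R]_n => x + s *: v) w); last exact: cw1.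
    by apply: (@continuousD _ _ _ id (cst (s *: v))); [exact: cvg_id|exact: cst_continuous].
  apply: cw2; rewrite -(ltrD2r `|v|) (lt_le_trans rx)//.
  rewrite -{1}(addrK (s *: v) x) (le_trans (ler_normB _ _))// lerD2l normrZ.
  by rewrite gtr0_norm// ler_piMl.
Qed.

(** By continuity W is at least half of W t0 on an interval around t0. *)
Lemma cont1_gt0 (W : R -> R) (r t0 : R) : 0 <= r -> continuous W ->
  (forall t, r < `|t| -> W t = 0) -> (forall t, 0 <= W t) -> 0 < W t0 ->
  0 < (\int[mu]_t W t)%R.
Proof.
move=> r0 cW sW W0 Wt0.
have Wt20 : 0 < W t0 / 2 by rewrite divr_gt0.
have /cvgrPdist_lt/(_ _ Wt20) := cW t0.
move=> /nbhs_ballP[d /= d0 hd].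
(* Half of the radius, for a closed interval inside the open ball. *)
pose c := d / 2; have c0 : 0 < c by rewrite divr_gt0.
have hW t : t \in `[t0 - c, t0 + c] -> W t0 / 2 <= W t.
  rewrite in_itv/= => /andP[t1 t2].
  have : `|W t0 - W t| < W t0 / 2.
    apply: hd; rewrite /ball/= ltr_norml; apply/andP; split.
      by apply: (@lt_le_trans _ _ (- c)); [rewrite ltrN2 /c; lra|lra].
    by apply: (@le_lt_trans _ _ c); [lra|rewrite /c; lra].
  by rewrite ltr_norml => /andP[_]; lra.
have [iW _] := cont1_integrable cW sW.
apply: (@lt_le_trans _ _ (\int[mu]_(t in `[t0 - c, t0 + c]) (W t0 / 2))%R).
  rewrite Rintegral_cst//= lebesgue_measure_itv/= lte_fin ifT; last lra.
  by rewrite -EFinD /= mulr_gt0//; lra.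
apply: (@le_trans _ _ (\int[mu]_(t in `[t0 - c, t0 + c]) W t)%R).
  apply: le_Rintegral => //.
  - apply: continuous_compact_integrable; first exact: segment_compact.
    by move=> x; exact: cst_continuous.
  - by apply: integrableS iW.
rewrite Rintegral_mkcond; apply: le_Rintegral => //.
  rewrite -restrict_EFin; apply: (integrable_mkcond _ _).1 => //.
  by apply: integrableS iW.
by move=> t _; rewrite patchE; case: ifP.
Qed.

Lemma eint_ge0 n (w : 'rV[R]_n -> R) : (forall x, 0 <= w x) -> 0 <= eint w.
Proof.
move=> w0; apply: fine_ge0; elim: n w w0 => [|n IH] w w0 /=; first by rewrite lee_fin.
by apply: integral_ge0 => t _; apply: (IH (slice w t)) => y; exact: w0.
Qed.

Lemma eint_gt0 n (w : 'rV[R]_n -> R) x0 : csupp w -> (forall x, 0 <= w x) -> 0 < w x0 ->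
  0 < eint w.
Proof.
elim: n w x0 => [|n IH] w x0 cw w0 wx0.
  by rewrite /eint /=; move: wx0; congr (0 < w _); apply/rowP; case.
have [r r0 sw] := cw.
have H := eint_goodP n r0.
rewrite (eintS H sw).
apply: (@cont1_gt0 _ r ((x0 : 'rV_(1 + n)) 0 (lshift n 0)) r0 (eint_slice_continuous r0 H sw)).
- by move=> t; exact: (eint_slice_supp H sw).
- by move=> t; apply: eint_ge0 => y; exact: w0.
- apply: (IH _ (rsubmx (x0 : 'rV_(1 + n)))).
  + by exists r => //; exact: supp_in_slice.
  + by move=> y; exact: w0.
  + by rewrite /slice glueK.
Qed.

End EuclideanIntegral.

#[local] Notation coord := Defs.coord.

(** * Charts *)

Section Charts.
Context {R : realType}.

Section one_chart.
Context {T : topologicalType} {m : nat} (c : chart R T m).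

Lemma cimg_coord p : cdom c p -> cimg c (coord c p).
Proof. by move=> cp; exists p. Qed.

Lemma cdom_cinv x : cimg c x -> cdom c (cinv c x).
Proof. by move=> [p cp <-]; rewrite coordK. Qed.

Lemma cinvK x : cimg c x -> coord c (cinv c x) = x.
Proof. by move=> [p cp <-]; rewrite coordK. Qed.

Definition cdomain (A : set T) : set 'rV[R]_m := coord c @` (cdom c `&` A).

Lemma cdomainP A x : cdomain A x <-> cimg c x /\ A (cinv c x).
Proof.
split; first by move=> [p [cp Ap] <-]; rewrite coordK//; split => //; exists p.
by move=> [[p cp <-]]; rewrite coordK// => Ap; exists p.
Qed.

Lemma cdomain_coord A p : cdom c p -> A p -> cdomain A (coord c p).
Proof. by move=> cp Ap; exists p. Qed.

Lemma open_cdomain A : open A -> open (cdomain A).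
Proof.
move=> oA; rewrite openE => x /cdomainP[cx Ax].
have h1 : nbhs x (cimg c) by apply: open_nbhs_nbhs; split => //; exact: cimg_open.
have h2 : nbhs x (cinv c @^-1` A).
  by apply: (cinv_continuous cx); exact: open_nbhs_nbhs.
by apply: filterS2 h1 h2 => y cy Ay; apply/cdomainP.
Qed.

Lemma open_cimg : open (cimg c). Proof. exact: cimg_open. Qed.

End one_chart.

Lemma Ck_local (V W : normedModType R) k (U : set V) (f : V -> W) :
  (forall x, U x -> exists V', [/\ open V', V' x & Ck k V' f]) -> Ck k U f.
Proof.
elim: k f => [|k IH] f h.
  by move=> x /h[V' [_ V'x]]; apply.
split=> [x /h[V' [_ V'x hf]]|v]; first exact: Ck_differentiable hf V'x.
apply: IH => x /h[V' [oV' V'x hf]]; exists V'; split => //; exact: Ck_derive hf.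
Qed.

Lemma Ck_id (V : normedModType R) k (U : set V) : Ck k U (@id V).
Proof.
case: k => [|k]; first by move=> x _; exact: cvg_id.
split=> [x _|v]; first by apply: ex_diff; exact: is_diff_id.
rewrite (_ : 'D_v _ = fun=> v); first exact: Ck_cst.
by apply/funext => x; rewrite derive_id.
Qed.

Definition rep {n m : nat} {L : manifold R n} {M : manifold R m}
  (c : chart R L n) (c' : chart R M m) (F : L -> M) : 'rV[R]_n -> 'rV[R]_m :=
  fun x => coord c' (F (cinv c x)).

Section rep.
Context {n m : nat} {L : manifold R n} {M : manifold R m}.
Variables (F : L -> M) (sF : smooth_map F).
Variables (c : chart R L n) (c' : chart R M m) (ac : atlas c) (ac' : atlas c').

Lemma open_rep_dom : open (cdomain c (F @^-1` cdom c')).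
Proof.
apply: open_cdomain; apply: open_comp; first by move=> p _; exact: sF.1.
exact: cdom_open.
Qed.

Lemma Ck_rep k : Ck k (cdomain c (F @^-1` cdom c')) (rep c c' F).
Proof. exact: sF.2 ac ac' k. Qed.

Lemma rep_img x : cdomain c (F @^-1` cdom c') x -> cimg c' (rep c c' F x).
Proof. by move=> /cdomainP[_ h]; exact: cimg_coord. Qed.

Lemma cinv_rep x : cdomain c (F @^-1` cdom c') x -> cinv c' (rep c c' F x) = F (cinv c x).
Proof. by move=> /cdomainP[_ h]; rewrite /rep coordK. Qed.

Lemma differentiable_rep x : cdomain c (F @^-1` cdom c') x -> differentiable (rep c c' F) x.
Proof. exact: Ck_differentiable (Ck_rep 1). Qed.

End rep.

Lemma smooth_map_id n (M : manifold R n) : smooth_map (@id M).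
Proof.
split; first by move=> x; exact: cvg_id.
by move=> c c' ac ac'; exact: atlas_smooth.
Qed.

Lemma derive_rep_comp n m l (L : manifold R n) (M : manifold R m) (N : manifold R l)
    (F : L -> M) (G : M -> N) c c' c'' x v :
  smooth_map F -> smooth_map G -> atlas c -> atlas c' -> atlas c'' ->
  cdomain c (F @^-1` cdom c') x -> cdom c'' (G (F (cinv c x))) ->
  'D_v (rep c c'' (G \o F)) x = 'D_('D_v (rep c c' F) x) (rep c' c'' G) (rep c c' F x).
Proof.
move=> sF sG ac ac' ac'' Dx Gx.
have Dx' : cdomain c' (G @^-1` cdom c'') (rep c c' F x).
  by apply/cdomainP; split; [exact: rep_img|rewrite /= cinv_rep].
rewrite -(derive_comp (f := rep c c' F) (g := rep c' c'' G)); last 2 first.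
- exact: differentiable_rep.
- exact: differentiable_rep.
apply: near_eq_derive; apply: (near_open _ Dx); first exact: open_rep_dom.
by move=> y Dy; rewrite /rep /= -/(rep c c' F y) cinv_rep.
Qed.

Lemma derive_rep_id n (M : manifold R n) (c : chart R M n) x v : cimg c x ->
  'D_v (rep c c (@id M)) x = v.
Proof.
move=> cx; rewrite (near_eq_derive (g := id)) ?derive_id//.
have oc : open (cimg c) by exact: open_cimg.
by apply: (near_open oc cx) => y cy; rewrite /rep cinvK.
Qed.

(** The differential of a coordinate change is inverted by that of the
    opposite change. *)
Lemma derive_transK n (M : manifold R n) (c c' : chart R M n) x v :
  atlas c -> atlas c' -> cdomain c (cdom c') x ->
  'D_('D_v (rep c c' (@id M)) x) (rep c' c (@id M)) (rep c c' (@id M) x) = v.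
Proof.
move=> ac ac' Dx; have [cx _] := (cdomainP _ _ _).1 Dx.
rewrite -(derive_rep_comp (F := @id M) (G := @id M) (c'' := c)) //.
- exact: derive_rep_id.
- exact: smooth_map_id.
- exact: smooth_map_id.
- exact: cdom_cinv.
Qed.

(** * Positive definite matrices *)

Definition posdef n (B : 'M[R]_n) := B^T = B /\ forall u, u != 0 -> 0 < dot B u u.

Lemma posdef_eq0 n (B : 'M[R]_n) u : posdef B -> (forall v, dot B u v = 0) -> u = 0.
Proof.
move=> [_ pB] h; apply/eqP; apply: contraT => /pB.
by rewrite h ltxx.
Qed.

Lemma posdef_ge0 n (B : 'M[R]_n) u : posdef B -> 0 <= dot B u u.
Proof.
move=> [_ pB]; have [->|/pB/ltW//] := eqVneq u 0; by rewrite dot0l.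
Qed.

Lemma posdef_unit n (B : 'M[R]_n) : posdef B -> B \in unitmx.
Proof.
move=> pB; rewrite -row_free_unit -kermx_eq0; apply/eqP/row_matrixP => i; rewrite row0.
apply: (posdef_eq0 pB) => v.
by rewrite /dot -row_mul mulmx_ker row0 mul0mx mxE.
Qed.

Lemma posdef1 n : posdef (1%:M : 'M[R]_n).
Proof.
split=> [|u u0]; first exact: trmx1.
rewrite dotE lt_neqAle; apply/andP; split; last first.
  apply: sumr_ge0 => i _; rewrite (bigD1 i)//= big1 ?addr0.
    by rewrite !mxE eqxx mulr1 -expr2 sqr_ge0.
  by move=> j ji; rewrite mxE eq_sym (negbTE ji) mulr0 mul0r.
apply: contra u0; rewrite eq_sym => /eqP s0; apply/eqP/rowP => i; rewrite mxE.
have E : \sum_i u 0 i ^+ 2 = 0.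
  rewrite -[RHS]s0; apply: eq_bigr => k _; rewrite (bigD1 k)//= big1 ?addr0.
    by rewrite !mxE eqxx mulr1.
  by move=> j jk; rewrite mxE eq_sym (negbTE jk) mulr0 mul0r.
have /(_ i isT)/eqP := psumr_eq0P (fun k _ => sqr_ge0 (u 0 k)) E.
by rewrite sqrf_eq0 => /eqP.
Qed.

Lemma dotDB n (A B : 'M[R]_n) u v : dot (A + B) u v = dot A u v + dot B u v.
Proof. by rewrite /dot mulmxDr mulmxDl mxE. Qed.

Lemma dotZB n a (B : 'M[R]_n) u v : dot (a *: B) u v = a * dot B u v.
Proof. by rewrite /dot -scalemxAr -scalemxAl mxE. Qed.

Lemma posdef_segment n (A B : 'M[R]_n) t : posdef A -> posdef B -> 0 <= t <= 1 ->
  posdef (A + t *: (B - A)).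
Proof.
move=> [sA pA] [sB pB] /andP[t0 t1].
have -> : A + t *: (B - A) = (1 - t) *: A + t *: B.
  by rewrite scalerBr scalerBl scale1r addrA addrAC.
split=> [|u u0]; first by rewrite linearD/= !linearZ/= sA sB.
rewrite dotDB !dotZB.
have := pA u u0; have := pB u u0; move: t0; rewrite le_eqVlt => /predU1P[<-|t0] hB hA.
  by rewrite subr0 mul1r mul0r addr0.
by rewrite ltr_wpDl// ?mulr_gt0// mulr_ge0 ?subr_ge0// ltW.
Qed.

(** The determinant does not vanish on the segment joining the identity to
    B, so it keeps its sign. *)
Lemma posdef_det_gt0 n (B : 'M[R]_n) : posdef B -> 0 < \det B.
Proof.
move=> pB.
pose f t := \det (1%:M + t *: (B - 1%:M)).
have f0 t : 0 <= t <= 1 -> f t != 0.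
  move=> t01; rewrite -unitfE -unitmxE; apply: posdef_unit.
  exact: posdef_segment (posdef1 n) pB t01.
have cf : continuous f.
  have hf : Ck 0 setT f; last by move=> t; exact: hf.
  apply: Ck_det; first exact: openT.
  move=> i j; rewrite (_ : (fun _ => _) = fun t : R => (1%:M : 'M[R]_n) i j + t * (B - 1%:M) i j).
    apply: Ck_add; [exact: openT|exact: Ck_cst|apply: Ck_mul; [exact: openT| |exact: Ck_cst]].
    exact: Ck_id.
  by apply/funext => s; rewrite !mxE.
have [//|B0] := ltP 0 (\det B).
have fB : f 1 = \det B by rewrite /f scale1r addrC subrK.
have f1 : f 0 = 1 by rewrite /f scale0r addr0 det1.
have [||c] := @IVT _ f 0 1 0 ler01.
- exact: continuous_subspaceT.
- by rewrite fB f1 ge_min le_max ler01 B0 orbT.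
- by rewrite in_itv/= => /f0/negP h /eqP.
Qed.

End Charts.

(** * Metrics in charts *)

Section Metrics.
Context {R : realType}.

Lemma dot_row n m (B : 'M[R]_m) (w : 'I_n -> 'rV[R]_m) u v :
  dot (\matrix_(i, j) dot B (w i) (w j)) u v =
  dot B (\sum_i u 0 i *: w i) (\sum_i v 0 i *: w i).
Proof.
have Dl I (r : seq I) (a : I -> R) (f : I -> 'rV[R]_m) z :
    dot B (\sum_(i <- r) a i *: f i) z = \sum_(i <- r) a i * dot B (f i) z.
  elim: r => [|i r IH]; first by rewrite !big_nil dot0l.
  by rewrite !big_cons dotDl dotZl IH.
have Dr I (r : seq I) (a : I -> R) (f : I -> 'rV[R]_m) z :
    dot B z (\sum_(i <- r) a i *: f i) = \sum_(i <- r) a i * dot B z (f i).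
  elim: r => [|i r IH]; first by rewrite !big_nil dot0r.
  by rewrite !big_cons dotDr dotZr IH.
rewrite dotE Dl; apply: eq_bigr => i _; rewrite Dr mulr_sumr; apply: eq_bigr => j _.
by rewrite mxE; ring.
Qed.

Lemma dot_delta n (C : 'M[R]_n) i j : dot C (delta_mx 0 i) (delta_mx 0 j) = C i j.
Proof. by rewrite /dot -rowE trmx_delta -colE !mxE. Qed.

Lemma dot_ext n (A B : 'M[R]_n) : (forall u v, dot A u v = dot B u v) -> A = B.
Proof. by move=> h; apply/matrixP => i j; rewrite -!dot_delta h. Qed.

Section one_manifold.
Context {m : nat} {M : manifold R m} (g : M -> 'M[R]_m).

(** The Gram matrix is the pull-back of the inner product by the
    differential of the change to the preferred chart. *)
Lemma local_metricE c x u v : atlas c -> cimg c x ->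
  dot (local_metric g c x) u v =
  dot (g (cinv c x)) ('D_u (rep c (chart_at (cinv c x)) (@id M)) x)
                     ('D_v (rep c (chart_at (cinv c x)) (@id M)) x).
Proof.
move=> ac cx; rewrite dot_row.
have ac' := chart_at_atlas (cinv c x).
have d : differentiable (rep c (chart_at (cinv c x)) (@id M)) x.
  apply: differentiable_rep => //; first exact: smooth_map_id.
  by apply/cdomainP; split => //; exact: chart_at_dom.
by rewrite !(derive_partial _ d).
Qed.

(** Chain rule: the change from c to the preferred chart factors through c',
    so that coordinate changes are isometries. *)
Lemma local_metric_pull c c' x u v : atlas c -> atlas c' -> cdomain c (cdom c') x ->
  dot (local_metric g c x) u v =
  dot (local_metric g c' (rep c c' (@id M) x)) ('D_u (rep c c' (@id M)) x) ('D_v (rep c c' (@id M)) x).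
Proof.
move=> ac ac' Dx; have [cx cx'] := (cdomainP _ _ _).1 Dx.
have sid := smooth_map_id M.
have ix : cimg c' (rep c c' (@id M) x) by exact: cimg_coord.
have ex : cinv c' (rep c c' (@id M) x) = cinv c x by exact: coordK.
have aq := chart_at_atlas (cinv c x); have dq := chart_at_dom (cinv c x).
have E1 := local_metricE u v ac cx.
have E2 := local_metricE ('D_u (rep c c' (@id M)) x) ('D_v (rep c c' (@id M)) x) ac' ix.
rewrite ex in E2.
have Eu := derive_rep_comp u sid sid ac ac' aq Dx dq.
have Ev := derive_rep_comp v sid sid ac ac' aq Dx dq.
by rewrite E1 E2 -Eu -Ev.
Qed.

Lemma local_metric_chart_at p : local_metric g (chart_at p) (coord (chart_at p) p) = g p.
Proof.
have ap := chart_at_atlas p; have dp := chart_at_dom p.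
have cp := cimg_coord dp.
apply: dot_ext => u v; rewrite local_metricE//.
by rewrite !coordK// !derive_rep_id.
Qed.

Section metric.
Hypothesis hg : riemannian_metric g.

Lemma metric_posdef p : posdef (g p).
Proof. by case: hg => h1 h2 _; split; [exact: h1|exact: h2]. Qed.

Lemma local_metric_posdef c x : atlas c -> cimg c x -> posdef (local_metric g c x).
Proof.
move=> ac cx; have [gs gp] := metric_posdef (cinv c x).
have ap := chart_at_atlas (cinv c x); have dp := chart_at_dom (cinv c x).
split=> [|u u0].
  by apply/matrixP => i j; rewrite !mxE dot_sym.
rewrite local_metricE//; apply: gp; apply: contra u0 => /eqP E.
have Dx : cdomain c (cdom (chart_at (cinv c x))) x by apply/cdomainP.
have := derive_transK u ac ap Dx; rewrite E => <-.
by rewrite derive0.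
Qed.

Lemma local_metric_sym c x : atlas c -> cimg c x -> (local_metric g c x)^T = local_metric g c x.
Proof. by move=> ac cx; have [] := local_metric_posdef ac cx. Qed.

Lemma local_metric_unit c x : atlas c -> cimg c x -> local_metric g c x \in unitmx.
Proof. by move=> ac cx; apply: posdef_unit; exact: local_metric_posdef. Qed.

Lemma local_metric_det c x : atlas c -> cimg c x -> 0 < \det (local_metric g c x).
Proof. by move=> ac cx; apply: posdef_det_gt0; exact: local_metric_posdef. Qed.

Lemma Ck_local_metric c k : atlas c -> Ck k (cimg c) (local_metric g c).
Proof. by case: hg => _ _ h ac; exact: h. Qed.

Lemma Ck_local_metric_entry c k i j : atlas c ->
  Ck k (cimg c) (fun x => local_metric g c x i j).
Proof.
move=> ac; have oc : open (cimg c) by exact: open_cimg.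
by apply: (Ck_mxP k _ oc).1; exact: Ck_local_metric.
Qed.

Lemma differentiable_local_metric c x : atlas c -> cimg c x ->
  differentiable (local_metric g c) x.
Proof. by move=> ac; apply: Ck_differentiable; exact: (Ck_local_metric 1). Qed.

End metric.
End one_manifold.

Lemma hess_ext n (G : 'rV[R]_n -> 'M[R]_n) (f f' : 'rV[R]_n -> R) (U : set 'rV[R]_n) x u v :
  open U -> U x -> (forall y, U y -> f y = f' y) -> hess G f x u v = hess G f' x u v.
Proof.
move=> oU Ux ff; rewrite /hess; apply: (f_equal2 (fun a b => a - b)).
  apply: near_eq_derive; apply: (near_open oU Ux) => y Uy.
  by apply: near_eq_derive; exact: near_open ff.
by apply: near_eq_derive; exact: near_open ff.
Qed.

(** The second fundamental form of a coordinate change is orthogonal to the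
    image of its differential (Gauss formula). This differential being onto,
    the form vanishes, and the composition law for Hessians has no extra
    term. *)
Lemma hess_trans n (M : manifold R n) (g : M -> 'M[R]_n) (c c' : chart R M n) (f : M -> R) U x u v :
  riemannian_metric g -> atlas c -> atlas c' -> cdomain c (cdom c') x ->
  open U -> U (cinv c x) -> Ck 2 (cdomain c' U) (f \o cinv c') ->
  hess (local_metric g c) (f \o cinv c) x u v =
  hess (local_metric g c') (f \o cinv c') (rep c c' (@id M) x)
    ('D_u (rep c c' (@id M)) x) ('D_v (rep c c' (@id M)) x).
Proof.
move=> hg ac ac' Dx oU Ux hf.
have sid := smooth_map_id M.
have [cx cx'] := (cdomainP _ _ _).1 Dx.
pose t := rep c c' (@id M).
have ix : cimg c' (t x) by exact: cimg_coord.
have oD : open (cdomain c (cdom c' `&` U)).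
  by apply: open_cdomain; apply: openI => //; exact: cdom_open.
have Dx2 : cdomain c (cdom c' `&` U) x by apply/cdomainP.
have DD : cdomain c (cdom c' `&` U) `<=` cdomain c (cdom c').
  by move=> y /cdomainP[cy [cy' _]]; apply/cdomainP.
have ht k : Ck k (cdomain c (cdom c' `&` U)) t.
  exact: Ck_subset DD (Ck_rep sid ac ac' k).
have tU y : cdomain c (cdom c' `&` U) y -> cdomain c' U (t y).
  by move=> /cdomainP[cy [cy' Uy]]; apply: cdomain_coord.
rewrite (@hess_ext _ _ _ (fun y => (f \o cinv c') (t y)) _ _ _ _ oD Dx2); last first.
  by move=> y /DD Dy; rewrite /= /t cinv_rep.
rewrite (hess_comp (local_metric g c) (local_metric g c') _ _ oD (open_cdomain (c := c') oU) Dx2 (ht 2) hf tU).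
suff -> : sff (local_metric g c) (local_metric g c') t x u v = 0 by rewrite derive0 add0r.
apply: (posdef_eq0 (local_metric_posdef hg ac' ix)) => w.
have Dx' : cdomain c' (cdom c) (t x).
  by apply/cdomainP; split => //; rewrite /t coordK//; exact: cdom_cinv.
have := derive_transK w ac' ac Dx'.
have -> : rep c' c (@id M) (t x) = x by rewrite /rep /t coordK// cinvK.
move=> <-.
apply: (sff_normal (U := cdomain c (cdom c' `&` U))) => //.
- by move=> y /DD Dy a b; exact: local_metric_pull.
- exact: differentiable_local_metric.
- exact: local_metric_sym.
- exact: local_metric_unit.
- exact: differentiable_local_metric.
- exact: local_metric_sym.
- exact: local_metric_unit.
Qed.

End Metrics.

(** * Immersions *)

Section Immersions.
Context {R : realType} {n m : nat} {L : manifold R n} {M : manifold R m}.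
Variables (g : M -> 'M[R]_m) (F : L -> M).
Hypotheses (hg : riemannian_metric g) (hF : immersion F).

#[local] Notation h := (induced_metric g F).
#[local] Notation sF := (hF.1).

Lemma dmapE p u :
  dmap F p u = 'D_u (rep (chart_at p) (chart_at (F p)) F) (coord (chart_at p) p).
Proof. by []. Qed.

Lemma cdomain_self p :
  cdomain (chart_at p) (F @^-1` cdom (chart_at (F p))) (coord (chart_at p) p).
Proof.
apply: cdomain_coord; first exact: chart_at_dom.
exact: (chart_at_dom (F p)).
Qed.

Lemma differentiable_local_rep p :
  differentiable (rep (chart_at p) (chart_at (F p)) F) (coord (chart_at p) p).
Proof.
apply: (differentiable_rep sF); [exact: chart_at_atlas|exact: chart_at_atlas|].
exact: cdomain_self.
Qed.

Lemma induced_metricE p u v : dot (h p) u v = dot (g (F p)) (dmap F p u) (dmap F p v).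
Proof.
have d := differentiable_local_rep p.
rewrite dot_row !dmapE.
by rewrite (derive_partial u d) (derive_partial v d).
Qed.

(** The differential of F read in arbitrary charts; both sides are the
    differential of F from c to the preferred chart at the image point. *)
Lemma dmap_rep c c' x u : atlas c -> atlas c' -> cdomain c (F @^-1` cdom c') x ->
  dmap F (cinv c x) ('D_u (rep c (chart_at (cinv c x)) (@id L)) x) =
  'D_('D_u (rep c c' F) x) (rep c' (chart_at (F (cinv c x))) (@id M)) (rep c c' F x).
Proof.
move=> ac ac' Dx; have [cx cx'] := (cdomainP _ _ _).1 Dx.
set p := cinv c x.
have ap := chart_at_atlas p; have dp := chart_at_dom p.
have aq := chart_at_atlas (F p); have dq := chart_at_dom (F p).
have Dp : cdomain c (@id L @^-1` cdom (chart_at p)) x by apply/cdomainP.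
have E1 := derive_rep_comp u (smooth_map_id L) sF ac ap aq Dp dq.
have E2 := derive_rep_comp u sF (smooth_map_id M) ac ac' aq Dx dq.
exact: etrans (esym E1) E2.
Qed.

Lemma induced_metric_pull c c' x u v : atlas c -> atlas c' -> cdomain c (F @^-1` cdom c') x ->
  dot (local_metric h c x) u v =
  dot (local_metric g c' (rep c c' F x)) ('D_u (rep c c' F) x) ('D_v (rep c c' F) x).
Proof.
move=> ac ac' Dx; have [cx cx'] := (cdomainP _ _ _).1 Dx.
have ix : cimg c' (rep c c' F x) by exact: cimg_coord.
have ex : cinv c' (rep c c' F x) = F (cinv c x) by exact: coordK.
have E1 := local_metricE h u v ac cx.
have E2 := local_metricE g ('D_u (rep c c' F) x) ('D_v (rep c c' F) x) ac' ix.
rewrite ex in E2.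
apply: (etrans E1); apply: etrans (esym E2).
apply: etrans (induced_metricE _ _ _) _.
by rewrite (dmap_rep u ac ac' Dx) (dmap_rep v ac ac' Dx).
Qed.

Lemma Ck_rep_derive k c c' u : atlas c -> atlas c' ->
  Ck k (cdomain c (F @^-1` cdom c')) ('D_u (rep c c' F)).
Proof. by move=> ac ac'; apply: Ck_derive; exact: (Ck_rep sF ac ac' k.+1). Qed.

Lemma Ck_comp_rep c c' k (f : 'rV[R]_m -> R) : atlas c -> atlas c' -> Ck k (cimg c') f ->
  Ck k (cdomain c (F @^-1` cdom c')) (fun x => f (rep c c' F x)).
Proof.
move=> ac ac' hf; apply: (Ck_comp (U' := cimg c')) => //.
- exact: (open_rep_dom sF).
- by move=> x; exact: rep_img.
- exact: (Ck_rep sF ac ac' k).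
Qed.

(** Positivity comes from the injectivity of the differential, smoothness
    from the expression of the pulled back metric in a chart around the
    image point. *)
Lemma riemannian_induced : riemannian_metric h.
Proof.
split.
- move=> p; apply/matrixP => i j; rewrite !mxE; apply: dot_sym.
  by have [] := metric_posdef hg (F p).
- move=> p u u0; rewrite induced_metricE.
  have [_] := metric_posdef hg (F p); apply; apply: contra u0 => /eqP E.
  apply/eqP; apply: (hF.2 p); rewrite E.
  by rewrite dmapE derive0.
- move=> c ac k; apply: Ck_local => x cx.
  set p := cinv c x.
  have aq := chart_at_atlas (F p); have dq := chart_at_dom (F p).
  set c' := chart_at (F p) in aq dq.
  have oD : open (cdomain c (F @^-1` cdom c')) by exact: (open_rep_dom sF).
  exists (cdomain c (F @^-1` cdom c')); split => //; first by apply/cdomainP.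
  apply/Ck_mxP => // i j.
  apply: (@Ck_ext _ _ _ _ _ (fun x => \sum_a \sum_b
     'D_(delta_mx 0 i) (rep c c' F) x 0 a * local_metric g c' (rep c c' F x) a b *
     'D_(delta_mx 0 j) (rep c c' F) x 0 b)) => //.
    move=> y Dy; rewrite -dotE -(induced_metric_pull _ _ ac aq Dy).
    exact: dot_delta.
  apply: Ck_sum => // a _; apply: Ck_sum => // b _.
  apply: Ck_mul => //; first apply: Ck_mul => //.
  + exact: (Ck_mxP k _ oD).1 (Ck_rep_derive k _ ac aq) 0 a.
  + apply: (Ck_comp_rep (f := fun y => local_metric g c' y a b)) => //.
    exact: (Ck_local_metric_entry hg).
  + exact: (Ck_mxP k _ oD).1 (Ck_rep_derive k _ ac aq) 0 b.
Qed.

#[local] Notation hh := riemannian_induced.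

Lemma sff_imm_normal c c' x u v w : atlas c -> atlas c' -> cdomain c (F @^-1` cdom c') x ->
  dot (local_metric g c' (rep c c' F x))
      (sff (local_metric h c) (local_metric g c') (rep c c' F) x u v)
      ('D_w (rep c c' F) x) = 0.
Proof.
move=> ac ac' Dx; have [cx cx'] := (cdomainP _ _ _).1 Dx.
have ix : cimg c' (rep c c' F x) by exact: cimg_coord.
apply: (sff_normal (U := cdomain c (F @^-1` cdom c'))) => //.
- exact: (open_rep_dom sF).
- exact: (Ck_rep sF ac ac' 2).
- by move=> y Dy a b; exact: induced_metric_pull.
- exact: (differentiable_local_metric hh).
- exact: (local_metric_sym hh).
- exact: (local_metric_unit hh).
- exact: (differentiable_local_metric hg).
- exact: (local_metric_sym hg).
- exact: (local_metric_unit hg).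
Qed.

(** The composition law for second derivatives, read in arbitrary charts.
    The first term is a derivative in a normal direction, by sff_imm_normal. *)
Lemma hess_restriction c c' (f : M -> R) U x u v :
  atlas c -> atlas c' -> cdomain c (F @^-1` cdom c') x ->
  open U -> U (F (cinv c x)) -> Ck 2 (cdomain c' U) (f \o cinv c') ->
  hess (local_metric h c) (f \o F \o cinv c) x u v =
  'D_(sff (local_metric h c) (local_metric g c') (rep c c' F) x u v)
    (f \o cinv c') (rep c c' F x) +
  hess (local_metric g c') (f \o cinv c') (rep c c' F x)
    ('D_u (rep c c' F) x) ('D_v (rep c c' F) x).
Proof.
move=> ac ac' Dx oU Ux hf.
have [cx cx'] := (cdomainP _ _ _).1 Dx.
have oFU : open (F @^-1` (cdom c' `&` U)).
  apply: open_comp; first by move=> p _; exact: sF.1.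
  by apply: openI => //; exact: cdom_open.
have oD : open (cdomain c (F @^-1` (cdom c' `&` U))) by exact: open_cdomain.
have Dx2 : cdomain c (F @^-1` (cdom c' `&` U)) x by apply/cdomainP.
have DD : cdomain c (F @^-1` (cdom c' `&` U)) `<=` cdomain c (F @^-1` cdom c').
  by move=> y /cdomainP[cy [cy' _]]; apply/cdomainP.
have ht : Ck 2 (cdomain c (F @^-1` (cdom c' `&` U))) (rep c c' F).
  exact: Ck_subset DD (Ck_rep sF ac ac' 2).
have tU y : cdomain c (F @^-1` (cdom c' `&` U)) y -> cdomain c' U (rep c c' F y).
  by move=> /cdomainP[cy [cy' Uy]]; apply: cdomain_coord.
have E : forall y, cdomain c (F @^-1` (cdom c' `&` U)) y ->
    (f \o F \o cinv c) y = (f \o cinv c') (rep c c' F y).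
  by move=> y /DD Dy; rewrite /= cinv_rep.
apply: (etrans (hess_ext _ _ _ oD Dx2 E)).
exact: (hess_comp (local_metric h c) (local_metric g c') u v oD (open_cdomain (c := c') oU) Dx2 ht hf tU).
Qed.

(** * Mean curvature in the preferred charts *)

Lemma dot_g_chart_at p u v :
  dot (local_metric g (chart_at p) (coord (chart_at p) p)) u v = dot (g p) u v.
Proof. by rewrite local_metric_chart_at. Qed.

(** Two candidates for the normal part differ by a vector both tangent and
    normal, so the vector picked in the definition is the only one. *)
Lemma normal_part_unique p w w' :
  (forall u, dot (g (F p)) w' (dmap F p u) = 0) ->
  (exists u, w = w' + dmap F p u) -> normal_part g F p w = w'.
Proof.
move=> h1 [u Eu]; rewrite /normal_part.
case: xgetP => [w2 _ [h2 [u2 Eu2]]|/(_ w')]; last first.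
  by case; split => //; exists u.
have dl := differentiable_local_rep p.
have E : w2 - w' = dmap F p (u - u2).
  rewrite dmapE derive_dirB// -!dmapE.
  by apply/eqP; rewrite subr_eq addrAC eq_sym subr_eq [_ + w']addrC -Eu Eu2.
apply/eqP; rewrite -subr_eq0; apply/eqP.
have pg := metric_posdef hg (F p).
apply/eqP; apply: contraT => /(pg.2).
by rewrite {2}E dotBl h1 h2 subrr ltxx.
Qed.

#[local] Notation sff0 p := (sff (local_metric h (chart_at p)) (local_metric g (chart_at (F p)))
    (rep (chart_at p) (chart_at (F p)) F) (coord (chart_at p) p)).

Lemma rep_chart_at p :
  rep (chart_at p) (chart_at (F p)) F (coord (chart_at p) p) = coord (chart_at (F p)) (F p).
Proof. by rewrite /rep coordK//; exact: chart_at_dom. Qed.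

(** The ambient derivative differs from sff by the image of the intrinsic
    Christoffel term, which is tangent; and sff is normal. *)
Lemma second_fundamental_formE p u v : second_fundamental_form g F p u v = sff0 p u v.
Proof.
have ap := chart_at_atlas p; have aq := chart_at_atlas (F p).
apply: normal_part_unique.
  move=> w; rewrite dmapE -dot_g_chart_at -rep_chart_at.
  exact: (sff_imm_normal u v w ap aq (cdomain_self p)).
exists (chr (local_metric h (chart_at p)) (coord (chart_at p) p) u v).
rewrite dmapE /sff subrK rep_chart_at.
by apply/rowP => k; rewrite /ambient_deriv !mxE.
Qed.

(** * Orthonormal bases *)

Lemma orthonormal_free k (B : 'M[R]_m) (e : k.-tuple 'rV[R]_m) :
  (forall a b, dot B (tnth e a) (tnth e b) = (a == b)%:R) -> free e.
Proof.
move=> he; apply/freeP => a Ea i.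
have : dot B (\sum_(j < k) a j *: e`_j) (tnth e i) = 0 by rewrite Ea dot0l.
have -> : dot B (\sum_(j < k) a j *: e`_j) (tnth e i) = \sum_(j < k) a j * dot B e`_j (tnth e i).
  elim: (index_enum _) => [|j r IH]; first by rewrite !big_nil dot0l.
  by rewrite !big_cons dotDl dotZl IH.
rewrite (bigD1 i)//= -tnth_nth he eqxx mulr1 big1 ?addr0// => j ji.
by rewrite -tnth_nth he (negbTE ji) mulr0.
Qed.

End Immersions.

Section Orthonormal.
Context {R : realType}.

(** Gram-Schmidt: as long as k < n some nonzero vector is orthogonal to the
    rows already chosen, and it can be normalized. *)
Lemma orthonormal_mx n (B : 'M[R]_n) k : posdef B -> (k <= n)%N ->
  exists E : 'M[R]_(k, n), E *m B *m E^T = 1%:M.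
Proof.
move=> pB; elim: k => [|k IH] kn; first by exists 0; apply/matrixP => -[].
have [E EE] := IH (ltnW kn).
have ker : kermx (B *m E^T) != 0.
  rewrite -mxrank_eq0 mxrank_ker subn_eq0 -ltnNge.
  by apply: leq_ltn_trans kn; exact: rank_leq_col.
pose v := nz_row (kermx (B *m E^T)).
have v0 : v != 0 by rewrite nz_row_eq0.
have vE : v *m B *m E^T = 0.
  by apply/eqP; rewrite -mulmxA -sub_kermx; exact: nz_row_sub.
have dv : 0 < dot B v v by exact: pB.2.
pose s := (Num.sqrt (dot B v v))^-1.
pose w := s *: v.
have wE : w *m B *m E^T = 0 by rewrite /w -!scalemxAl vE scaler0.
have Ew : E *m B *m w^T = 0.
  by apply: trmx_inj; rewrite !trmx_mul trmxK pB.1 mulmxA wE trmx0.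
have ww : w *m B *m w^T = 1%:M.
  apply/matrixP => i j; rewrite (ord1 i) (ord1 j) -/(dot B w w).
  rewrite /w dotZl dotZr mulrA !mxE eqxx /s -invfM -expr2 sqr_sqrtr ?ltW//.
  by rewrite mulVf// gt_eqF.
have : col_mx w E *m B *m (col_mx w E)^T = 1%:M.
  by rewrite mul_col_mx tr_col_mx mul_col_row wE Ew ww EE -scalar_mx_block.
by exists (col_mx w E).
Qed.

Lemma orthonormal_exists n (B : 'M[R]_n) : posdef B ->
  exists e : n.-tuple 'rV[R]_n, onbasis B fullv e.
Proof.
move=> pB; have [E EE] := orthonormal_mx pB (leqnn n).
pose e : n.-tuple 'rV[R]_n := [tuple row i E | i < n].
have he a b : dot B (tnth e a) (tnth e b) = (a == b)%:R.
  rewrite !tnth_mktuple; have /matrixP/(_ a b) := EE; rewrite !mxE => <-.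
  rewrite dotE exchange_big; apply: eq_bigr => j _ /=.
  by rewrite !mxE mulr_suml; apply: eq_bigr => i _; rewrite !mxE.
exists e; split => //.
rewrite basisEfree (orthonormal_free he) subvf /=.
by rewrite size_map size_enum_ord dimvf dim_matrix; apply: eq_leq; exact: mul1n.
Qed.

End Orthonormal.

(** * Laplacian and mean curvature *)

Section LaplacianManifold.
Context {R : realType} {n : nat} {N : manifold R n}.

Definition laplacian (g : N -> 'M[R]_n) (u : N -> R) (p : N) : R :=
  lapl (local_metric g (chart_at p)) (u \o cinv (chart_at p)) (coord (chart_at p) p).

Definition Ck_on k (U : set N) (u : N -> R) :=
  forall c, atlas c -> Ck k (cdomain c U) (u \o cinv c).

Lemma trace_hess g c (u : N -> R) U x (e : n.-tuple 'rV[R]_n) :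
  atlas c -> open U -> cdomain c U x -> Ck_on 2 U u ->
  (forall a b, dot (local_metric g c x) (tnth e a) (tnth e b) = (a == b)%:R) ->
  \sum_a hess (local_metric g c) (u \o cinv c) x (tnth e a) (tnth e a) =
  lapl (local_metric g c) (u \o cinv c) x.
Proof.
move=> ac oU Ux hu he.
apply: (orthonormal_trace (B := hess (local_metric g c) (u \o cinv c) x) _ _ he).
- by move=> a w w' v; exact: hess_linear_l (hu c ac) Ux.
- by move=> a w v v'; exact: hess_linear_r (open_cdomain oU) (hu c ac) Ux.
Qed.

(** An orthonormal basis in one chart is carried to an orthonormal basis in
    the other, and Hessians agree. *)
Lemma laplacian_chart g c (u : N -> R) U p : riemannian_metric g ->
  atlas c -> cdom c p -> open U -> U p -> Ck_on 2 U u ->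
  laplacian g u p = lapl (local_metric g c) (u \o cinv c) (coord c p).
Proof.
move=> hg ac cp oU Up hu.
have a0 := chart_at_atlas p; have d0 := chart_at_dom p.
set c0 := chart_at p in a0 d0 *.
have [e [_ he]] := orthonormal_exists (metric_posdef hg p).
rewrite -local_metric_chart_at -/c0 in he.
have x0 : cdomain c0 U (coord c0 p) by exact: cdomain_coord.
have Dx : cdomain c0 (cdom c) (coord c0 p) by exact: cdomain_coord.
have tx : rep c0 c (@id N) (coord c0 p) = coord c p by rewrite /rep coordK.
have Up0 : U (cinv c0 (coord c0 p)) by rewrite coordK.
rewrite /laplacian -(trace_hess a0 oU x0 hu he).
pose e' : n.-tuple 'rV[R]_n := [tuple 'D_(tnth e a) (rep c0 c (@id N)) (coord c0 p) | a < n].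
rewrite -(@trace_hess g c u U (coord c p) e' ac oU)//; last 2 first.
- exact: cdomain_coord.
- move=> a b; rewrite -he !tnth_mktuple -tx.
  by apply: esym; exact: local_metric_pull.
apply: eq_bigr => a _.
apply: (etrans (hess_trans _ _ hg a0 ac Dx oU Up0 (hu c ac))).
by rewrite tx tnth_mktuple.
Qed.

(** The definition expands the Hessian on coordinate vectors; bilinearity
    turns it into the coordinate-free form. *)
Lemma hessianE (g : N -> 'M[R]_n) (f : N -> R) U q u v :
  open U -> U q -> Ck_on 2 U f ->
  hessian g f q u v =
  hess (local_metric g (chart_at q)) (f \o cinv (chart_at q)) (coord (chart_at q) q) u v.
Proof.
move=> oU Uq hf.
have ac := chart_at_atlas q; have dc := chart_at_dom q.
rewrite /hessian; set c := chart_at q in ac dc *.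
set x := coord c q; set f' := f \o cinv c.
have Ux : cdomain c U x by exact: cdomain_coord.
have hfc := hf c ac.
have df y : cdomain c U y -> differentiable f' y by exact: Ck_differentiable hfc.
have d2f j : differentiable (partial j f') x := Ck_differentiable (Ck_derive (delta_mx 0 j) hfc) Ux.
have E1 : 'D_u ('D_v f') x = \sum_i \sum_j u 0 i * v 0 j * partial i (partial j f') x.
  transitivity ('D_u (fun y => \sum_j v 0 j * partial j f' y) x).
    apply: near_eq_derive; apply: (near_open (open_cdomain oU) Ux) => y Uy.
    by rewrite (derive_partial v (df y Uy)).
  rewrite derive_fsum; last by move=> j _; exact: differentiableM.
  rewrite [RHS]exchange_big; apply: eq_bigr => j _ /=.
  rewrite (derive_mulr _ (differentiable_cst _ _) (d2f j)) derive_cst mul0r add0r.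
  rewrite (derive_partial u (d2f j)) mulr_sumr; apply: eq_bigr => i _.
  by rewrite /GRing.scale/= mulrA [v 0 j * _]mulrC.
have E2 : 'D_(chr (local_metric g c) x u v) f' x =
    \sum_i \sum_j u 0 i * v 0 j * \sum_k christoffel g c x i j k * partial k f' x.
  rewrite (derive_partial _ (df x Ux)).
  transitivity (\sum_k \sum_i \sum_j u 0 i * v 0 j * (christoffel g c x i j k * partial k f' x)).
    apply: eq_bigr => k _; rewrite mxE scaler_suml; apply: eq_bigr => i _.
    rewrite scaler_suml; apply: eq_bigr => j _.
    rewrite /GRing.scale/= -/(christoffel g c x i j k).
    by set cc := christoffel _ _ _ _ _ _; set pp := partial _ _ _; ring.
  rewrite exchange_big; apply: eq_bigr => i _ /=.
  rewrite exchange_big; apply: eq_bigr => j _ /=.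
  by rewrite mulr_sumr.
rewrite /hess; apply: (etrans _ (esym (f_equal2 (fun a b => a - b) E1 E2))).
rewrite -sumrB; apply: eq_bigr => i _; rewrite -sumrB; apply: eq_bigr => j _.
by rewrite mulrBr.
Qed.

End LaplacianManifold.

Section MeanCurvature.
Context {R : realType} {n m : nat} {L : manifold R n} {M : manifold R m}.
Variables (g : M -> 'M[R]_m) (F : L -> M).
Hypotheses (hg : riemannian_metric g) (hF : immersion F).

#[local] Notation h := (induced_metric g F).
#[local] Notation sF := (hF.1).
#[local] Notation hh := (riemannian_induced hg hF).
#[local] Notation sff0 p := (sff (local_metric h (chart_at p)) (local_metric g (chart_at (F p)))
    (rep (chart_at p) (chart_at (F p)) F) (coord (chart_at p) p)).

(** Orthonormal bases exist, so the one picked in the definition of the mean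
    curvature is genuine. *)
Lemma mean_curvatureE p : exists2 e : n.-tuple 'rV[R]_n,
  (forall a b, dot (h p) (tnth e a) (tnth e b) = (a == b)%:R) &
  mean_curvature g F p = \sum_a sff0 p (tnth e a) (tnth e a).
Proof.
rewrite /mean_curvature.
case: xgetP => [e _ [_ he]|none]; last first.
  have [e he] := orthonormal_exists (metric_posdef hh p).
  by have := none e he.
exists e => //; apply: eq_bigr => a _.
exact: second_fundamental_formE.
Qed.

(** Trace of the Hessian of a restriction over an orthonormal basis of the
    tangent space of L. *)
Lemma laplacian_restriction p (e : n.-tuple 'rV[R]_n) (f : M -> R) U :
  (forall a b, dot (h p) (tnth e a) (tnth e b) = (a == b)%:R) ->
  mean_curvature g F p = \sum_a sff0 p (tnth e a) (tnth e a) ->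
  open U -> U (F p) -> Ck_on 2 U f -> Ck_on 2 (F @^-1` U) (f \o F) ->
  laplacian h (f \o F) p = dfun f (F p) (mean_curvature g F p) +
    \sum_a hessian g f (F p) (dmap F p (tnth e a)) (dmap F p (tnth e a)).
Proof.
move=> he HE oU Up hf hfF.
have oFU : open (F @^-1` U) by apply: open_comp => // q _; exact: sF.1.
have a0 := chart_at_atlas p; have d0 := chart_at_dom p.
have a1 := chart_at_atlas (F p); have d1 := chart_at_dom (F p).
have he' := he; rewrite -local_metric_chart_at in he'.
have x0 : cdomain (chart_at p) (F @^-1` U) (coord (chart_at p) p) by exact: cdomain_coord.
have y0 : cdomain (chart_at (F p)) U (coord (chart_at (F p)) (F p)) by exact: cdomain_coord.
have df := Ck_differentiable (hf _ a1) y0.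
rewrite /laplacian -(trace_hess a0 oFU x0 hfF he').
rewrite HE /dfun derive_dir_sum//.
rewrite -big_split; apply: eq_bigr => a _ /=.
rewrite (hessianE g _ _ oU Up hf).
have Ux : U (F (cinv (chart_at p) (coord (chart_at p) p))) by rewrite coordK.
have := hess_restriction g hF (tnth e a) (tnth e a) a0 a1 (cdomain_self F p) oU Ux (hf _ a1).
by rewrite rep_chart_at.
Qed.

Lemma Ck_on_comp k U (f : M -> R) : open U -> Ck_on k U f -> Ck_on k (F @^-1` U) (f \o F).
Proof.
move=> oU hf c ac; apply: Ck_local => x /cdomainP[cx Ux].
set q := F (cinv c x) in Ux.
have a1 := chart_at_atlas q; have d1 := chart_at_dom q.
set c' := chart_at q in a1 d1.
have oFU : open (F @^-1` (cdom c' `&` U)).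
  apply: open_comp; first by move=> p _; exact: sF.1.
  by apply: openI => //; exact: cdom_open.
have oD : open (cdomain c (F @^-1` (cdom c' `&` U))) by exact: open_cdomain.
have DD : cdomain c (F @^-1` (cdom c' `&` U)) `<=` cdomain c (F @^-1` cdom c').
  by move=> y /cdomainP[cy [cy' _]]; apply/cdomainP.
exists (cdomain c (F @^-1` (cdom c' `&` U))); split => //; first by apply/cdomainP.
apply: (@Ck_ext _ _ _ _ _ (fun y => (f \o cinv c') (rep c c' F y))) => //.
  by move=> y /DD Dy; rewrite /= cinv_rep.
apply: (Ck_comp (U' := cdomain c' U)) => //.
- by move=> y /cdomainP[cy [cy' Uy]]; apply: cdomain_coord.
- exact: Ck_subset DD (Ck_rep sF ac a1 k).
- exact: hf.
Qed.

End MeanCurvature.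

(** * Continuity of the mean curvature *)

Section Continuity.
Context {R : realType}.

Lemma Ck_chr n m k (G : 'rV[R]_m -> 'M[R]_m) (phi a b : 'rV[R]_n -> 'rV[R]_m)
    (U : set 'rV[R]_n) (U' : set 'rV[R]_m) :
  open U -> open U' -> (forall x, U x -> U' (phi x)) ->
  Ck k U phi -> Ck k U a -> Ck k U b ->
  (forall i j, Ck k.+1 U' (fun y => G y i j)) -> (forall y, U' y -> G y \in unitmx) ->
  Ck k U (fun x => chr G (phi x) (a x) (b x)).
Proof.
move=> oU oU' UU' hphi ha hb hG uG; apply/Ck_mxP => // i0 l0.
apply: (@Ck_ext _ _ _ _ _ (fun x => \sum_i \sum_j
    (2^-1 * \sum_l invmx (G (phi x)) l0 l *
      (dcoef G (phi x) i j l + dcoef G (phi x) j i l - dcoef G (phi x) l i j)) *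
      a x 0 i * b x 0 j)) => //.
  by move=> x Ux; rewrite mxE.
have hd i j l : Ck k U (fun x => dcoef G (phi x) i j l).
  apply: (Ck_comp (f := fun y => dcoef G y i j l) oU UU' hphi).
  exact: Ck_derive (hG j l).
have hG' i j : Ck k U' (fun y => G y i j) by exact: Ck_S.
apply: Ck_sum => // i _; apply: Ck_sum => // j _.
apply: Ck_mul => //; last exact: (Ck_mxP k _ oU).1 hb 0 j.
apply: Ck_mul => //; last exact: (Ck_mxP k _ oU).1 ha 0 i.
apply: Ck_mul => //; first exact: Ck_cst.
apply: Ck_sum => // l _; apply: Ck_mul => //.
  apply: (Ck_comp (f := fun y => invmx (G y) l0 l) oU UU' hphi).
  exact: Ck_invmx.
by apply: Ck_sub => //; apply: Ck_add.
Qed.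

Lemma Ck_sff n m k (G' : 'rV[R]_n -> 'M[R]_n) (G : 'rV[R]_m -> 'M[R]_m)
    (phi : 'rV[R]_n -> 'rV[R]_m) (U : set 'rV[R]_n) (U' : set 'rV[R]_m) u v :
  open U -> open U' -> (forall x, U x -> U' (phi x)) -> Ck k.+2 U phi ->
  (forall i j, Ck k.+1 U' (fun y => G y i j)) -> (forall y, U' y -> G y \in unitmx) ->
  (forall i j, Ck k.+1 U (fun y => G' y i j)) -> (forall y, U y -> G' y \in unitmx) ->
  Ck k U (fun x => sff G' G phi x u v).
Proof.
move=> oU oU' UU' hphi hG uG hG' uG'.
have h2 w : Ck k.+1 U ('D_w phi) by exact: Ck_derive hphi.
apply: Ck_sub => //; first apply: Ck_add => //.
- exact: Ck_derive (h2 v).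
- by apply: (Ck_chr (U' := U')) => //; [exact: Ck_S (Ck_S hphi)|exact: Ck_S|exact: Ck_S].
- have hc : Ck k U (fun x => chr G' x u v).
    apply: (@Ck_chr _ _ k G' id (fun=> u) (fun=> v) U U oU oU) => //; [exact: Ck_id|exact: Ck_cst|exact: Ck_cst].
  apply/Ck_mxP => // i0 l0.
  apply: (@Ck_ext _ _ _ _ _ (fun x => \sum_i chr G' x u v 0 i * 'D_(delta_mx 0 i) phi x i0 l0)) => //.
    move=> x Ux; rewrite (derive_partial _ (Ck_differentiable hphi Ux)) summxE.
    by apply: eq_bigr => i _; rewrite [RHS]mxE.
  apply: Ck_sum => // i _; apply: Ck_mul => //.
    exact: (Ck_mxP k _ oU).1 hc 0 i.
  exact: (Ck_mxP k _ oU).1 (Ck_S (h2 _)) i0 l0.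
Qed.

Context {n m : nat} {L : manifold R n} {M : manifold R m}.
Variables (g : M -> 'M[R]_m) (F : L -> M).
Hypotheses (hg : riemannian_metric g) (hF : immersion F).

#[local] Notation h := (induced_metric g F).
#[local] Notation sF := (hF.1).
#[local] Notation hh := (riemannian_induced hg hF).

(** The trace of the second fundamental form through the inverse metric
    instead of an orthonormal basis: in this form it visibly depends
    smoothly on the point. *)
Definition local_mean_curvature c c' (x : 'rV[R]_n) : 'rV[R]_m :=
  \sum_i \sum_j invmx (local_metric h c x) i j *:
     sff (local_metric h c) (local_metric g c') (rep c c' F) x (delta_mx 0 i) (delta_mx 0 j).

Lemma Ck_local_mean_curvature k c c' : atlas c -> atlas c' ->
  Ck k (cdomain c (F @^-1` cdom c')) (local_mean_curvature c c').
Proof.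
move=> ac ac'.
have oD : open (cdomain c (F @^-1` cdom c')) by exact: (open_rep_dom sF).
have DD : cdomain c (F @^-1` cdom c') `<=` cimg c by move=> y /cdomainP[].
have hG k' i j : Ck k' (cdomain c (F @^-1` cdom c')) (fun y => local_metric h c y i j).
  by apply: Ck_subset DD _; exact: (Ck_local_metric_entry hh).
have uG y : cdomain c (F @^-1` cdom c') y -> local_metric h c y \in unitmx.
  by move=> /DD cy; exact: (local_metric_unit hh).
apply: Ck_sum => // i _; apply: Ck_sum => // j _.
apply/Ck_mxP => // i0 l0.
apply: (@Ck_ext _ _ _ _ _ (fun x => invmx (local_metric h c x) i j *
  sff (local_metric h c) (local_metric g c') (rep c c' F) x (delta_mx 0 i) (delta_mx 0 j) i0 l0)) => //.
  by move=> x _; rewrite [RHS]mxE.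
apply: Ck_mul => //; first exact: Ck_invmx.
apply: (Ck_mxP k _ oD).1 => //.
have oc : open (cimg c') by exact: open_cimg.
apply: (Ck_sff _ _ oD oc) => //.
- by move=> x; exact: rep_img.
- exact: (Ck_rep sF ac ac' k.+2).
- by move=> i' j'; exact: (Ck_local_metric_entry hg).
- by move=> y cy; exact: (local_metric_unit hg).
Qed.

Lemma Ck_on_coord k c' l : atlas c' -> Ck_on k (cdom c') (fun q : M => coord c' q 0 l).
Proof.
move=> ac' c ac.
have oD : open (cdomain c (cdom c')) by apply: open_cdomain; exact: cdom_open.
exact: (Ck_mxP k _ oD).1 (Ck_rep (smooth_map_id M) ac ac' k) 0 l.
Qed.

Lemma derive_coord (c' : chart R M m) (l : 'I_m) (y w : 'rV[R]_m) : cimg c' y ->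
  'D_w ((fun q : M => coord c' q 0 l) \o cinv c') y = w 0 l.
Proof.
move=> cy; have oc : open (cimg c') by exact: open_cimg.
rewrite (near_eq_derive (g := fun y : 'rV[R]_m => y 0 l)).
  have d : differentiable (@id 'rV[R]_m) y by apply: ex_diff; exact: is_diff_id.
  by rewrite -(derive_entry w 0 l d) derive_id.
by apply: (near_open oc cy) => z cz /=; rewrite cinvK.
Qed.

(** Computed coordinate by coordinate: the differential of a coordinate
    function along the mean curvature is a difference of two traces (the
    Laplacian of its restriction and the trace of its ambient Hessian), each
    independent of the charts. *)
Lemma mean_curvature_chart c c' p : atlas c -> atlas c' -> cdom c p -> cdom c' (F p) ->
  'D_(mean_curvature g F p) (rep (chart_at (F p)) c' (@id M)) (coord (chart_at (F p)) (F p)) =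
  local_mean_curvature c c' (coord c p).
Proof.
move=> ac ac' cp cFp.
have a0 := chart_at_atlas p; have d0 := chart_at_dom p.
have a1 := chart_at_atlas (F p); have d1 := chart_at_dom (F p).
have [e he HE] := mean_curvatureE hg hF p.
set c0 := chart_at p in a0 d0 HE *; set c1 := chart_at (F p) in a1 d1 HE *.
set y0 := coord c1 (F p).
have sidM := smooth_map_id M; have sidL := smooth_map_id L.
have Dy0 : cdomain c1 (cdom c') y0 by exact: cdomain_coord.
have dT : differentiable (rep c1 c' (@id M)) y0 by exact: (differentiable_rep sidM).
apply/rowP => l.
(* laplacian_restriction applied to a coordinate function of c'. *)
pose f : M -> R := fun q : M => coord c' q 0 l.
have oc' : open (cdom c') by exact: cdom_open.
have hf k : Ck_on k (cdom c') f by exact: Ck_on_coord.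
have hfF : Ck_on 2 (F @^-1` cdom c') (f \o F) by exact: Ck_on_comp.
have oFU : open (F @^-1` cdom c') by apply: open_comp => // q _; exact: sF.1.
have := laplacian_restriction hF he HE oc' cFp (hf 2) hfF.
have -> : dfun f (F p) (mean_curvature g F p) =
   'D_(mean_curvature g F p) (rep c1 c' (@id M)) y0 0 l.
  by rewrite derive_entry.
move=> /esym/(canRL (addrK _)) ->.
have hUp : (F @^-1` cdom c') p by [].
rewrite (laplacian_chart hh ac cp oFU hUp hfF).
set x := coord c p.
have Dx : cdomain c (F @^-1` cdom c') x by exact: cdomain_coord.
have cx : cimg c x by exact: cimg_coord.
have y1 : rep c c' F x = coord c' (F p) by rewrite /rep coordK.
have cy : cimg c' (rep c c' F x) by exact: rep_img.
have Ux : cdom c' (F (cinv c x)) by rewrite coordK.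
have hfc' : Ck 2 (cdomain c' (cdom c')) (f \o cinv c') := hf 2 c' ac'.
have Dy : cdomain c' (cdom c') (rep c c' F x) by apply/cdomainP; split => //; exact: cdom_cinv.
pose B u v := hess (local_metric g c') (f \o cinv c') (rep c c' F x)
      ('D_u (rep c c' F) x) ('D_v (rep c c' F) x).
have dphi : differentiable (rep c c' F) x by exact: (differentiable_rep sF).
have Bl a u u' v : B (a *: u + u') v = a * B u v + B u' v.
  by rewrite /B (derive_dirP a u u' dphi); exact: hess_linear_l hfc' Dy.
have Br a u v v' : B u (a *: v + v') = a * B u v + B u v'.
  by rewrite /B (derive_dirP a v v' dphi); exact: hess_linear_r (open_cdomain (c := c') oc') hfc' Dy.
pose e' : n.-tuple 'rV[R]_n := [tuple 'D_(tnth e a) (rep c0 c (@id L)) (coord c0 p) | a < n].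
have Dx0 : cdomain c0 (cdom c) (coord c0 p) by exact: cdomain_coord.
have tx : rep c0 c (@id L) (coord c0 p) = x by rewrite /rep coordK.
have he' a b : dot (local_metric h c x) (tnth e' a) (tnth e' b) = (a == b)%:R.
  rewrite -he -local_metric_chart_at !tnth_mktuple -tx.
  by apply: esym; exact: local_metric_pull.
have -> : \sum_a hessian g f (F p) (dmap F p (tnth e a)) (dmap F p (tnth e a)) =
   \sum_a B (tnth e' a) (tnth e' a).
  apply: eq_bigr => a _.
  have cFp' : cdom c' (cinv c1 y0) by rewrite /y0 coordK.
  rewrite (hessianE g _ _ oc' cFp (hf 2)).
  apply: (etrans (hess_trans _ _ hg a1 ac' Dy0 oc' cFp' (hf 2 c' ac'))).
  have -> : rep c1 c' (@id M) y0 = rep c c' F x by rewrite y1 /rep /y0 coordK.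
  have E : 'D_(dmap F p (tnth e a)) (rep c1 c' (@id M)) y0 = 'D_(tnth e' a) (rep c c' F) x.
    have cF0 : cdom c' (F (cinv c0 (coord c0 p))) by rewrite coordK.
    have Dx0' : cdomain c0 (F @^-1` cdom c1) (coord c0 p) by exact: cdomain_coord.
    have E1 := derive_rep_comp (tnth e a) sF sidM a0 a1 ac' Dx0' cF0.
    have E2 := derive_rep_comp (tnth e a) sidL sF a0 ac ac' Dx0 cF0.
    rewrite tx in E2; rewrite rep_chart_at in E1.
    rewrite tnth_mktuple; exact: etrans (esym E1) E2.
  by rewrite E.
rewrite (orthonormal_trace Bl Br he').
rewrite /lapl -sumrB /local_mean_curvature summxE; apply: eq_bigr => i _.
rewrite -sumrB summxE; apply: eq_bigr => j _.
rewrite (hess_restriction g hF _ _ ac ac' Dx oc' Ux hfc').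
rewrite (derive_coord _ _ cy) -/(B (delta_mx 0 i) (delta_mx 0 j)) [RHS]mxE.
by rewrite mulrDr addrK.
Qed.

Lemma norm_mean_curvature_chart c c' p : atlas c -> atlas c' -> cdom c p -> cdom c' (F p) ->
  metric_norm g (F p) (mean_curvature g F p) =
  Num.sqrt (dot (local_metric g c' (rep c c' F (coord c p)))
     (local_mean_curvature c c' (coord c p)) (local_mean_curvature c c' (coord c p))).
Proof.
move=> ac ac' cp cFp; rewrite /metric_norm; congr Num.sqrt.
have a1 := chart_at_atlas (F p); have d1 := chart_at_dom (F p).
have Dy0 : cdomain (chart_at (F p)) (cdom c') (coord (chart_at (F p)) (F p)) by exact: cdomain_coord.
rewrite -dot_g_chart_at.
apply: (etrans (local_metric_pull g _ _ a1 ac' Dy0)).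
rewrite (mean_curvature_chart ac ac' cp cFp).
by rewrite /rep !coordK.
Qed.

(** The basis and the preferred charts in the definition of the mean
    curvature vary without any continuity; around p its norm is computed
    instead in the two fixed charts preferred at p and at F p. *)
Lemma continuous_norm_mean_curvature :
  continuous (fun p => metric_norm g (F p) (mean_curvature g F p)).
Proof.
move=> p.
have ac := chart_at_atlas p; have cp := chart_at_dom p.
have ac' := chart_at_atlas (F p); have cFp := chart_at_dom (F p).
set c := chart_at p in ac cp; set c' := chart_at (F p) in ac' cFp.
pose N := local_mean_curvature c c'.
pose D := cdomain c (F @^-1` cdom c').
have oD : open D by exact: (open_rep_dom sF).
have Dp : D (coord c p) by exact: cdomain_coord.
have hN : Ck 0 D N by exact: Ck_local_mean_curvature.
pose q x := dot (local_metric g c' (rep c c' F x)) (N x) (N x).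
have hq : Ck 0 D q.
  apply: (@Ck_ext _ _ _ _ _ (fun x => \sum_a \sum_b
     N x 0 a * local_metric g c' (rep c c' F x) a b * N x 0 b)) => //.
    by move=> x _; rewrite -dotE.
  apply: Ck_sum => // a _; apply: Ck_sum => // b _.
  apply: Ck_mul => //; first apply: Ck_mul => //.
  - exact: (Ck_mxP 0 _ oD).1 hN 0 a.
  - apply: (Ck_comp_rep hF (f := fun y => local_metric g c' y a b)) => //.
    exact: (Ck_local_metric_entry hg).
  - exact: (Ck_mxP 0 _ oD).1 hN 0 b.
have cont : {for p, continuous (fun r => Num.sqrt (q (coord c r)))}.
  apply: (@continuous_comp _ _ _ (fun r => q (coord c r)) Num.sqrt); last exact: sqrt_continuous.
  apply: (@continuous_comp _ _ _ (coord c) q); first exact: Defs.coord_continuous.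
  exact: hq.
have E : \near p, Num.sqrt (q (coord c p)) = metric_norm g (F p) (mean_curvature g F p).
  have oO : open (cdom c `&` F @^-1` cdom c').
    apply: openI; first exact: cdom_open.
    by apply: open_comp; [move=> r _; exact: sF.1|exact: cdom_open].
  have nO : nbhs p (cdom c `&` F @^-1` cdom c') by exact: open_nbhs_nbhs.
  by apply: filterS nO => r [cr cFr]; rewrite (norm_mean_curvature_chart ac ac' cr cFr).
rewrite /continuous_at -(nbhs_singleton E).
by apply: cvg_trans cont; apply: near_eq_cvg.
Qed.

End Continuity.

(** * Functions supported in a chart *)

Section Support.
Context {R : realType}.

(** Near a point of U the extension is f, and near any other point it is
    zero, K being closed. *)
Lemma Ck_extend0 (V : normedModType R) k (U K : set V) (f : V -> R) :
  open U -> closed K -> K `<=` U -> Ck k U f -> (forall x, U x -> ~ K x -> f x = 0) ->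
  Ck k setT (f \_ U).
Proof.
move=> oU cK KU hf f0; apply: Ck_local => x _.
have [Ux|Ux] := pselect (U x).
  exists U; split => //; apply: Ck_ext hf => // y Uy.
  by rewrite patchE mem_set.
exists (~` K); split; [exact: closed_openC|by move=> /KU|].
apply: (@Ck_ext _ _ _ _ _ (fun=> 0)); [exact: closed_openC| |exact: Ck_cst].
move=> y Ky; rewrite patchE; case: ifPn => // /set_mem Uy.
by rewrite f0.
Qed.

Lemma csupp_extend0 n (K : set 'rV[R]_n) (f : 'rV[R]_n -> R) :
  compact K -> Ck 0 setT f -> (forall x, ~ K x -> f x = 0) -> csupp f.
Proof.
move=> cK hf f0.
have [r [_ hr]] : bounded_set K by exact: compact_bounded.
exists (Num.max 0 (r + 1)); first by rewrite le_max lexx.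
split=> [x|x]; first exact: hf.
rewrite gt_max => /andP[_ rx]; apply: f0 => /(hr (r + 1) _).
by rewrite ltrDl ltr01 => /(_ isT) /=; rewrite leNgt rx.
Qed.

Context {n : nat} {L : manifold R n}.

Definition extend c (f : 'rV[R]_n -> R) : L -> R :=
  fun q => if q \in cdom c then f (coord c q) else 0.

Lemma Ck_on_setT k (u : L -> R) :
  Ck_on k setT u <-> forall c, atlas c -> Ck k (cimg c) (u \o cinv c).
Proof.
have E c : cdomain c setT = cimg c by rewrite /cdomain setIT.
by split=> h c ac; have := h c ac; rewrite E.
Qed.

(** This is where the Hausdorff axiom enters: a function supported in a
    compact part of a chart extends by zero to a regular function on the
    whole manifold. *)
Lemma closed_chart_compact (c : chart R L n) K : compact K -> K `<=` cimg c ->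
  closed (cinv c @` K : set L).
Proof.
move=> cK KU; apply: compact_closed; first exact: manifold_hausdorff.
apply: continuous_compact => //.
apply: continuous_in_subspaceT => x /set_mem Kx.
exact: (cinv_continuous (KU _ Kx)).
Qed.

Lemma Ck_on_extend k c K f : atlas c -> compact K -> K `<=` cimg c -> Ck k (cimg c) f ->
  (forall x, cimg c x -> ~ K x -> f x = 0) -> Ck_on k setT (extend c f).
Proof.
move=> ac cK KU hf f0; apply/Ck_on_setT => c' ac'; apply: Ck_local => x cx.
have [qc|qc] := pselect (cdom c (cinv c' x)).
  have oD : open (cdomain c' (cdom c)) by apply: open_cdomain; exact: cdom_open.
  exists (cdomain c' (cdom c)); split => //; first by apply/cdomainP.
  apply: (@Ck_ext _ _ _ _ _ (fun y => f (rep c' c (@id L) y))) => //.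
    by move=> y /cdomainP[cy cy']; rewrite /= /extend mem_set.
  apply: (Ck_comp (U' := cimg c)) => //.
    by move=> y Dy; exact: rep_img.
  exact: (Ck_rep (smooth_map_id L) ac' ac k).
have oK : open (~` (cinv c @` K) : set L) by apply: closed_openC; exact: closed_chart_compact.
exists (cdomain c' (~` (cinv c @` K))); split; first exact: open_cdomain.
  by apply/cdomainP; split => // -[y /KU cy E]; apply: qc; rewrite -E; exact: cdom_cinv.
apply: (@Ck_ext _ _ _ _ _ (fun=> 0)); [exact: open_cdomain| |exact: Ck_cst].
move=> y /cdomainP[cy nK]; rewrite /= /extend; case: ifPn => // /set_mem cq.
rewrite f0//; first exact: cimg_coord.
by move=> Kq; apply: nK; exists (coord c (cinv c' y)) => //; rewrite coordK.
Qed.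

Lemma Ck_on_continuous k (u : L -> R) : Ck_on k setT u -> continuous u.
Proof.
move=> /Ck_on_setT hu p.
have ac := chart_at_atlas p; have cp := chart_at_dom p.
set c := chart_at p in ac cp.
have cont : {for p, continuous (fun q => (u \o cinv c) (coord c q))}.
  apply: (@continuous_comp _ _ _ (coord c) (u \o cinv c)); first exact: Defs.coord_continuous.
  by apply: Ck_continuous (hu c ac) _; exact: cimg_coord.
have E : \near p, (u \o cinv c) (coord c p) = u p.
  have nO : nbhs p (cdom c) by apply: open_nbhs_nbhs; split => //; exact: cdom_open.
  by apply: filterS nO => q cq; rewrite /= coordK.
rewrite /continuous_at -(nbhs_singleton E).
by apply: cvg_trans cont; apply: near_eq_cvg.
Qed.

Lemma Ck_on_mul k U (u v : L -> R) : open U ->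
  Ck_on k U u -> Ck_on k U v -> Ck_on k U (fun p => u p * v p).
Proof.
move=> oU hu hv c ac; apply: (Ck_mul (f := u \o cinv c) (g := v \o cinv c)).
- exact: open_cdomain.
- exact: hu.
- exact: hv.
Qed.

Lemma Ck_on_sum k U (I : Type) (s : seq I) (u : I -> L -> R) : open U ->
  (forall i, Ck_on k U (u i)) -> Ck_on k U (fun p => \sum_(i <- s) u i p).
Proof.
move=> oU hu c ac; apply: (@Ck_sum _ _ _ _ _ _ _ _ (fun i => u i \o cinv c)).
  exact: open_cdomain.
by move=> i _; exact: hu.
Qed.

Lemma Ck_on_inv k U (u : L -> R) : open U -> (forall p, U p -> u p != 0) ->
  Ck_on k U u -> Ck_on k U (fun p => (u p)^-1).
Proof.
move=> oU u0 hu c ac; apply: (Ck_inv (f := u \o cinv c)).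
- exact: open_cdomain.
- by move=> x /cdomainP[_ Ux]; exact: u0.
- exact: hu.
Qed.

(** * Bump functions *)

(** A product over the coordinates, supported in a cube around x0. The third
    power of a positive part is C^2. *)
Definition bump (r : R) (x0 x : 'rV[R]_n) : R :=
  \prod_i pospart (r ^+ 2 - (x 0 i - x0 0 i) ^+ 2) ^+ 3.

Lemma Ck_bump r x0 : Ck 2 setT (bump r x0).
Proof.
apply: Ck_prod; first exact: openT.
move=> i _; apply: (Ck_pos_pow (k := 2) (f := fun x : 'rV[R]_n => r ^+ 2 - (x 0 i - x0 0 i) ^+ 2)).
  exact: openT.
apply: Ck_sub; [exact: openT|exact: Ck_cst|].
have hi : Ck 2 setT (fun x : 'rV[R]_n => x 0 i - x0 0 i).
  apply: Ck_sub; [exact: openT| |exact: Ck_cst].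
  exact: (Ck_mxP 2 _ openT).1 (Ck_id 2 _) 0 i.
exact: (Ck_mul openT hi hi).
Qed.

Lemma bump_ge0 r x0 x : 0 <= bump r x0 x.
Proof. by apply: prodr_ge0 => i _; rewrite exprn_ge0// le_max lexx. Qed.

Lemma bump_center r x0 : 0 < r -> 0 < bump r x0 x0.
Proof.
move=> r0; apply: prodr_gt0 => i _; rewrite exprn_gt0// lt_max.
by rewrite subrr expr0n subr0 exprn_gt0// orbT.
Qed.

Lemma bump_out r x0 x : 0 <= r -> r < `|x - x0| -> bump r x0 x = 0.
Proof.
move=> r0 rx.
have [i hi] : exists i, r < `|(x - x0) 0 i|.
  apply: contrapT => h; move: rx; rewrite ltNge => /negP; apply.
  apply: mx_norm_le => // j i; rewrite (ord1 j) leNgt; apply/negP => hi.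
  by apply: h; exists i.
rewrite /bump (bigD1 i)//= (_ : pospart _ = 0) ?expr0n ?mul0r//.
apply/max_idPl; rewrite subr_le0 -(real_normK (num_real (x 0 i - x0 0 i))).
move: hi; rewrite !mxE => /ltW hi.
by rewrite ler_pXn2r// nnegrE.
Qed.

(** The image of the chart contains a ball around the point; the bump lives
    on the closed ball of half the radius. *)
Lemma bump_exists (p : L) : exists (f : 'rV[R]_n -> R) (K : set 'rV[R]_n),
  [/\ compact K, K `<=` cimg (chart_at p),
      Ck 2 setT f, (forall x, ~ K x -> f x = 0) & (forall x, 0 <= f x) /\
      0 < f (coord (chart_at p) p)].
Proof.
have cp := chart_at_dom p; set c := chart_at p in cp *.
set x0 := coord c p.
have cx0 : cimg c x0 by exact: cimg_coord.
have /nbhs_ballP[d /= d0 hd] : nbhs x0 (cimg c).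
  by apply: open_nbhs_nbhs; split => //; exact: open_cimg.
pose r := d / 2; have r0 : 0 < r by rewrite divr_gt0.
exists (bump r x0), [set x | `|x - x0| <= r]; split.
- apply: bounded_closed_compact.
    exists (r + `|x0|); split; first exact: num_real.
    move=> s rs x /= xr; rewrite (le_trans _ (ltW rs))//.
    by rewrite -{1}(subrK x0 x) (le_trans (ler_normD _ _))// lerD2r.
  rewrite (_ : [set x | _] = (fun x : 'rV[R]_n => `|x - x0|) @^-1` [set s | s <= r]) //.
  apply: closed_comp; last exact: closed_le.
  move=> x _; apply: (@continuous_comp _ _ _ (fun x : 'rV[R]_n => x - x0) (fun x : 'rV[R]_n => `|x|)); last exact: norm_continuous.
  by apply: (@continuousB _ _ _ id (cst x0)); [exact: cvg_id|exact: cst_continuous].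
- move=> x /= xr; apply: hd; rewrite -ball_normE /= distrC (le_lt_trans xr)//.
  by rewrite /r ltr_pdivrMr// ltr_pMr// ltr1n.
- exact: Ck_bump.
- by move=> x /negP; rewrite -ltNge => rx; apply: bump_out => //; exact: ltW.
- by split; [exact: bump_ge0|exact: bump_center].
Qed.

(** * Partitions of unity *)

Definition in_chart (u : L -> R) := exists c (K : set 'rV[R]_n),
  [/\ atlas c, compact K, K `<=` cimg c &
      forall p, ~ (cdom c p /\ K (coord c p)) -> u p = 0].

Lemma in_chart_mul (u v : L -> R) : in_chart u -> in_chart (fun p => u p * v p).
Proof.
move=> [c [K [ac cK KU hu]]]; exists c, K; split => // p /hu ->.
by rewrite mul0r.
Qed.

(** By compactness finitely many bump functions have no common zero; they
    are divided by their sum. Twice differentiable functions are enough, the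
    Laplacian being of order two. *)
Lemma partition_of_unity : compact [set: L] ->
  exists (I : Type) (s : seq I) (chi : I -> L -> R),
  [/\ forall i, Ck_on 2 setT (chi i), forall i, in_chart (chi i),
      forall i p, 0 <= chi i p & forall p, \sum_(i <- s) chi i p = 1].
Proof.
move=> cL.
have /choice[f hf] : forall p : L, exists f : 'rV[R]_n -> R, exists K : set 'rV[R]_n,
  [/\ compact K, K `<=` cimg (chart_at p),
      Ck 2 setT f, (forall x, ~ K x -> f x = 0) & (forall x, 0 <= f x) /\
      0 < f (coord (chart_at p) p)] by exact: bump_exists.
pose b p := extend (chart_at p) (f p).
have bC p : Ck_on 2 setT (b p).
  have [K [cK KU h2 h0 _]] := hf p.
  apply: (Ck_on_extend (K := K)) => //; first exact: chart_at_atlas.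
  - by apply: Ck_subset h2.
  - by move=> x _; exact: h0.
have b0 p q : 0 <= b p q.
  have [K [_ _ _ _ [h _]]] := hf p.
  by rewrite /b /extend; case: ifP.
have bp p : 0 < b p p.
  have [K [_ _ _ _ [_ h]]] := hf p.
  by rewrite /b /extend mem_set//; exact: chart_at_dom.
have bin p : in_chart (b p).
  have [K [cK KU _ h _]] := hf p.
  exists (chart_at p), K; split => //; first exact: chart_at_atlas.
  move=> q nK; rewrite /b /extend; case: ifPn => // /set_mem cq.
  by rewrite h// => Kq; apply: nK.
have ob p : open [set q | 0 < b p q].
  rewrite (_ : [set q | _] = b p @^-1` [set t | 0 < t])//.
  apply: open_comp; last exact: open_gt.
  by move=> q _; exact: (Ck_on_continuous (bC p)).
move: cL; rewrite compact_cover => /(_ L setT (fun p => [set q | 0 < b p q]))[].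
- by move=> p _; exact: ob.
- by move=> q _; exists q => //=; exact: bp.
move=> D _ cov.
pose S q := \sum_(p <- finmap.enum_fset D) b p q.
have S0 q : 0 < S q.
  have [p /= pD bpq] := cov q I.
  rewrite /S (big_rem p)//=; apply: ltr_wpDr => //.
  by apply: sumr_ge0 => i _; exact: b0.
have SC : Ck_on 2 setT (fun q => (S q)^-1).
  apply: Ck_on_inv; [exact: openT|by move=> q _; rewrite gt_eqF|].
  by apply: Ck_on_sum => //; exact: openT.
exists L, (finmap.enum_fset D), (fun p q => b p q * (S q)^-1); split.
- by move=> p; exact: (Ck_on_mul openT (bC p) SC).
- by move=> p; exact: (in_chart_mul (fun q => (S q)^-1) (bin p)).
- by move=> p q; rewrite mulr_ge0// invr_ge0 ltW.
- by move=> q; rewrite -mulr_suml; exact: (mulfV (lt0r_neq0 (S0 q))).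
Qed.

End Support.

(** * Integration on the manifold *)

Section Volume.
Context {R : realType} {n : nat} {L : manifold R n}.
Variables (h : L -> 'M[R]_n) (mu : {measure set (borel L) -> \bar R}).
Hypotheses (hh : riemannian_metric h) (hmu : riemannian_volume h mu).

Lemma continuous_borel (u : L -> R) : continuous u ->
  measurable_fun [set: borel L] (u : borel L -> R).
Proof.
move=> cu.
apply: (measurability _ (RGenOpens.measurableE R)) => // _ [_ [a [b ->]] <-].
rewrite setTI; apply: sub_sigma_algebra.
by apply: open_comp; [move=> p _; exact: cu|exact: interval_open].
Qed.

(** The integrand, in the chart c, of the Riemannian volume integral of w. *)
Definition density c (w : L -> R) : 'rV[R]_n -> R :=
  (fun x => w (cinv c x) * Num.sqrt (\det (local_metric h c x))) \_ (cimg c).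

Lemma csupp_density (c : chart R L n) (K : set 'rV[R]_n) (w : L -> R) : atlas c -> compact K -> K `<=` cimg c -> continuous w ->
  (forall p, ~ (cdom c p /\ K (coord c p)) -> w p = 0) -> csupp (density c w).
Proof.
move=> ac cK KU cw w0.
have oc : open (cimg c) by exact: open_cimg.
have w0' x : cimg c x -> ~ K x -> w (cinv c x) = 0.
  by move=> cx nK; apply: w0 => -[_]; rewrite cinvK.
apply: (csupp_extend0 cK).
  apply: (Ck_extend0 (K := K)) => //.
  - by apply: compact_closed cK; exact: norm_hausdorff.
  - apply: (@Ck_mul _ _ 0 _ (w \o cinv c)) => //.
      move=> x cx; apply: (@continuous_comp _ _ _ (cinv c) w); last exact: cw.
      exact: cinv_continuous.
    apply: Ck_sqrt => //; first by move=> x cx; exact: local_metric_det.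
    by apply: Ck_det => // i j; exact: Ck_local_metric_entry.
  - by move=> x cx nK; rewrite w0'// mul0r.
move=> x nK; rewrite /density patchE; case: ifPn => // /set_mem cx.
by rewrite w0'// mul0r.
Qed.

(** The defining property of the volume measure, for functions supported in
    the chart. *)
Lemma integral_in_chart_ge0 (c : chart R L n) (K : set 'rV[R]_n) (w : L -> R) : atlas c -> compact K -> K `<=` cimg c -> continuous w ->
  (forall p, ~ (cdom c p /\ K (coord c p)) -> w p = 0) -> (forall p, 0 <= w p) ->
  (\int[mu]_p (w p)%:E = (eint (density c w))%:E)%E.
Proof.
move=> ac cK KU cw w0 wge0.
rewrite -eintE; last exact: csupp_density cw w0.
have H := hmu ac (phi := fun p => (w p)%:E).
have -> : EFin \o density c w =
    (fun x => (w (cinv c x))%:E * (Num.sqrt (\det (local_metric h c x)))%:E)%E \_ (cimg c).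
  by apply/funext => x; rewrite /= /density !patchE; case: ifP.
rewrite -H.
- rewrite [RHS]integral_mkcond; apply: eq_integral => p _; rewrite patchE.
  case: ifPn => // /negP nc; rewrite w0// => -[cp _].
  by apply: nc; rewrite inE.
- by apply/measurable_EFinP; exact: continuous_borel.
- by move=> p; rewrite lee_fin.
Qed.

Lemma continuous_fpos (w : L -> R) : continuous w -> continuous (fun p => Num.max (w p) 0).
Proof.
by move=> cw p; apply: (@continuous_max _ _ w (cst 0)); [exact: cw|exact: cst_continuous].
Qed.

(** The volume measure is characterized by nonnegative functions, so w is
    split into its positive and negative parts. *)
Lemma integral_in_chart (c : chart R L n) (K : set 'rV[R]_n) (w : L -> R) : atlas c -> compact K -> K `<=` cimg c -> continuous w ->
  (forall p, ~ (cdom c p /\ K (coord c p)) -> w p = 0) ->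
  mu.-integrable setT (EFin \o w) /\
  (\int[mu]_p w p = eint (density c w))%R.
Proof.
move=> ac cK KU cw w0.
pose wp p := Num.max (w p) 0; pose wn p := Num.max (- w p) 0.
have cwp : continuous wp by exact: continuous_fpos.
have cNw : continuous (fun p => - w p) by move=> p; apply: cvgN; exact: cw.
have cwn : continuous wn by exact: continuous_fpos.
have wp0 p : ~ (cdom c p /\ K (coord c p)) -> wp p = 0.
  by move=> /w0 E; rewrite /wp E maxxx.
have wn0 p : ~ (cdom c p /\ K (coord c p)) -> wn p = 0.
  by move=> /w0 E; rewrite /wn E oppr0 maxxx.
have wpge p : 0 <= wp p by rewrite le_max lexx orbT.
have wnge p : 0 <= wn p by rewrite le_max lexx orbT.
have wE p : w p = wp p - wn p.
  rewrite /wp /wn; have [w0p|wp0p] := leP (w p) 0.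
    by rewrite max_l ?oppr_ge0// opprK add0r.
  by rewrite max_r ?subr0// oppr_le0 ltW.
have Ip := integral_in_chart_ge0 ac cK KU cwp wp0 wpge.
have In := integral_in_chart_ge0 ac cK KU cwn wn0 wnge.
have iwp : mu.-integrable setT (EFin \o wp).
  apply/integrableP; split; first by apply/measurable_EFinP; exact: continuous_borel.
  by under eq_integral do rewrite /= ger0_norm//; rewrite Ip ltry.
have iwn : mu.-integrable setT (EFin \o wn).
  apply/integrableP; split; first by apply/measurable_EFinP; exact: continuous_borel.
  by under eq_integral do rewrite /= ger0_norm//; rewrite In ltry.
have E : EFin \o w = (fun p => (wp p)%:E - (wn p)%:E)%E by apply/funext => p; rewrite /= wE.
split; first by rewrite E; exact: (integrableB measurableT iwp iwn).
transitivity (\int[mu]_p (wp p - wn p))%R; first by apply: eq_Rintegral => p _; rewrite -wE.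
rewrite RintegralB// /Rintegral Ip In /=.
rewrite addrC -mulN1r -eint_lin; last 2 first.
- exact: csupp_density cwn wn0.
- exact: csupp_density cwp wp0.
congr eint; apply/funext => x; rewrite /density !patchE; case: ifP => _; last by rewrite mulr0 addr0.
by rewrite wE; ring.
Qed.

(** * Integral of the Laplacian *)

Lemma hess0 m (G : 'rV[R]_m -> 'M[R]_m) x u v : hess G (fun=> 0) x u v = 0.
Proof.
rewrite /hess derive_cst subr0 (_ : 'D_v _ = cst 0) ?derive_cst//.
by apply/funext => y; rewrite derive_cst.
Qed.

Lemma lapl_near0 m (G : 'rV[R]_m -> 'M[R]_m) (U : set 'rV[R]_m) (f : 'rV[R]_m -> R) x :
  open U -> U x -> (forall y, U y -> f y = 0) -> lapl G f x = 0.
Proof.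
move=> oU Ux f0; rewrite /lapl big1// => i _; rewrite big1// => j _.
by rewrite (hess_ext G _ _ oU Ux f0) hess0 mulr0.
Qed.

Lemma hessD m (G : 'rV[R]_m -> 'M[R]_m) (U : set 'rV[R]_m) (f f' : 'rV[R]_m -> R) x u v :
  open U -> U x -> Ck 2 U f -> Ck 2 U f' ->
  hess G (fun y => f y + f' y) x u v = hess G f x u v + hess G f' x u v.
Proof.
move=> oU Ux hf hf'.
have d w y : U y -> 'D_w (fun y => f y + f' y) y = 'D_w f y + 'D_w f' y.
  by move=> Uy; rewrite derive_add//; [exact: Ck_differentiable hf Uy|exact: Ck_differentiable hf' Uy].
have E : 'D_u ('D_v (fun y => f y + f' y)) x = 'D_u ('D_v f) x + 'D_u ('D_v f') x.
  rewrite -derive_add.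
  - by apply: near_eq_derive; apply: (near_open oU Ux) => y Uy; exact: d.
  - exact: Ck_differentiable (Ck_derive v hf) Ux.
  - exact: Ck_differentiable (Ck_derive v hf') Ux.
apply: (etrans (f_equal2 (fun a b => a - b) E (d _ _ Ux))).
by rewrite /hess opprD addrACA.
Qed.

Lemma laplacianD (u u' : L -> R) p : Ck_on 2 setT u -> Ck_on 2 setT u' ->
  laplacian h (fun q => u q + u' q) p = laplacian h u p + laplacian h u' p.
Proof.
move=> /Ck_on_setT hu /Ck_on_setT hu'; rewrite /laplacian /lapl.
have ac := chart_at_atlas p; have cp := chart_at_dom p.
set c := chart_at p in ac cp *.
have cx := cimg_coord cp.
rewrite -big_split; apply: eq_bigr => i _ /=; rewrite -big_split; apply: eq_bigr => j _ /=.
rewrite -mulrDr; congr (_ * _).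
exact: (hessD _ _ _ (open_cimg (c := c)) cx (hu c ac) (hu' c ac)).
Qed.

Lemma laplacian_sum (I : Type) (s : seq I) (u : I -> L -> R) p :
  (forall i, Ck_on 2 setT (u i)) ->
  laplacian h (fun q => \sum_(i <- s) u i q) p = \sum_(i <- s) laplacian h (u i) p.
Proof.
move=> hu; elim: s => [|i s IH].
  rewrite big_nil /laplacian.
  apply: (@lapl_near0 _ _ setT); [exact: openT|by []|].
  by move=> y _ /=; rewrite big_nil.
rewrite big_cons -IH -laplacianD//; last by apply: Ck_on_sum => //; exact: openT.
by congr laplacian; apply/funext => q; rewrite big_cons.
Qed.

(** Only second derivatives of u and first derivatives of the metric occur. *)
Lemma Ck_lapl c (u : L -> R) : atlas c -> Ck_on 2 setT u ->
  Ck 0 (cimg c) (lapl (local_metric h c) (u \o cinv c)).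
Proof.
move=> ac /Ck_on_setT hu.
have oc : open (cimg c) by exact: open_cimg.
have hG k i j : Ck k (cimg c) (fun y => local_metric h c y i j) by exact: Ck_local_metric_entry.
have uG y : cimg c y -> local_metric h c y \in unitmx by exact: local_metric_unit.
apply: Ck_sum => // i _; apply: Ck_sum => // j _; apply: Ck_mul => //; first exact: Ck_invmx.
have hc := hu c ac.
apply: Ck_sub => //; first exact: Ck_derive (Ck_derive _ hc).
apply: (@Ck_ext _ _ _ _ _ (fun x => \sum_k chr (local_metric h c) x (delta_mx 0 i) (delta_mx 0 j) 0 k *
    partial k (u \o cinv c) x)) => //.
  by move=> x cx; rewrite (derive_partial _ (Ck_differentiable hc cx)).
apply: Ck_sum => // k _; apply: Ck_mul => //.
  apply: (Ck_mxP 0 _ oc).1.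
  apply: (@Ck_chr _ _ _ 0 (local_metric h c) id (fun=> _) (fun=> _) (cimg c) (cimg c) oc oc) => //;
    [exact: Ck_id|exact: Ck_cst|exact: Ck_cst].
exact: Ck_S (Ck_derive _ hc).
Qed.

Lemma continuous_laplacian (u : L -> R) : Ck_on 2 setT u -> continuous (laplacian h u).
Proof.
move=> hu p.
have ac := chart_at_atlas p; have cp := chart_at_dom p.
set c := chart_at p in ac cp.
pose q := lapl (local_metric h c) (u \o cinv c).
have cont : {for p, continuous (fun r => q (coord c r))}.
  apply: (@continuous_comp _ _ _ (coord c) q); first exact: Defs.coord_continuous.
  by apply: (Ck_lapl ac hu); exact: cimg_coord.
have E : \near p, q (coord c p) = laplacian h u p.
  have nO : nbhs p (cdom c) by apply: open_nbhs_nbhs; split => //; exact: cdom_open.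
  by apply: filterS nO => r cr; rewrite (laplacian_chart hh ac cr openT I hu).
rewrite /continuous_at -(nbhs_singleton E).
by apply: cvg_trans cont; apply: near_eq_cvg.
Qed.

(** In the chart, the Laplacian of u times the volume density is the
    divergence of a flux which is C^1 and, extended by zero, has compact
    support; its partial derivatives integrate to zero. *)
Lemma integral_laplacian_in_chart (u : L -> R) : Ck_on 2 setT u -> in_chart u ->
  mu.-integrable setT (EFin \o laplacian h u) /\ (\int[mu]_p laplacian h u p = 0)%R.
Proof.
move=> hu [c [K [ac cK KU u0]]].
have oc : open (cimg c) by exact: open_cimg.
have clK : closed K by apply: compact_closed cK; exact: norm_hausdorff.
have oK : open (~` K) by exact: closed_openC.
have hc : Ck 2 (cimg c) (u \o cinv c) by exact: (Ck_on_setT _ _).1 hu c ac.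
have lap0 p : ~ (cdom c p /\ K (coord c p)) -> laplacian h u p = 0.
  move=> np.
  have oC : open (~` (cinv c @` K) : set L) by apply: closed_openC; exact: closed_chart_compact.
  apply: (lapl_near0 (local_metric h (chart_at p)) (U := cdomain (chart_at p) (~` (cinv c @` K)))).
  - exact: open_cdomain.
  - apply: cdomain_coord; first exact: chart_at_dom.
    move=> [y Ky E]; apply: np; rewrite -E; split; first by apply: cdom_cinv; exact: KU.
    by rewrite cinvK//; exact: KU.
  - move=> y /cdomainP[_ nC] /=; apply: u0 => -[cy Ky]; apply: nC.
    by exists (coord c (cinv (chart_at p) y)) => //; rewrite coordK.
have [il ->] := integral_in_chart ac cK KU (continuous_laplacian hu) lap0.
split=> //.
pose fl i := flux (local_metric h c) (u \o cinv c) i \_ (cimg c).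
have fl0 i x : cimg c x -> ~ K x -> flux (local_metric h c) (u \o cinv c) i x = 0.
  move=> cx nK; rewrite /flux big1 ?mulr0// => j _.
  have oUK : open (cimg c `&` ~` K) by exact: openI.
  have xUK : (cimg c `&` ~` K) x by [].
  rewrite /partial (near_eq_derive (g := cst 0)) ?derive_cst ?mulr0//.
  apply: (near_open oUK xUK) => y [cy nKy] /=.
  by apply: u0 => -[_]; rewrite cinvK.
have flC i : Ck 1 setT (fl i).
  apply: (Ck_extend0 oc clK KU); last exact: fl0.
  apply: Ck_flux => //; first by move=> y cy; exact: local_metric_det.
  by move=> a b; exact: Ck_local_metric_entry.
have flK i x : ~ K x -> fl i x = 0.
  move=> nK; rewrite /fl patchE; case: ifPn => // /set_mem cx.
  exact: fl0.
have DflK i x : ~ K x -> 'D_(delta_mx 0 i) (fl i) x = 0.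
  move=> nK; rewrite (near_eq_derive (g := cst 0)) ?derive_cst//.
  by apply: (near_open oK nK) => y; exact: flK.
have cfl i : csupp (fl i) by apply: (csupp_extend0 cK); [exact: Ck_S (flC i)|exact: flK].
have cDfl i : csupp ('D_(delta_mx 0 i) (fl i)).
  by apply: (csupp_extend0 cK); [exact: Ck_derive (flC i)|exact: DflK].
have -> : density c (laplacian h u) = fun x => \sum_i 'D_(delta_mx 0 i) (fl i) x.
  apply/funext => x; rewrite /density patchE; case: ifPn => [/set_mem cx|/negP ncx]; last first.
    rewrite big1// => i _; apply: DflK => /KU cx; apply: ncx; exact: mem_set.
  rewrite (laplacian_chart hh ac (cdom_cinv cx) openT I hu) cinvK//.
  rewrite (lapl_div oc cx _ _ _ hc).
  - apply: eq_bigr => i _; apply: near_eq_derive; apply: (near_open oc cx) => y cy.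
    by rewrite /fl patchE mem_set.
  - by move=> y cy; exact: local_metric_det.
  - exact: local_metric_sym.
  - by move=> i j; exact: Ck_local_metric_entry.
rewrite eint_sum// big1// => i _; apply: eint_derive => // x.
exact: Ck_differentiable (flC i) _.
Qed.

Lemma Rintegral_sum (I : Type) (s : seq I) (w : I -> L -> R) :
  (forall i, mu.-integrable setT (EFin \o w i)) ->
  mu.-integrable setT (EFin \o (fun p => \sum_(i <- s) w i p)) /\
  (\int[mu]_p (\sum_(i <- s) w i p) = \sum_(i <- s) \int[mu]_p w i p)%R.
Proof.
move=> hw; elim: s => [|i s [IH1 IH2]].
  have E : (fun p : L => \sum_(i <- [::]) w i p) = fun=> 0 by apply/funext => p; rewrite big_nil.
  split; first by rewrite E; exact: integrable0.
  by rewrite big_nil E Rintegral_cst// mul0r.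
have E : (fun p => \sum_(j <- i :: s) w j p) = fun p => w i p + \sum_(j <- s) w j p.
  by apply/funext => p; rewrite big_cons.
split.
  by rewrite E; exact: (integrableD measurableT (hw i) IH1).
by rewrite E RintegralD// IH2 big_cons.
Qed.

Hypothesis cL : compact [set: L].

(** Divergence theorem: for a partition of unity chi, the Laplacian of u is
    the sum of the Laplacians of the chi i * u, each supported in one chart. *)
Lemma integral_laplacian (u : L -> R) : Ck_on 2 setT u ->
  mu.-integrable setT (EFin \o laplacian h u) /\ (\int[mu]_p laplacian h u p = 0)%R.
Proof.
move=> hu; have [I [s [chi [chiC chi_in _ chi1]]]] := partition_of_unity cL.
pose v i p := chi i p * u p.
have vC i : Ck_on 2 setT (v i) by exact: (Ck_on_mul openT (chiC i) hu).
have vin i : in_chart (v i) by exact: (in_chart_mul u (chi_in i)).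
have E : laplacian h u = fun p => \sum_(i <- s) laplacian h (v i) p.
  apply/funext => p; rewrite -laplacian_sum//; congr laplacian; apply/funext => q.
  by rewrite -mulr_suml chi1 mul1r.
have iv i := (integral_laplacian_in_chart (vC i) (vin i)).1.
have [h1 h2] := Rintegral_sum s iv.
rewrite E; split => //; rewrite h2 big1// => i _.
exact: (integral_laplacian_in_chart (vC i) (vin i)).2.
Qed.

Lemma integral_in_chart_gt0 (w : L -> R) p : continuous w -> in_chart w ->
  (forall p, 0 <= w p) -> 0 < w p -> (0 < \int[mu]_p (w p)%:E)%E.
Proof.
move=> cw [c [K [ac cK KU w0]]] wge0 wp.
rewrite (integral_in_chart_ge0 ac cK KU cw w0 wge0) lte_fin.
have [cp Kp] : cdom c p /\ K (coord c p).
  by apply: contrapT => /w0 E; rewrite E ltxx in wp.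
have cx := cimg_coord cp.
apply: (eint_gt0 (x0 := coord c p)).
- exact: csupp_density cw w0.
- move=> x; rewrite /density patchE; case: ifP => // _.
  by rewrite mulr_ge0// sqrtr_ge0.
- rewrite /density patchE mem_set// coordK// mulr_gt0// sqrtr_gt0.
  exact: local_metric_det.
Qed.

(** The volume is the sum of the integrals of the functions of a partition
    of unity; these are finite, and if the volume were zero they would all
    vanish identically. *)
Lemma volume_finite : exists2 V : R, 0 < V & mu setT = V%:E.
Proof.
have [J [s [chi [chiC chi_in chi0 chi1]]]] := partition_of_unity cL.
have chic i : continuous (chi i) by exact: Ck_on_continuous (chiC i).
have mchi i : measurable_fun [set: borel L] (EFin \o chi i).
  by apply/measurable_EFinP; exact: continuous_borel.
have E : (mu setT = \sum_(i <- s) \int[mu]_p (chi i p)%:E)%E.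
  rewrite -ge0_integral_sum//; last by move=> i p _; rewrite lee_fin.
  rewrite -[LHS]mul1e -integral_cst//; apply: eq_integral => p _ /=.
  by rewrite -(chi1 p) sumEFin.
have fin i : (\int[mu]_p (chi i p)%:E)%E \is a fin_num.
  have [c [K [ac cK KU w0]]] := chi_in i.
  by rewrite (integral_in_chart_ge0 ac cK KU (chic i) w0 (chi0 i)).
have muE : mu setT \is a fin_num.
  by rewrite E; elim/big_ind : _ => // x y fx fy; rewrite fin_numD fx.
exists (fine (mu setT)); last by rewrite fineK.
rewrite fine_gt0//; apply/andP; split; last by rewrite ltey_eq muE.
rewrite lt0e measure_ge0 andbT; apply/eqP => mu0.
have chi_null i q : chi i q = 0.
  apply/eqP; apply: contraT => n0.
  have qpos : 0 < chi i q by rewrite lt_neqAle eq_sym n0 chi0.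
  have := integral_in_chart_gt0 (chic i) (chi_in i) (chi0 i) qpos.
  have -> : (\int[mu]_p (chi i p)%:E = 0)%E by apply: null_set_integral => //; exact: mchi.
  by rewrite ltxx.
have := chi1 point; rewrite big1 => [/eqP|i _]; last exact: chi_null.
by rewrite eq_sym oner_eq0.
Qed.

Lemma continuous_integrable (w : L -> R) : continuous w -> mu.-integrable setT (EFin \o w).
Proof.
move=> cw; have [V V0 muV] := volume_finite.
apply: measurable_bounded_integrable => //.
- by rewrite muV ltry.
- exact: continuous_borel.
- have cwL : compact (w @` setT).
    by apply: continuous_compact => //; exact: continuous_subspaceT.
  have [M [Mr hM]] := compact_bounded cwL.
  exists M; split => // x Mx p _ /=.
  by apply: (hM x Mx); exists p.
Qed.

End Volume.

(** * The mean curvature bound *)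

Section Comparison.
Context {R : realType} {n m : nat} {L : manifold R n} {M : manifold R m}.
Variables (g : M -> 'M[R]_m) (F : L -> M).
Hypotheses (hg : riemannian_metric g) (hF : immersion F).

Lemma dotNN k (B : 'M[R]_k) (u v : 'rV[R]_k) : dot B (- u) (- v) = dot B u v.
Proof. by rewrite /dot linearN !mulNmx mulmxN opprK. Qed.

Lemma dot_combination k (B : 'M[R]_k) (u v : 'rV[R]_k) (a b : R) :
  dot B (a *: v + b *: u) (a *: v + b *: u) =
  a * (a * dot B v v + b * dot B v u) + b * (a * dot B u v + b * dot B u u).
Proof. by rewrite !(dotDl, dotDr) !(dotZl, dotZr) !mulrDr !mulrA. Qed.

(** The form is nonnegative on the combination of u and v orthogonal to u. *)
Lemma posdef_cauchy_schwarz k (B : 'M[R]_k) u v : posdef B ->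
  dot B u v <= Num.sqrt (dot B u u) * Num.sqrt (dot B v v).
Proof.
move=> pB.
have [->|u0] := eqVneq u 0; first by rewrite !dot0l sqrtr0 mul0r.
have uu := pB.2 u u0.
have sy : dot B v u = dot B u v by exact: dot_sym pB.1.
have Q : dot B u v ^+ 2 <= dot B u u * dot B v v.
  have := posdef_ge0 (dot B u u *: v + (- dot B u v) *: u) pB.
  rewrite dot_combination sy.
  move: uu; move: (dot B u u) (dot B u v) (dot B v v) => a b c a0.
  rewrite (_ : _ + _ = a * (a * c - b ^+ 2)); last by ring.
  by rewrite pmulr_rge0// subr_ge0.
apply: (le_trans (ler_norm _)).
rewrite -sqrtrM ?(ltW uu)// -(sqrtr_sqr (dot B u v)).
by rewrite ler_wsqrtr.
Qed.

(** The matrix of the metric is invertible, so the differential is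
    represented by a vector and the gradient is not the default value. *)
Lemma gradE (f : M -> R) U q v : open U -> U q -> Ck_on 1 U f ->
  dfun f q v = dot (g q) (grad g f q) v.
Proof.
move=> oU Uq hf.
have ac := chart_at_atlas q; have dc := chart_at_dom q.
have df : differentiable (f \o cinv (chart_at q)) (coord (chart_at q) q).
  by apply: Ck_differentiable (hf _ ac) _; exact: cdomain_coord.
rewrite /grad; case: xgetP => [w _ ->//|none].
have pg := metric_posdef hg q.
pose d : 'rV[R]_m := \row_i partial i (f \o cinv (chart_at q)) (coord (chart_at q) q).
have [] := none (d *m invmx (g q)).
move=> w; rewrite /dot mulmxKV ?posdef_unit// mxE /dfun derive_partial//.
by apply: eq_bigr => i _; rewrite !mxE mulrC.
Qed.

(** The trace of the ambient Hessian over the tangent space of L at p is one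
    of the traces in the infimum, and the derivative of f along the mean
    curvature is at least minus its norm, by Cauchy-Schwarz and the bound on
    the gradient. *)
Lemma laplacian_lower_bound (f : M -> R) U Omega p (A : R) :
  open U -> Omega `<=` U -> Ck_on 2 U f -> Omega (F p) ->
  metric_norm g (F p) (grad g f (F p)) <= 1 ->
  (A%:E <= hess_trace_inf g n f Omega)%E ->
  A <= laplacian (induced_metric g F) (f \o F) p +
       metric_norm g (F p) (mean_curvature g F p).
Proof.
move=> oU OU hf Op gf hA.
have Up : U (F p) by exact: OU.
have [e he HE] := mean_curvatureE hg hF p.
rewrite (laplacian_restriction hF he HE oU Up hf (Ck_on_comp hF oU hf)).
pose e' : n.-tuple 'rV[R]_m := [tuple dmap F p (tnth e a) | a < n].
have he' a b : dot (g (F p)) (tnth e' a) (tnth e' b) = (a == b)%:R.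
  by rewrite !tnth_mktuple -he (induced_metricE g hF).
have fe' := orthonormal_free he'.
have hAT : A <= \sum_a hessian g f (F p) (dmap F p (tnth e a)) (dmap F p (tnth e a)).
  rewrite -lee_fin; apply: (le_trans hA); apply: ereal_inf_lbound.
  exists (F p), <<e'>>%VS, e'; split => //.
  - by move: fe'; rewrite /free size_tuple => /eqP.
  - by split => //; rewrite basisEdim subvv /= (eqP fe').
  - by congr (_%:E); apply: eq_bigr => a _; rewrite tnth_mktuple.
set H := mean_curvature g F p.
have hH : - dfun f (F p) H <= metric_norm g (F p) H.
  have hf1 : Ck_on 1 U f by move=> c ac; exact: Ck_S (hf c ac).
  rewrite (gradE H oU Up hf1) -dotNl.
  apply: le_trans (posdef_cauchy_schwarz _ _ (metric_posdef hg (F p))) _.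
  rewrite dotNN.
  by rewrite -[leRHS]mul1r ler_wpM2r// sqrtr_ge0.
by lra.
Qed.

End Comparison.

Theorem mainTheorem7 (R : realType) (m n : nat) (M : manifold R m)
    (g : M -> 'M[R]_m) (L : manifold R n) (iota : L -> M)
    (dV : {measure set (borel L) -> \bar R}) (Omega : set M)
    (hg : riemannian_metric g)
    (hn : (0 < n)%N)
    (hL : compact [set: L])
    (hiota : immersion iota)
    (hdV : riemannian_volume (induced_metric g iota) dV)
    (hOmega : range iota `<=` Omega) :
  (Theta g n Omega <=
     (ave dV (fun p => metric_norm g (iota p) (mean_curvature g iota p)))%:E)%E.
Proof.
apply: ge_ereal_sup => _ [f [[U [oU OU sf]] gf] <-].
have hf k : Ck_on k U f by move=> c ac; exact: sf.
have hh := riemannian_induced hg hiota.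
have Oi p : Omega (iota p) by apply: hOmega; exists p.
have gf1 p : metric_norm g (iota p) (grad g f (iota p)) <= 1.
  rewrite -lee_fin; apply: le_trans gf; apply: ereal_sup_ubound.
  by exists (iota p).
pose phi p := metric_norm g (iota p) (mean_curvature g iota p).
pose lap := laplacian (induced_metric g iota) (f \o iota).
have key (A : R) p : (A%:E <= hess_trace_inf g n f Omega)%E -> A <= lap p + phi p.
  move=> hA; exact: (laplacian_lower_bound hg hiota oU OU (hf 2) (Oi p) (gf1 p) hA).
have hu : Ck_on 2 setT (f \o iota).
  have -> : [set: L] = iota @^-1` U by apply/esym; rewrite -subTset => p _; exact/OU/Oi.
  exact: (Ck_on_comp hiota oU (hf 2)).
have [ilap lap0] := integral_laplacian hh hdV hL hu.
have [V V0 muV] := volume_finite hh hdV hL.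
have iphi : dV.-integrable setT (EFin \o phi).
  apply: (continuous_integrable hh hdV hL).
  exact: (continuous_norm_mean_curvature hg hiota).
have bound (A : R) : (A%:E <= hess_trace_inf g n f Omega)%E -> A <= ave dV phi.
  move=> hA; rewrite /ave muV /= mulrC ler_pdivlMr//.
  have -> : A * V = (\int[dV]_p A)%R by rewrite Rintegral_cst// muV.
  have -> : (\int[dV]_p phi p = \int[dV]_p (lap p + phi p))%R.
    by rewrite RintegralD// lap0 add0r.
  apply: le_Rintegral => //.
  - apply: (continuous_integrable hh hdV hL (w := cst A)).
    by move=> p; exact: cst_continuous.
  - exact: (integrableD measurableT ilap iphi).
  - by move=> p _; exact: key.
(* An infimum equal to +oo would bound the average below by every real
   number. *)
case E : (hess_trace_inf g n f Omega) => [A| |].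
- by rewrite lee_fin; apply: bound; rewrite E.
- have := bound (ave dV phi + 1); rewrite E leey => /(_ isT).
  by rewrite gerDl ler10.
- by rewrite leNye.
Qed.
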